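(* Let $\Omega\subseteq\mathbb{C}^d$ be a bounded, convex, balanced domain, and let $\mathcal{V}$ be an analytic subvariety of $\Omega$ that is relatively polynomially convex in $\Omega$. Assume there is an isometric linear extension operator $E: H^\infty(\mathcal{V})\to H^\infty(\Omega)$, i.e. $E$ is linear, $(Ef)|_{\mathcal{V}} = f$ and $\sup_{\Omega}|Ef| = \sup_{\mathcal{V}}|f|$ for every $f\in H^\infty(\mathcal{V})$. If any one of the following holds: (i) $\Omega$ is the polydisk $\mathbb{D}^d$; (ii) $\Omega$ is strictly convex; (iii) $E$ is multiplicative ($E(fg) = E(f)E(g)$ for all $f,g\in H^\infty(\mathcal{V})$), then $\mathcal{V}$ is a retract of $\Omega$.
   Context: $\mathbb{D}$ is the open unit disk. A domain $\Omega$ is balanced if $\lambda\Omega\subseteq\Omega$ for every $\lambda$ in the closed unit disk. An analytic subvariety of $\Omega$ is a relatively closed set $\mathcal{V}\subseteq\Omega$ such that each point of $\mathcal{V}$ has an open neighborhood $U$ and holomorphic $f_1,\dots,f_m$ on $U$ with $\mathcal{V}\cap U = \{\mu\in U: f_i(\mu)=0 \ \forall i\}$. A function on $\mathcal{V}$ is holomorphic if near each point of $\mathcal{V}$ it is the restriction of a holomorphic function defined on an open set of $\mathbb{C}^d$; $H^\infty(\mathcal{V})$ is the space of bounded holomorphic functions on $\mathcal{V}$ with the supremum norm, and $H^\infty(\Omega)$ likewise. $\mathcal{V}$ is relatively polynomially convex in $\Omega$ if for every $\lambda\in\Omega\setminus\mathcal{V}$ there is a polynomial $p$ with $|p(\lambda)|>\sup_{\mu\in\mathcal{V}}|p(\mu)|$.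 $\Omega$ is strictly convex if for every boundary point $\lambda$ there is a (real) hyperplane in $\mathbb{C}^d$ whose intersection with $\overline{\Omega}$ is $\{\lambda\}$. $\mathcal{V}$ is a retract of $\Omega$ if there is a holomorphic $r:\Omega\to\Omega$ with $r(\Omega)=\mathcal{V}$ and $r|_{\mathcal{V}}=\mathrm{id}_{\mathcal{V}}$. *)

(* Defs.v *)
From HB Require Import structures.
From mathcomp Require Import all_boot all_order all_algebra.
From mathcomp Require Import reals complex mpoly.
Import GRing.Theory Num.Theory.
Set Implicit Arguments. Unset Strict Implicit. Unset Printing Implicit Defensive.
Local Open Scope ring_scope.

Section Defs.
Variables (R : realType) (d : nat).
Local Notation C := R[i].

Definition pt := 'I_d -> C.
Definition cset := pt -> Prop.

Definition rC (x : R) : C := (x%:C)%C.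

Definition cball (z : pt) (e : R) : cset := fun w => forall i, `|w i - z i| < rC e.

Definition is_open (U : cset) : Prop :=
  forall z, U z -> exists e : R, 0 < e /\ forall w, cball z e w -> U w.

Definition is_connected (U : cset) : Prop :=
  forall A B : cset, is_open A -> is_open B ->
    (forall z, U z -> A z \/ B z) ->
    (exists z, U z /\ A z) -> (exists z, U z /\ B z) ->
    exists z, U z /\ A z /\ B z.

Definition domain (U : cset) : Prop :=
  is_open U /\ (exists z, U z) /\ is_connected U.

Definition bounded_set (U : cset) : Prop :=
  exists M : R, forall z, U z -> forall i, `|z i| <= rC M.

Definition convex_set (U : cset) : Prop :=
  forall x y (t : R), U x -> U y -> 0 <= t -> t <= 1 ->
    U (fun i => rC t * x i + rC (1 - t) * y i).

Definition balanced (U : cset) : Prop :=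
  forall lam : C, `|lam| <= 1 -> forall z, U z -> U (fun i => lam * z i).

Definition closure (U : cset) : cset :=
  fun z => forall e : R, 0 < e -> exists w, U w /\ cball z e w.

(* boundary point (U will be open, so closure minus U is the boundary) *)
Definition boundary (U : cset) : cset := fun z => closure U z /\ ~ U z.

(* every real hyperplane of C^d = R^{2d} is {w | Re (sum_i a_i w_i) = c}
   with a <> 0, c real *)
Definition real_hyperplane (a : pt) (c : R) : cset :=
  fun w => complex.Re (\sum_(i < d) a i * w i) = c.

Definition strictly_convex (U : cset) : Prop :=
  forall z, boundary U z ->
    exists (a : pt) (c : R), (exists i, a i != 0) /\
      forall w, (real_hyperplane a c w /\ closure U w) <-> w = z.

Definition polydisk : cset := fun z => forall i, `|z i| < 1.

Definition holomorphic (U : cset) (f : pt -> C) : Prop :=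
  is_open U /\
  forall a, U a -> exists c : pt, forall e : R, 0 < e ->
    exists del : R, 0 < del /\
      forall h : pt, (forall i, `|h i| < rC del) -> U (fun i => a i + h i) ->
        `|f (fun i => a i + h i) - f a - \sum_(i < d) c i * h i|
          <= rC e * \sum_(i < d) `|h i|.

Definition analytic_subvariety (Om V : cset) : Prop :=
  (forall z, V z -> Om z) /\
  (forall z, Om z -> closure V z -> V z) /\
  forall p, V p -> exists U : cset, is_open U /\ U p /\
    exists (m : nat) (F : 'I_m -> pt -> C),
      (forall k, holomorphic U (F k)) /\
      forall w, U w -> (V w <-> forall k, F k w = 0).

Definition holomorphic_on_var (V : cset) (f : pt -> C) : Prop :=
  forall p, V p -> exists (U : cset) (F : pt -> C),
    U p /\ holomorphic U F /\ forall w, U w -> V w -> F w = f w.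

Definition bounded_on (S : cset) (f : pt -> C) : Prop :=
  exists M : R, forall z, S z -> `|f z| <= rC M.

(* H^oo(V) and H^oo(Om) (functions represented as total functions on C^d,
   only their values on V, resp. Om, matter) *)
Definition Hinf_var (V : cset) (f : pt -> C) : Prop :=
  holomorphic_on_var V f /\ bounded_on V f.

Definition Hinf (Om : cset) (f : pt -> C) : Prop :=
  holomorphic Om f /\ bounded_on Om f.

Definition rel_poly_convex (Om V : cset) : Prop :=
  forall l, Om l -> ~ V l ->
    exists (p : {mpoly C[d]}) (c : R),
      rC c < `|p.@[l]| /\ forall mu, V mu -> `|p.@[mu]| <= rC c.

(* E : H^oo(V) -> H^oo(Om) isometric linear extension operator.
   sup_Om |Ef| = sup_V |f| is expressed as: both have the same real upper
   bounds. *)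
Definition isometric_extension_operator (Om V : cset)
    (E : (pt -> C) -> (pt -> C)) : Prop :=
  (forall f g, Hinf_var V f -> Hinf_var V g -> (forall z, V z -> f z = g z) ->
     forall z, Om z -> E f z = E g z) /\
  (forall f, Hinf_var V f -> Hinf Om (E f)) /\
  (forall (a : C) f g, Hinf_var V f -> Hinf_var V g -> forall z, Om z ->
     E (fun w => a * f w + g w) z = a * E f z + E g z) /\
  (forall f, Hinf_var V f -> forall z, V z -> E f z = f z) /\
  (forall f, Hinf_var V f -> forall M : R,
     (forall z, Om z -> `|E f z| <= rC M) <-> (forall z, V z -> `|f z| <= rC M)).

Definition multiplicative_op (Om V : cset) (E : (pt -> C) -> (pt -> C)) : Prop :=
  forall f g, Hinf_var V f -> Hinf_var V g -> forall z, Om z ->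
    E (fun w => f w * g w) z = E f z * E g z.

Definition retract (Om V : cset) : Prop :=
  exists r : pt -> pt,
    (forall k, holomorphic Om (fun z => r z k)) /\
    (forall z, Om z -> Om (r z)) /\
    (forall z, Om z -> V (r z)) /\
    (forall v, V v -> exists z, Om z /\ r z = v) /\
    (forall z, V z -> r z = z).

End Defs.

(* Main.v *)
(* Let r = (E z_1, ..., E z_d).  It fixes V pointwise, and since a linear functional
   and its extension have the same bound, Hahn-Banach and the maximum principle give
   r(Om) <= Om.  By relative polynomial convexity it suffices to find a holomorphic
   self-map s of Om fixing V with |P(s z)| <= sup_V |P| for all polynomials P.

   If E is multiplicative, E P = P o r, and s = r works.

   If Om is strictly convex, a point of the boundary that is a limit of values of r
   is a limit of points of V.  With the maximum principle this shows that every
   limit of the iterates r^n can be taken as s.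

   In the polydisk, let J be a minimal set of coordinates such that some self-map s
   fixing V depends only on z_J.  If (r o s)_i were different from z_i for some i in
   J, then on V the i-th coordinate would be the attracting fixed point of an
   averaged slice map determined by the other coordinates, against minimality.  So
   f |-> E f o s maps z_i to z_i for i in J; the functional f |-> E f (s z) is then
   concentrated near w_i = z_i when |z_i| is close to 1, and the maximum principle
   yields E(z_i f) o s = z_i (E f o s).  If P(s z0) - P(s v) were bounded away from 0
   for v in V, its reciprocal g would be holomorphic on V; but telescoping over the
   coordinates, (P o s - P(s z0))^n is a combination of the z_i - z0_i, i in J, with
   bounded holomorphic coefficients, so f |-> E f (s z0) would kill 1.

   Limits along a fixed ultrafilter on nat replace Montel's theorem: along it every
   uniformly bounded sequence of holomorphic functions converges, and the limit is
   holomorphic. *)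

From HB Require Import structures.
From mathcomp Require Import all_boot all_order all_algebra.
From mathcomp Require Import reals complex.
From mathcomp Require mpoly.
From mathcomp Require Import boolp classical_sets filter topology normedtype.
From mathcomp Require Import constructive_ereal measure lebesgue_measure lebesgue_integral.
From mathcomp Require Import ring lra.
Require Import Defs.
Import Order.TTheory GRing.Theory Num.Theory numFieldNormedType.Exports.
Set Implicit Arguments. Unset Strict Implicit. Unset Printing Implicit Defensive.
Local Open Scope ring_scope.

(** * Modulus and complex derivatives *)

Section Modulus.
Variable R : realType.
Implicit Types z w : R[i].

(** All the complex analysis used here rests on one estimate: |f'(0)| <= 2 M when |f| <= M on the
    disc of radius 2, obtained from Goursat's theorem on squares. Applied to rescaled functions, to
    differences of translates and to powers, it gives Lipschitz and second-order Taylor bounds whose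
    constants depend only on sup |f|. This uniformity is what makes pointwise limits along the
    ultrafilter holomorphic and lets the powers of f detect a maximum. Where a quotient is singular,
    surplus powers in the numerator (n + 2 over n, a cube over a linear factor) make it
    differentiable by inspection.

    The obstacle in the polydisk is that the functional f |-> E f (s z0) is only known to respect
    multiplication by the coordinates z_i with i in J, so E P cannot simply be evaluated there. The
    radical of an ideal contained in its kernel takes the place of multiplicativity. *)

Definition cabs z : R := Num.sqrt (complex.Re z ^+ 2 + complex.Im z ^+ 2).

(** In [R[i]] the norm is itself a complex number, compared in a partial order; this rewriting moves
    every estimate to the ordered field [R]. *)
Lemma normcE_cabs z : `|z| = rC (cabs z).
Proof. exact: normc_def. Qed.

Lemma rC_le (x y : R) : (rC x <= rC y) = (x <= y).
Proof. by rewrite /rC lecR. Qed.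

Lemma rC_lt (x y : R) : (rC x < rC y) = (x < y).
Proof. by rewrite /rC ltcR. Qed.

Lemma rC_inj : injective (@rC R).
Proof. by move=> x y []. Qed.

Lemma rCD (x y : R) : rC (x + y) = rC x + rC y.
Proof. exact: rmorphD. Qed.

Lemma rCM (x y : R) : rC (x * y) = rC x * rC y.
Proof. exact: rmorphM. Qed.

Lemma rCN (x : R) : rC (- x) = - rC x.
Proof. exact: rmorphN. Qed.

Lemma rCB (x y : R) : rC (x - y) = rC x - rC y.
Proof. exact: rmorphB. Qed.

Lemma rC1 : rC (1 : R) = 1.
Proof. by []. Qed.

Lemma cabs_ge0 z : 0 <= cabs z.
Proof. exact: sqrtr_ge0. Qed.

Lemma cabsM z w : cabs (z * w) = cabs z * cabs w.
Proof. by apply: rC_inj; rewrite rCM -!normcE_cabs normrM. Qed.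

Lemma cabsD z w : cabs (z + w) <= cabs z + cabs w.
Proof. by rewrite -rC_le rCD -!normcE_cabs ler_normD. Qed.

Lemma cabsN z : cabs (- z) = cabs z.
Proof. by apply: rC_inj; rewrite -!normcE_cabs normrN. Qed.

Lemma cabsB z w : cabs (z - w) <= cabs z + cabs w.
Proof. by rewrite (le_trans (cabsD _ _))// cabsN. Qed.

Lemma cabsC z w : cabs (z - w) = cabs (w - z).
Proof. by rewrite -cabsN opprB. Qed.

Lemma cabs_tri (u z w : R[i]) : cabs (z - w) <= cabs (z - u) + cabs (u - w).
Proof. by apply: le_trans (cabsD _ _); rewrite addrA subrK. Qed.

Lemma cabs_ger z w : cabs z - cabs w <= cabs (z - w).
Proof. by rewrite lerBlDr -{1}(subrK w z) cabsD. Qed.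

Lemma cabs0 : cabs 0 = 0.
Proof. by apply: rC_inj; rewrite -normcE_cabs normr0. Qed.

Lemma cabs1 : cabs 1 = 1.
Proof. by apply: rC_inj; rewrite -normcE_cabs normr1. Qed.

Lemma cabs_eq0 z : (cabs z == 0) = (z == 0).
Proof. by rewrite -(inj_eq rC_inj) -normcE_cabs normr_eq0. Qed.

Lemma cabs_gt0 z : (0 < cabs z) = (z != 0).
Proof. by rewrite lt_def cabs_ge0 andbT cabs_eq0. Qed.

Lemma cabsX z n : cabs (z ^+ n) = cabs z ^+ n.
Proof. by elim: n => [|n IH]; rewrite ?expr0 ?cabs1// !exprS cabsM IH. Qed.

Lemma cabsV z : cabs z^-1 = (cabs z)^-1.
Proof.
by apply: rC_inj; rewrite -normcE_cabs normfV normcE_cabs /rC fmorphV.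
Qed.

Lemma cabs_rC (x : R) : cabs (rC x) = `|x|.
Proof. by rewrite /cabs /= expr0n addr0 sqrtr_sqr. Qed.

Lemma cabs_two : cabs 2 = 2.
Proof. by rewrite (_ : 2 = rC 2) ?cabs_rC ?ger0_norm// /rC rmorph_nat. Qed.

Lemma cabs_sum n (F : 'I_n -> R[i]) (P : pred 'I_n) :
  cabs (\sum_(i | P i) F i) <= \sum_(i | P i) cabs (F i).
Proof.
elim/big_ind2 : _ => [|x1 x2 y1 y2 h1 h2|//]; first by rewrite cabs0.
by rewrite (le_trans (cabsD _ _))// lerD.
Qed.

Lemma cabs_sqr z : cabs z ^+ 2 = complex.Re z ^+ 2 + complex.Im z ^+ 2.
Proof. by rewrite sqr_sqrtr// addr_ge0// sqr_ge0. Qed.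

Lemma Re_le_cabs z : `|complex.Re z| <= cabs z.
Proof. by rewrite -sqrtr_sqr ler_wsqrtr// lerDl sqr_ge0. Qed.

Lemma Im_le_cabs z : `|complex.Im z| <= cabs z.
Proof. by rewrite -sqrtr_sqr ler_wsqrtr// lerDr sqr_ge0. Qed.

Lemma cabs_le_ReIm z : cabs z <= `|complex.Re z| + `|complex.Im z|.
Proof.
rewrite -(@ler_pXn2r _ 2)// ?nnegrE ?cabs_ge0 ?addr_ge0//.
rewrite cabs_sqr sqrrD !real_normK ?num_real//.
by rewrite addrAC lerDl mulrn_wge0// mulr_ge0.
Qed.

Lemma sqr_cabs_conj z : rC (cabs z ^+ 2) = z * conjc z.
Proof. by rewrite /rC rmorphXn /= -[(_)%:C%C]normc_def sqr_normc. Qed.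

Lemma cabs_conj z : cabs (conjc z) = cabs z.
Proof. by apply: rC_inj; rewrite -!normcE_cabs normcJ. Qed.

Lemma cReD z w : complex.Re (z + w) = complex.Re z + complex.Re w.
Proof. by case: z; case: w. Qed.

Lemma cImD z w : complex.Im (z + w) = complex.Im z + complex.Im w.
Proof. by case: z; case: w. Qed.

Lemma cReB z w : complex.Re (z - w) = complex.Re z - complex.Re w.
Proof. by case: z; case: w. Qed.

Lemma cImB z w : complex.Im (z - w) = complex.Im z - complex.Im w.
Proof. by case: z; case: w. Qed.

Lemma cReM z w : complex.Re (z * w) =
  complex.Re z * complex.Re w - complex.Im z * complex.Im w.
Proof. by case: z; case: w. Qed.

Lemma cImM z w : complex.Im (z * w) =
  complex.Re z * complex.Im w + complex.Im z * complex.Re w.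
Proof. by case: z; case: w. Qed.

End Modulus.

(** * First-order expansions with respect to a size function *)

Section LittleO.
Variables (R : realType) (X : Type) (N : X -> R).
Hypothesis N_ge0 : forall h, 0 <= N h.
Implicit Types (f g L : X -> R[i]) (v w k : R[i]).

(** The size function [N] stays abstract so that one calculus of expansions serves both [cabs] on
    the plane and [l1norm] in several variables. *)
Definition little_o f := forall e : R, 0 < e -> exists2 del, 0 < del &
  forall h, N h < del -> cabs (f h) <= e * N h.

Definition big_O f := exists K : R, exists2 del, 0 < del &
  forall h, N h < del -> cabs (f h) <= K * N h.

Lemma little_o_ext f g : (exists2 del, 0 < del & forall h, N h < del -> f h = g h) ->
  little_o f -> little_o g.
Proof.
move=> [d d0 fg] of_ e /of_ [d' d'0 H]; exists (Num.min d d'); first by rewrite lt_min d0.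
by move=> h; rewrite lt_min => /andP[h1 h2]; rewrite -fg// H.
Qed.

Lemma little_o_big f : little_o f -> big_O f.
Proof. by move=> /(_ 1 ltr01) [d d0 H]; exists 1, d. Qed.

Lemma big_O_pos f : big_O f -> exists2 K : R, 0 < K & exists2 del, 0 < del &
  forall h, N h < del -> cabs (f h) <= K * N h.
Proof.
move=> [K [d d0 H]]; exists (`|K| + 1); first by rewrite ltr_wpDl.
exists d => // h /H h1; rewrite (le_trans h1)// ler_wpM2r// (le_trans (ler_norm K))//.
by rewrite lerDl.
Qed.

Lemma little_oD f g : little_o f -> little_o g -> little_o (fun h => f h + g h).
Proof.
move=> of_ og e e0; have e20 : 0 < e / 2 by rewrite divr_gt0.
have [d1 d10 H1] := of_ _ e20; have [d2 d20 H2] := og _ e20.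
exists (Num.min d1 d2); first by rewrite lt_min d10.
move=> h; rewrite lt_min => /andP[/H1 h1 /H2 h2].
rewrite (le_trans (cabsD _ _))//; lra.
Qed.

Lemma big_OD f g : big_O f -> big_O g -> big_O (fun h => f h + g h).
Proof.
move=> [K1 [d1 d10 H1]] [K2 [d2 d20 H2]]; exists (K1 + K2).
exists (Num.min d1 d2); first by rewrite lt_min d10.
move=> h; rewrite lt_min => /andP[/H1 h1 /H2 h2].
rewrite (le_trans (cabsD _ _))//; lra.
Qed.

Lemma little_oZ k f : little_o f -> little_o (fun h => k * f h).
Proof.
move=> of_ e e0; have k0 : 0 < cabs k + 1 by rewrite ltr_wpDl ?cabs_ge0.
have [|d d0 H] := of_ (e / (cabs k + 1)); first by rewrite divr_gt0.
exists d => // h /H h1; rewrite cabsM.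
apply: le_trans (_ : (cabs k + 1) * (e / (cabs k + 1) * N h) <= _); last first.
  by rewrite mulrA mulrCA divff ?mulr1// gt_eqF.
by apply: ler_pM => //; rewrite ?cabs_ge0// lerDl.
Qed.

Lemma big_OM f g : big_O f -> big_O g -> little_o (fun h => f h * g h).
Proof.
move=> /big_O_pos[K1 K10 [d1 d10 H1]] /big_O_pos[K2 K20 [d2 d20 H2]] e e0.
exists (Num.min (Num.min d1 d2) (e / (K1 * K2))).
  by rewrite !lt_min d10 d20 divr_gt0// mulr_gt0.
move=> h; rewrite !lt_min => /andP[/andP[/H1 h1 /H2 h2] h3].
rewrite cabsM (le_trans (ler_pM _ _ h1 h2)) ?cabs_ge0//.
rewrite mulrACA mulrA ler_wpM2r// -[leLHS]mulrC -ler_pdivlMr ?mulr_gt0//.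
by rewrite ltW.
Qed.

Lemma little_o_bounded f g : little_o f ->
  (exists K : R, exists2 del, 0 < del & forall h, N h < del -> cabs (g h) <= K) ->
  little_o (fun h => f h * g h).
Proof.
move=> of_ [K [d d0 H]] e e0.
have K0 : 0 < `|K| + 1 by rewrite ltr_wpDl.
have [|d' d'0 H'] := of_ (e / (`|K| + 1)); first by rewrite divr_gt0.
exists (Num.min d d'); first by rewrite lt_min d0.
move=> h; rewrite lt_min => /andP[/H h1 /H' h2]; rewrite cabsM.
apply: le_trans (_ : (e / (`|K| + 1) * N h) * (`|K| + 1) <= _); last first.
  by rewrite mulrAC mulrVK ?unitfE ?gt_eqF.
apply: ler_pM => //; rewrite ?cabs_ge0// (le_trans h1)// (le_trans (ler_norm _))//.
by rewrite lerDl.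
Qed.

Definition expansion f v L := little_o (fun h => f h - v - L h).

Section Rules.
Variables (f g L L' : X -> R[i]) (v w : R[i]).
Hypotheses (bL : big_O L) (bL' : big_O L').
Hypotheses (df : expansion f v L) (dg : expansion g w L').

Lemma expansion_big_O : big_O (fun h => f h - v).
Proof.
have := big_OD (little_o_big df) bL; rewrite (_ : (fun h => _ + _) = (fun h => f h - v))//.
by apply/funext => h; rewrite subrK.
Qed.

Lemma expansionD : expansion (fun h => f h + g h) (v + w) (fun h => L h + L' h).
Proof.
have := little_oD df dg; rewrite /expansion.
by apply: little_o_ext; exists 1 => // h _; ring.
Qed.

Lemma expansionZ k : expansion (fun h => k * f h) (k * v) (fun h => k * L h).
Proof.
have := little_oZ k df; rewrite /expansion.
by apply: little_o_ext; exists 1 => // h _; ring.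
Qed.

(** With A = - v (f - v - L) + L (f - v), the remainder 1/f - 1/v + L/v^2 equals A / (f v^2). Here A
    is little o, and the other factor stays bounded because |f| >= |v| / 2 near the base point. *)
Lemma expansion_inv : v != 0 ->
  expansion (fun h => (f h)^-1) v^-1 (fun h => - v ^- 2 * L h).
Proof.
move=> v0; have /big_O_pos[K K0 [d d0 H]] := expansion_big_O.
have v0' : 0 < cabs v by rewrite cabs_gt0.
have fv h : N h < Num.min d (cabs v / (2 * K)) -> cabs v / 2 <= cabs (f h).
  rewrite lt_min => /andP[/H h1 h2].
  have : K * N h < cabs v / 2.
    by rewrite mulrC -ltr_pdivlMr// -mulrA -invfM mulrC mulrC.
  by have := cabs_ger v (f h); rewrite cabsC; lra.
have h1 : little_o (fun h => - v * (f h - v - L h) + L h * (f h - v)).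
  by apply: little_oD; [exact: little_oZ|apply: big_OM => //; exact: expansion_big_O].
have dm : 0 < Num.min d (cabs v / (2 * K)).
  by rewrite lt_min d0 divr_gt0// mulr_gt0.
have h2 : little_o (fun h => (- v * (f h - v - L h) + L h * (f h - v)) * (f h * v ^+ 2)^-1).
  apply: little_o_bounded => //; exists (cabs v / 2 * cabs v ^+ 2)^-1.
  exists (Num.min d (cabs v / (2 * K))) => // h /fv h2.
  rewrite cabsV lef_pV2 ?posrE; last 2 first.
  - by rewrite cabsM cabsX mulr_gt0 ?exprn_gt0// (lt_le_trans _ h2)// divr_gt0.
  - by rewrite mulr_gt0 ?exprn_gt0// divr_gt0.
  by rewrite cabsM cabsX ler_wpM2r// exprn_ge0// cabs_ge0.
apply: little_o_ext h2; exists (Num.min d (cabs v / (2 * K))) => // h /fv fh.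
have f0 : f h != 0 by rewrite -cabs_gt0 (lt_le_trans _ fh)// divr_gt0.
by field; rewrite v0 f0.
Qed.

Lemma expansionM : expansion (fun h => f h * g h) (v * w)
  (fun h => v * L' h + w * L h).
Proof.
have bf := expansion_big_O.
have bg : big_O (fun h => g h - w).
  have := big_OD (little_o_big dg) bL'.
  by rewrite (_ : (fun h => _ + _) = (fun h => g h - w))//; apply/funext => h; rewrite subrK.
have := little_oD (big_OM bf bg) (little_oD (little_oZ v dg) (little_oZ w df)).
by apply: little_o_ext; exists 1 => // h _; ring.
Qed.

End Rules.
End LittleO.

(** * Rules for the complex derivative *)

Section ComplexDerivative.
Variable R : realType.
Implicit Types (f g : R[i] -> R[i]) (z w c : R[i]).

Definition cderiv f z c := expansion (@cabs R) (fun h => f (z + h)) (f z) (fun h => c * h).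

Lemma big_O_scale c : big_O (@cabs R) (fun h => c * h).
Proof. by exists (cabs c), 1 => // h _; rewrite cabsM. Qed.

Let cge0 := @cabs_ge0 R.

Lemma cderiv_eq f z c c' : c = c' -> cderiv f z c -> cderiv f z c'.
Proof. by move->. Qed.

Lemma expansion_eq (X : Type) (N : X -> R) (F L L' : X -> R[i]) v : L =1 L' ->
  expansion N F v L -> expansion N F v L'.
Proof. by move=> /funext ->. Qed.

Lemma cderivD f g z c c' : cderiv f z c -> cderiv g z c' ->
  cderiv (fun x => f x + g x) z (c + c').
Proof.
move=> df dg; have := expansionD df dg.
by apply: expansion_eq => h; rewrite mulrDl.
Qed.

Lemma cderivZ k f z c : cderiv f z c -> cderiv (fun x => k * f x) z (k * c).
Proof.
move=> df; have := expansionZ df k.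
by apply: expansion_eq => h; rewrite mulrA.
Qed.

Lemma cderivM f g z c c' : cderiv f z c -> cderiv g z c' ->
  cderiv (fun x => f x * g x) z (f z * c' + g z * c).
Proof.
move=> df dg.
have := expansionM cge0 (big_O_scale c) (big_O_scale c') df dg.
by apply: expansion_eq => h; ring.
Qed.

Lemma cderivV f z c : f z != 0 -> cderiv f z c ->
  cderiv (fun x => (f x)^-1) z (- (f z) ^- 2 * c).
Proof.
move=> f0 df; have := expansion_inv cge0 (big_O_scale c) df f0.
by apply: expansion_eq => h; rewrite mulrA.
Qed.

Lemma cderiv_cst k z : cderiv (fun=> k) z 0.
Proof.
move=> e e0; exists 1 => // h _.
by rewrite subrr mul0r subrr cabs0 mulr_ge0// ltW.
Qed.

Lemma cderiv_id z : cderiv id z 1.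
Proof.
move=> e e0; exists 1 => // h _.
by rewrite mul1r [z + h]addrC addrK subrr cabs0 mulr_ge0// ltW.
Qed.

Lemma cderiv_lip f z c : cderiv f z c -> exists2 K : R, 0 < K & exists2 del, 0 < del &
  forall h, cabs h < del -> cabs (f (z + h) - f z) <= K * cabs h.
Proof.
move=> df; apply: big_O_pos => //; exact: expansion_big_O (big_O_scale c) df.
Qed.

Definition ccont_at f z := forall e : R, 0 < e -> exists2 del, 0 < del &
  forall w, cabs (w - z) < del -> cabs (f w - f z) <= e.

Lemma cderiv_cont f z c : cderiv f z c -> ccont_at f z.
Proof.
move=> /cderiv_lip[K K0 [d d0 H]] e e0.
exists (Num.min d (e / K)); first by rewrite lt_min d0 divr_gt0.
move=> w; rewrite lt_min => /andP[/H h1 h2].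
move: h1; rewrite [z + _]addrC subrK => /le_trans; apply.
by rewrite mulrC -ler_pdivlMr// ltW.
Qed.

Lemma cderiv_comp f g z c c' : cderiv g z c -> cderiv f (g z) c' ->
  cderiv (fun x => f (g x)) z (c' * c).
Proof.
move=> dg df; have [K K0 [d d0 H]] := cderiv_lip dg.
have h1 : little_o (@cabs R) (fun h => f (g (z + h)) - f (g z) - c' * (g (z + h) - g z)).
  move=> e e0; have [|d' d'0 H'] := df (e / K); first by rewrite divr_gt0.
  exists (Num.min d (d' / K)); first by rewrite lt_min d0 divr_gt0.
  move=> h; rewrite lt_min => /andP[/H gh h2].
  have /H' : cabs (g (z + h) - g z) < d'.
    by rewrite (le_lt_trans gh)// mulrC -ltr_pdivlMr.
  rewrite [g z + _]addrC subrK => /le_trans; apply.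
  by rewrite -mulrA ler_pM2l// ler_pdivrMl.
have := little_oD h1 (little_oZ c' dg).
by apply: little_o_ext; exists 1 => // h _; ring.
Qed.

Lemma cderivX f z c n : cderiv f z c ->
  cderiv (fun x => f x ^+ n) z (n%:R * f z ^+ n.-1 * c).
Proof.
move=> df; elim: n => [|n IH].
  by rewrite !mul0r; exact: cderiv_cst.
have := cderivM df IH.
rewrite (_ : (fun x => _) = (fun x => f x ^+ n.+1)); last first.
  by apply/funext => x; rewrite exprS.
apply: cderiv_eq => /=; case: n {IH} => [|n]; first by rewrite !mul0r mulr0 add0r expr0 !mul1r.
by rewrite /= -(natr1 n.+1) !exprS; ring.
Qed.

End ComplexDerivative.

(** * Goursat's theorem and Cauchy estimates *)

Section SegmentIntegral.
Variable R : realType.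
Implicit Types (f g : R -> R) (a b c k : R).
Local Open Scope classical_set_scope.

Definition J f a b : R := \int[@lebesgue_measure R]_(t in `[a, b]) f t.

Definition cont_seg f a b := forall x, a <= x <= b -> forall e, 0 < e ->
  exists2 del, 0 < del & forall y, a <= y <= b -> `|y - x| < del -> `|f y - f x| <= e.

Lemma cont_seg_integrable f a b : cont_seg f a b ->
  (@lebesgue_measure R).-integrable `[a, b] (EFin \o f).
Proof.
move=> cf; apply: continuous_compact_integrable; first exact: segment_compact.
apply/subspace_continuousP => x /=; rewrite in_itv /= => xab.
apply/cvgrPdist_le => /= e e0.
have [del del0 H] := cf x xab e e0.
rewrite near_withinE; exists del => //= y.
rewrite /ball_/= => xy /=; rewrite in_itv /= => yab.
by rewrite distrC; apply: H => //; rewrite distrC.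
Qed.

Lemma cont_segW f a b a' b' : a <= a' -> b' <= b -> cont_seg f a b -> cont_seg f a' b'.
Proof.
move=> aa bb cf x /andP[x1 x2] e e0.
have [|del d0 H] := cf x _ e e0; first by rewrite (le_trans aa)// (le_trans x2).
by exists del => // y /andP[y1 y2]; apply: H; rewrite (le_trans aa)// (le_trans y2).
Qed.

Lemma cont_segD f g a b : cont_seg f a b -> cont_seg g a b ->
  cont_seg (fun x => f x + g x) a b.
Proof.
move=> cf cg x xab e e0.
have e20 : 0 < e / 2 by rewrite divr_gt0.
have [d1 d10 H1] := cf x xab _ e20; have [d2 d20 H2] := cg x xab _ e20.
exists (Num.min d1 d2); first by rewrite lt_min d10.
move=> y yab; rewrite lt_min => /andP[/H1 h1 /H2 h2].
rewrite opprD addrACA (le_trans (ler_normD _ _))// (splitr e).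
by rewrite lerD ?h1 ?h2.
Qed.

Lemma cont_segN f a b : cont_seg f a b -> cont_seg (fun x => - f x) a b.
Proof.
move=> cf x xab e e0; have [d1 d10 H1] := cf x xab _ e0.
exists d1 => // y yab /H1 h1.
by rewrite -opprD normrN h1.
Qed.

Lemma cont_segB f g a b : cont_seg f a b -> cont_seg g a b ->
  cont_seg (fun x => f x - g x) a b.
Proof. by move=> cf /cont_segN; exact: cont_segD. Qed.

Lemma JD f g a b : cont_seg f a b -> cont_seg g a b ->
  J (fun x => f x + g x) a b = J f a b + J g a b.
Proof. by move=> cf cg; apply: RintegralD => //; exact: cont_seg_integrable. Qed.

Lemma cont_seg_cst k a b : cont_seg (fun=> k) a b.
Proof.
by move=> x _ e e0; exists 1 => // y _ _; rewrite subrr normr0 ltW.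
Qed.

Lemma J_cst k a b : a <= b -> J (fun=> k) a b = k * (b - a).
Proof.
move=> ab; rewrite /J Rintegral_cst//= lebesgue_measure_itv/=.
rewrite lte_fin; case: ltP => [//|ba]; suff -> : a = b by rewrite subrr.
by apply/eqP; rewrite eq_le ab.
Qed.

Lemma le_J f g a b : cont_seg f a b -> cont_seg g a b ->
  (forall x, a <= x <= b -> f x <= g x) -> J f a b <= J g a b.
Proof.
move=> cf cg fg; apply: le_Rintegral => //; try exact: cont_seg_integrable.
Qed.

Lemma J_le f a b k : a <= b -> cont_seg f a b ->
  (forall x, a <= x <= b -> f x <= k) -> J f a b <= k * (b - a).
Proof.
move=> ab cf fk; rewrite -J_cst//; apply: le_J => //; exact: cont_seg_cst.
Qed.

Lemma J_norm_le f a b k : a <= b -> cont_seg f a b ->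
  (forall x, a <= x <= b -> `|f x| <= k) -> `|J f a b| <= k * (b - a).
Proof.
move=> ab cf fk; rewrite ler_norml; apply/andP; split; last first.
  by apply: J_le => // x /fk; rewrite ler_norml => /andP[].
rewrite -mulNr -J_cst//; apply: le_J => //; first exact: cont_seg_cst.
by move=> x /fk; rewrite ler_norml => /andP[].
Qed.

Lemma J_split f a b c : a <= b -> b <= c -> cont_seg f a c ->
  J f a c = J f a b + J f b c.
Proof.
move=> ab bc cf; have := @Rintegral_itvB R f (BLeft a) (BRight c) b
  (cont_seg_integrable cf).
rewrite !bnd_simp => /(_ ab bc) h; rewrite /J.
have icb : (@lebesgue_measure R).-integrable `]b, c] (EFin \o f).
  have ibc : (@lebesgue_measure R).-integrable `[b, c] (EFin \o f).
    by apply: cont_seg_integrable; apply: cont_segW cf.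
  apply: (integrableS _ _ _ ibc) => //.
  by move=> x /=; rewrite !in_itv/= => /andP[/ltW -> ->].
rewrite -[X in _ + X](Rintegral_itv_obnd_cbnd icb) -h.
by rewrite addrC subrK.
Qed.

End SegmentIntegral.

(** * Bisection of rectangles *)

Section Bisection.
Variable R : realType.

(* [P x y w h] is about the rectangle with lower left corner [(x, y)], width [w]
   and height [h]. *)
Lemma bisect_rect (P : R -> R -> R -> R -> Prop) (x0 y0 w0 h0 : R) :
  0 < w0 -> 0 < h0 ->
  (forall x y w h, 0 < w -> 0 < h -> x0 <= x -> x + (w + w) <= x0 + w0 ->
     y0 <= y -> y + (h + h) <= y0 + h0 ->
     P x y w h -> P (x + w) y w h -> P x (y + h) w h -> P (x + w) (y + h) w h ->
     P x y (w + w) (h + h)) ->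
  (forall a b, x0 <= a <= x0 + w0 -> y0 <= b <= y0 + h0 -> exists2 del, 0 < del &
     forall x y w h, 0 < w -> 0 < h -> x0 <= x -> x + w <= x0 + w0 ->
     y0 <= y -> y + h <= y0 + h0 ->
       x <= a <= x + w -> y <= b <= y + h -> w + h < del -> P x y w h) ->
  P x0 y0 w0 h0.
Proof.
move=> w00 h00 quad loc; apply: contrapT => nP0.
(* A counterexample is quartered forever: a state is a depth n and a lower left corner, the size
   being [w0 / 2 ^+ n] by [h0 / 2 ^+ n]. The rectangles on which [P] fails are nested and share a
   point, contradicting [loc] there. *)
pose T := (nat * (R * R))%type.
pose W n := w0 / 2 ^+ n; pose H n := h0 / 2 ^+ n.
have W0 n : 0 < W n by rewrite divr_gt0 ?exprn_gt0.
have H0 n : 0 < H n by rewrite divr_gt0 ?exprn_gt0.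
have WS n : W n = W n.+1 + W n.+1.
  by rewrite {1}/W (splitr (w0 / _)) /W exprSr invfM mulrA.
have HS n : H n = H n.+1 + H n.+1.
  by rewrite {1}/H (splitr (h0 / _)) /H exprSr invfM mulrA.
pose Q (p : T) := [/\ x0 <= p.2.1, p.2.1 + W p.1 <= x0 + w0, y0 <= p.2.2,
  p.2.2 + H p.1 <= y0 + h0 & ~ P p.2.1 p.2.2 (W p.1) (H p.1)].
pose S (p q : {p : T | Q p}) := (sval q).1 = (sval p).1.+1 /\
  ((sval p).2.1 <= (sval q).2.1 /\ (sval q).2.1 + W (sval q).1 <= (sval p).2.1 + W (sval p).1) /\
  ((sval p).2.2 <= (sval q).2.2 /\ (sval q).2.2 + H (sval q).1 <= (sval p).2.2 + H (sval p).1).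
have Q0 : Q (0%N, (x0, y0)) by rewrite /Q /W /H /= expr0 !divr1.
have step (p : {p : T | Q p}) : {q | S p q}.
  apply: cid; case: p => [[n [x y]] Qp]; case: (Qp) => /= a1 a2 a3 a4 nP.
  have W1 := W0 n.+1; have H1 := H0 n.+1; have WSn := WS n; have HSn := HS n.
  have mk x' y' : x <= x' -> x' + W n.+1 <= x + W n -> y <= y' ->
      y' + H n.+1 <= y + H n -> ~ P x' y' (W n.+1) (H n.+1) ->
      exists q, S (exist _ (n, (x, y)) Qp) q.
    move=> b1 b2 b3 b4 b5; have Qq : Q (n.+1, (x', y')).
      by split=> //=; lra.
    by exists (exist _ (n.+1, (x', y')) Qq).
  apply: contrapT => nex; apply: (nP); rewrite WS HS; apply: quad; try lra.
  - by apply: contrapT => np; apply: nex; apply: (mk _ _ _ _ _ _ np); lra.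
  - by apply: contrapT => np; apply: nex; apply: (mk _ _ _ _ _ _ np); lra.
  - by apply: contrapT => np; apply: nex; apply: (mk _ _ _ _ _ _ np); lra.
  - by apply: contrapT => np; apply: nex; apply: (mk _ _ _ _ _ _ np); lra.
have [F [F0 FS]] := dependent_choice step (exist _ _ Q0).
pose X n := (sval (F n)).2.1; pose Y n := (sval (F n)).2.2.
have Fn n : (sval (F n)).1 = n by elim: n => [|n IH]; rewrite ?F0//= (FS n).1 IH.
have QF n : [/\ x0 <= X n, X n + W n <= x0 + w0, y0 <= Y n, Y n + H n <= y0 + h0 &
    ~ P (X n) (Y n) (W n) (H n)].
  by have := svalP (F n); rewrite /Q Fn.
have XY n : [/\ X n <= X n.+1, X n.+1 + W n.+1 <= X n + W n, Y n <= Y n.+1 &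
    Y n.+1 + H n.+1 <= Y n + H n].
  by have [_ [[h1 h2] [h3 h4]]] := FS n; split => //; move: h2 h4; rewrite !Fn.
have lim (Z V : nat -> R) : (forall n, 0 < V n) -> (forall n, Z n <= Z n.+1) ->
    (forall n, Z n.+1 + V n.+1 <= Z n + V n) ->
    exists a, forall n, Z n <= a <= Z n + V n.
  move=> V0 Zi Zd.
  have ni n k : Z n <= Z (n + k)%N.
    by elim: k => [|k IH]; rewrite ?addn0// addnS (le_trans IH).
  have nd n k : Z (n + k)%N + V (n + k)%N <= Z n + V n.
    by elim: k => [|k IH]; rewrite ?addn0// addnS (le_trans _ IH).
  have ub m n : Z m <= Z n + V n.
    have [mn|nm] := leqP m n.
      by have := ni m (n - m)%N; rewrite subnKC// => /le_trans; apply; rewrite lerDl ltW.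
    have := nd n (m - n)%N; rewrite subnKC; last exact: ltnW.
    by apply: le_trans; rewrite lerDl ltW.
  have hs : has_sup [set Z n | n in [set: nat]].
    by split; [exists (Z 0%N), 0%N|exists (Z 0%N + V 0%N) => _ [m _ <-]].
  exists (sup [set Z n | n in [set: nat]]) => n; apply/andP; split.
    by apply: sup_upper_bound => //; exists n.
  by apply: ge_sup; [exact: hs.1|move=> _ [m _ <-]].
have [a Ha] : exists a, forall n, X n <= a <= X n + W n.
  by apply: lim => // n; case: (XY n).
have [b Hb] : exists a, forall n, Y n <= a <= Y n + H n.
  by apply: lim => // n; case: (XY n).
have [||del del0 Hdel] := loc a b.
- by have := Ha 0%N; have [] := QF 0%N; lra.
- by have := Hb 0%N; have [] := QF 0%N; lra.
have [n Hn] : exists n, W n + H n < del.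
  set k := (Num.truncn ((w0 + h0) / del)).+1; exists k.
  rewrite /W /H -mulrDl ltr_pdivrMr ?exprn_gt0// mulrC -ltr_pdivrMr//.
  apply: lt_le_trans (_ : k%:R <= _); first exact: truncnS_gt.
  by rewrite -natrX ler_nat ltnW// ltn_expl.
have [q1 q2 q3 q4 nP] := QF n.
by apply: nP; apply: Hdel => //.
Qed.

End Bisection.

(** * Goursat's theorem for rectangles *)

Section Goursat.
Variable R : realType.
Implicit Types (G : R[i] -> R[i]) (x y w h a b t : R).

Local Notation "x +I y" := (Complex x y) (at level 50).

Lemma cont_seg_Im_h G a b y : (forall t, a <= t <= b -> ccont_at G (t +I y)) ->
  cont_seg (fun t => complex.Im (G (t +I y))) a b.
Proof.
move=> cG t tab e e0; have [d d0 H] := cG t tab e e0; exists d => // s _ st.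
rewrite -cImB (le_trans (Im_le_cabs _))// H// (le_lt_trans (cabs_le_ReIm _))//=.
by rewrite subrr normr0 addr0.
Qed.

Lemma cont_seg_Re_v G a b x : (forall t, a <= t <= b -> ccont_at G (x +I t)) ->
  cont_seg (fun t => complex.Re (G (x +I t))) a b.
Proof.
move=> cG t tab e e0; have [d d0 H] := cG t tab e e0; exists d => // s _ st.
rewrite -cReB (le_trans (Re_le_cabs _))// H// (le_lt_trans (cabs_le_ReIm _))//=.
by rewrite subrr normr0 add0r.
Qed.

(* Imaginary part of the integral of [G dz] along the boundary of the rectangle
   with lower left corner [x +I y] and upper right corner [x' +I y']. *)
Definition Im_contour G x x' y y' :=
  J (fun t => complex.Im (G (t +I y)) - complex.Im (G (t +I y'))) x x' +
  J (fun t => complex.Re (G (x' +I t)) - complex.Re (G (x +I t))) y y'.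

Definition cont_h G y a b := forall t, a <= t <= b -> ccont_at G (t +I y).
Definition cont_v G x a b := forall t, a <= t <= b -> ccont_at G (x +I t).

Lemma Im_contour_h G x1 x2 x3 y y' : x1 <= x2 -> x2 <= x3 ->
  cont_h G y x1 x3 -> cont_h G y' x1 x3 ->
  cont_v G x1 y y' -> cont_v G x2 y y' -> cont_v G x3 y y' ->
  Im_contour G x1 x3 y y' = Im_contour G x1 x2 y y' + Im_contour G x2 x3 y y'.
Proof.
move=> x12 x23 /cont_seg_Im_h c1 /cont_seg_Im_h c2 /cont_seg_Re_v c3
  /cont_seg_Re_v c4 /cont_seg_Re_v c5.
rewrite /Im_contour (J_split x12 x23); last exact: cont_segB.
rewrite [RHS]addrACA; congr (_ + _).
rewrite -JD; try exact: cont_segB.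
by congr (J _ _ _); apply/funext => t; rewrite [RHS]addrC subrKA.
Qed.

Lemma Im_contour_v G x x' y1 y2 y3 : y1 <= y2 -> y2 <= y3 ->
  cont_v G x y1 y3 -> cont_v G x' y1 y3 ->
  cont_h G y1 x x' -> cont_h G y2 x x' -> cont_h G y3 x x' ->
  Im_contour G x x' y1 y3 = Im_contour G x x' y1 y2 + Im_contour G x x' y2 y3.
Proof.
move=> y12 y23 /cont_seg_Re_v c1 /cont_seg_Re_v c2 /cont_seg_Im_h c3
  /cont_seg_Im_h c4 /cont_seg_Im_h c5.
rewrite /Im_contour (J_split y12 y23); last exact: cont_segB.
rewrite [RHS]addrACA; congr (_ + _).
rewrite -JD; try exact: cont_segB.
by congr (J _ _ _); apply/funext => t; rewrite subrKA.
Qed.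

(** An affine function has zero contour integral, so only the deviation of [G] from it, at most [e],
    is integrated; each pair of opposite sides gives the factor 2. *)
Lemma Im_contour_affine_le G x y w h (p c : R[i]) (e : R) : 0 <= w -> 0 <= h ->
  cont_h G y x (x + w) -> cont_h G (y + h) x (x + w) ->
  cont_v G x y (y + h) -> cont_v G (x + w) y (y + h) ->
  (forall a b, x <= a <= x + w -> y <= b <= y + h ->
     cabs (G (a +I b) - G p - c * (a +I b - p)) <= e) ->
  `|Im_contour G x (x + w) y (y + h)| <= 2 * e * (w + h).
Proof.
move=> w0 h0 /cont_seg_Im_h c1 /cont_seg_Im_h c2 /cont_seg_Re_v c3 /cont_seg_Re_v c4 H.
have [xw yh] : x <= x + w /\ y <= y + h by rewrite !lerDl.
pose A := complex.Re c.
(* The values of c (z - p) on opposite sides differ by - A h for the horizontal pair and by A w for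
   the vertical one. The corrections inserted here remove these differences, and their integrals A h
   w and - A w h cancel. *)
have -> : Im_contour G x (x + w) y (y + h) =
    J (fun t => complex.Im (G (t +I y)) - complex.Im (G (t +I (y + h))) + A * h) x (x + w) +
    J (fun t => complex.Re (G ((x + w) +I t)) - complex.Re (G (x +I t)) + - (A * w)) y (y + h).
  rewrite (JD (cont_segB c1 c2) (@cont_seg_cst R _ _ _)).
  rewrite (JD (cont_segB c4 c3) (@cont_seg_cst R _ _ _)) !J_cst//.
  by rewrite /Im_contour; ring.
rewrite mulrDr (le_trans (ler_normD _ _))//.
have b1 : 0 <= e.
  by rewrite (le_trans (cabs_ge0 _) (H x y _ _))// lexx.
apply: lerD.
- rewrite [leRHS](_ : _ = 2 * e * (x + w - x)); last by rewrite [x + w]addrC addrK.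
  apply: J_norm_le => //; first by apply: cont_segD; [exact: cont_segB|exact: cont_seg_cst].
  move=> t tx; have yy : y <= y <= y + h by rewrite lexx yh.
  have yy' : y <= y + h <= y + h by rewrite lexx yh.
  have := H t _ tx yy; have := H t _ tx yy'.
  move=> /(le_trans (Im_le_cabs _)) + /(le_trans (Im_le_cabs _)).
  rewrite !cImB !cImM /= -/A => h1 h2.
  rewrite (_ : _ + A * h = (complex.Im (G (t +I y)) - complex.Im (G p) -
    (A * (y - complex.Im p) + complex.Im c * (t - complex.Re p))) -
    (complex.Im (G (t +I (y + h))) - complex.Im (G p) -
    (A * (y + h - complex.Im p) + complex.Im c * (t - complex.Re p)))); last by ring.
  rewrite (le_trans (ler_normB _ _))// mulr_natl mulr2n lerD//.
  + by move: h2; case: (p) => //.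
  + by move: h1; case: (p) => //.
- rewrite [leRHS](_ : _ = 2 * e * (y + h - y)); last by rewrite [y + h]addrC addrK.
  apply: J_norm_le => //; first by apply: cont_segD; [exact: cont_segB|exact: cont_seg_cst].
  move=> t tx; have yy : x <= x <= x + w by rewrite lexx xw.
  have yy' : x <= x + w <= x + w by rewrite lexx xw.
  have := H _ t yy tx; have := H _ t yy' tx.
  move=> /(le_trans (Re_le_cabs _)) + /(le_trans (Re_le_cabs _)).
  rewrite !cReB !cReM /= -/A => h1 h2.
  rewrite (_ : _ + - (A * w) = (complex.Re (G ((x + w) +I t)) - complex.Re (G p) -
    (A * (x + w - complex.Re p) - complex.Im c * (t - complex.Im p))) -
    (complex.Re (G (x +I t)) - complex.Re (G p) -
    (A * (x - complex.Re p) - complex.Im c * (t - complex.Im p)))); last by ring.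
  rewrite (le_trans (ler_normB _ _))// mulr_natl mulr2n lerD//.
  + by move: h1; case: (p) => //.
  + by move: h2; case: (p) => //.
Qed.

(** The bound [e * (w + h) ^+ 2] is additive under quartering, so bisection reduces it to small
    rectangles, where the derivative gives an affine approximation within [e / 2 * (w + h)].
    Following the imaginary part is enough because the contour integral of 1/z is purely
    imaginary. *)
Lemma Goursat_pos G x y w h : 0 < w -> 0 < h ->
  (forall a b, x <= a <= x + w -> y <= b <= y + h -> exists c, cderiv G (a +I b) c) ->
  Im_contour G x (x + w) y (y + h) = 0.
Proof.
move=> w0 h0 dG.
have cG a b : x <= a <= x + w -> y <= b <= y + h -> ccont_at G (a +I b).
  by move=> /dG H /H [c /cderiv_cont].
have ch t r s : x <= r -> s <= x + w -> y <= t -> t <= y + h -> cont_h G t r s.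
  move=> rx sw ty ty' u /andP[u1 u2]; apply: cG; last by rewrite ty.
  by rewrite (le_trans rx u1) (le_trans u2 sw).
have cv t r s : y <= r -> s <= y + h -> x <= t -> t <= x + w -> cont_v G t r s.
  move=> rx sw ty ty' u /andP[u1 u2]; apply: cG; first by rewrite ty.
  by rewrite (le_trans rx u1) (le_trans u2 sw).
suff H e : 0 < e -> `|Im_contour G x (x + w) y (y + h)| <= e * (w + h) ^+ 2.
  apply/normr0_eq0/eqP; rewrite eq_le normr_ge0 andbT; apply/ler_addgt0Pr => e e0.
  have wh : 0 < (w + h) ^+ 2 by rewrite exprn_gt0 ?addr_gt0.
  by have := H _ (divr_gt0 e0 wh); rewrite divfK ?gt_eqF// add0r.
move=> e0.
apply: (@bisect_rect R (fun x y w h =>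
  `|Im_contour G x (x + w) y (y + h)| <= e * (w + h) ^+ 2)) => //.
- move=> x1 y1 w' h' w'0 h'0 x01.
  rewrite !addrA; set x2 := x1 + w'; set x3 := x2 + w' => x3l y01.
  set y2 := y1 + h'; set y3 := y2 + h' => y3l.
  have x12 : x1 <= x2 by rewrite lerDl ltW.
  have x23 : x2 <= x3 by rewrite lerDl ltW.
  have y12 : y1 <= y2 by rewrite lerDl ltW.
  have y23 : y2 <= y3 by rewrite lerDl ltW.
  have x02 := le_trans x01 x12; have x03 := le_trans x02 x23.
  have x2l := le_trans x23 x3l; have x1l := le_trans x12 x2l.
  have y02 := le_trans y01 y12; have y03 := le_trans y02 y23.
  have y2l := le_trans y23 y3l; have y1l := le_trans y12 y2l.
  have H1 : Im_contour G x1 x3 y1 y3 = Im_contour G x1 x2 y1 y3 + Im_contour G x2 x3 y1 y3.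
    by apply: Im_contour_h => //; [exact: ch|exact: ch|exact: cv|exact: cv|exact: cv].
  have H2 : Im_contour G x1 x2 y1 y3 = Im_contour G x1 x2 y1 y2 + Im_contour G x1 x2 y2 y3.
    by apply: Im_contour_v => //; [exact: cv|exact: cv|exact: ch|exact: ch|exact: ch].
  have H3 : Im_contour G x2 x3 y1 y3 = Im_contour G x2 x3 y1 y2 + Im_contour G x2 x3 y2 y3.
    by apply: Im_contour_v => //; [exact: cv|exact: cv|exact: ch|exact: ch|exact: ch].
  move=> p1 p2 p3 p4; rewrite H1 H2 H3 (le_trans (ler_normD _ _))//.
  have -> : e * (w' + w' + h' + h') ^+ 2 =
    (e * (w' + h') ^+ 2 + e * (w' + h') ^+ 2) + (e * (w' + h') ^+ 2 + e * (w' + h') ^+ 2) by ring.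
  by rewrite lerD// (le_trans (ler_normD _ _))// lerD.
- move=> a b ax by_; have [c dc] := dG a b ax by_.
  have [|d d0 H] := dc (e / 2); first by rewrite divr_gt0.
  exists d => // x' y' w' h' w0' h0' a1 a2 a3 a4 ax' by' whd.
  have -> : e * (w' + h') ^+ 2 = 2 * (e / 2 * (w' + h')) * (w' + h') by field.
  have xx : x' <= x' + w' by rewrite lerDl ltW.
  have yy : y' <= y' + h' by rewrite lerDl ltW.
  have x2 := le_trans a1 xx; have x3 := le_trans xx a2.
  have y2 := le_trans a3 yy; have y3 := le_trans yy a4.
  apply: (@Im_contour_affine_le G x' y' w' h' (a +I b) c);
    [exact: ltW|exact: ltW|exact: ch|exact: ch|exact: cv|exact: cv|].
  move=> s t xs yt; set q := (s +I t) - (a +I b).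
  have qwh : cabs q <= w' + h'.
    rewrite (le_trans (cabs_le_ReIm _))//= lerD// ler_norml.
      by clear -xs ax'; lra.
    by clear -yt by'; lra.
  have -> : s +I t = a +I b + q by rewrite /q addrC subrK.
  rewrite (le_trans (H _ (le_lt_trans qwh whd)))// ler_wpM2l ?divr_ge0//; exact: ltW.
Qed.

Lemma Goursat G x x' y y' : x < x' -> y < y' ->
  (forall a b, x <= a <= x' -> y <= b <= y' -> exists c, cderiv G (a +I b) c) ->
  Im_contour G x x' y y' = 0.
Proof.
move=> xx yy dG; have := @Goursat_pos G x y (x' - x) (y' - y).
by rewrite !subr_gt0 ![_ + (_ - _)]addrC !subrK; exact.
Qed.

End Goursat.

(** * Derivative bound at the centre of a disc *)

Section CauchyEstimate.
Variable R : realType.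
Implicit Types (f g : R[i] -> R[i]) (z w c : R[i]).

Local Notation "x +I y" := (Complex x y) (at level 50).

(** The region between the two squares is cut into two strips of full height and two blocks above
    and below the small square; none of them contains 0, so Goursat's theorem applies to each. *)
Lemma Im_contour_shrink G (s : R) : 0 < s -> s < 1 ->
  (forall a b, -1 <= a <= 1 -> -1 <= b <= 1 -> (a != 0) || (b != 0) ->
    exists c, cderiv G (a +I b) c) ->
  Im_contour G (-1) 1 (-1) 1 = Im_contour G (- s) s (- s) s.
Proof.
move=> s0 s1 dG.
have cG a b : -1 <= a <= 1 -> -1 <= b <= 1 -> (a != 0) || (b != 0) -> ccont_at G (a +I b).
  by move=> a1 b1 ab; have [c' /cderiv_cont] := dG a b a1 b1 ab.
have ch t r u : -1 <= r -> u <= 1 -> -1 <= t -> t <= 1 -> t != 0 -> cont_h G t r u.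
  move=> r1 s1' t1 t1' t0 v /andP[u1 u2]; apply: cG => //; rewrite ?t0 ?orbT ?t1//.
  by rewrite (le_trans r1)// (le_trans u2).
have cv t r u : -1 <= r -> u <= 1 -> -1 <= t -> t <= 1 -> t != 0 -> cont_v G t r u.
  move=> r1 s1' t1 t1' t0 v /andP[u1 u2]; apply: cG => //; rewrite ?t0 ?orbT ?t1//.
  by rewrite (le_trans r1)// (le_trans u2).
have [a1 a2 a3] : [/\ -1 < - s, - s < s & -1 < s].
  by split; clear -s0 s1; lra.
have [b1 b2 b3] : [/\ - s < 1, -1 < 1 :> R & s < 1].
  by split; clear -s0 s1; lra.
have [n1 n2 n3] : [/\ -1 != 0 :> R, - s != 0 & s != 0].
  by split; clear -s0 s1; lra.
have n4 : (1 : R) != 0 by exact: oner_neq0.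
have [a1' a2' a3'] : [/\ -1 <= - s, - s <= s & -1 <= s] by split; exact: ltW.
have [b1' b2' b3'] : [/\ - s <= 1, -1 <= 1 :> R & s <= 1] by split; exact: ltW.
have z1 : Im_contour G (-1) (- s) (-1) 1 = 0.
  apply: Goursat => // a b /andP[a4 a5] b4; apply: dG => //.
    by rewrite a4 (le_trans a5).
  by rewrite lt_eqF// (le_lt_trans a5)// oppr_lt0.
have z2 : Im_contour G s 1 (-1) 1 = 0.
  apply: Goursat => // a b /andP[a4 a5] b4; apply: dG => //.
    by rewrite a5 (le_trans _ a4).
  by rewrite gt_eqF// (lt_le_trans s0).
have z3 : Im_contour G (- s) s (-1) (- s) = 0.
  apply: Goursat => // a b /andP[a4 a5] /andP[b4 b5]; apply: dG => //.
  - by rewrite (le_trans _ a4)// (le_trans a5).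
  - by rewrite b4 (le_trans b5).
  - by rewrite orbC lt_eqF// (le_lt_trans b5)// oppr_lt0.
have z4 : Im_contour G (- s) s s 1 = 0.
  apply: Goursat => // a b /andP[a4 a5] /andP[b4 b5]; apply: dG => //.
  - by rewrite (le_trans _ a4)// (le_trans a5).
  - by rewrite b5 (le_trans _ b4).
  - by rewrite orbC gt_eqF// (lt_le_trans s0).
have [l0 l1] := (lexx (-1 : R), lexx (1 : R)).
rewrite (Im_contour_h a1' b1' (ch _ _ _ l0 l1 l0 b2' n1) (ch _ _ _ l0 l1 b2' l1 n4)
  (cv _ _ _ l0 l1 l0 b2' n1) (cv _ _ _ l0 l1 a1' b1' n2) (cv _ _ _ l0 l1 b2' l1 n4)).
rewrite (Im_contour_h a2' b3' (ch _ _ _ a1' l1 l0 b2' n1) (ch _ _ _ a1' l1 b2' l1 n4)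
  (cv _ _ _ l0 l1 a1' b1' n2) (cv _ _ _ l0 l1 a3' b3' n3) (cv _ _ _ l0 l1 b2' l1 n4)).
rewrite (Im_contour_v a1' b1' (cv _ _ _ l0 l1 a1' b1' n2) (cv _ _ _ l0 l1 a3' b3' n3)
  (ch _ _ _ a1' b3' l0 b2' n1) (ch _ _ _ a1' b3' a1' b1' n2) (ch _ _ _ a1' b3' b2' l1 n4)).
rewrite (Im_contour_v a2' b3' (cv _ _ _ a1' l1 a1' b1' n2) (cv _ _ _ a1' l1 a3' b3' n3)
  (ch _ _ _ a1' b3' a1' b1' n2) (ch _ _ _ a1' b3' a3' b3' n3) (ch _ _ _ a1' b3' b2' l1 n4)).
by rewrite z1 z2 z3 z4 !(addr0, add0r).
Qed.

(* [G] below is [(f z - f (- z) - 2 c z) / z^2], which is [o(1/z)] at [0], so its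
   contour integrals over small squares, hence over the unit square, vanish; on
   the unit square the [1/z] part contributes at least a multiple of [c]. *)
Lemma cderiv_ge0_le_bound (f : R[i] -> R[i]) (M c : R) :
  (forall z, cabs z < 2 -> exists c', cderiv f z c') ->
  (forall z, cabs z < 2 -> cabs (f z) <= M) ->
  0 <= c -> cderiv f 0 (rC c) -> c <= 2 * M.
Proof.
move=> df fM c0 dc.
(* The odd combination removes f(0) and has derivative 2 c at 0. *)
pose g z := f z + -1 * f (-1 * z).
pose G z := g z * (z ^+ 2)^-1 + rC (- 2 * c) * z^-1.
have gM z : cabs z < 2 -> cabs (g z) <= 2 * M.
  move=> z2; rewrite (le_trans (cabsD _ _))// cabsM cabsN cabs1 mul1r mulN1r.
  by rewrite mulr_natl mulr2n lerD// fM// cabsN.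
have dg z : cabs z < 2 -> exists c', cderiv g z c'.
  move=> z2; have [c1 dc1] := df z z2.
  have [|c2 dc2] := df (-1 * z); first by rewrite mulN1r cabsN.
  by eexists; apply: cderivD dc1 (cderivZ _ (cderiv_comp (cderivZ _ (cderiv_id _)) dc2)).
have dG z : z != 0 -> cabs z < 2 -> exists c', cderiv G z c'.
  move=> z0 z2; have [c1 dc1] := dg z z2.
  have z20 : z ^+ 2 != 0 by rewrite expf_neq0.
  have d2 : cderiv (fun x : R[i] => x ^+ 2) z (2%:R * z ^+ 1 * 1).
    exact: cderivX (cderiv_id z).
  eexists; exact: (cderivD (cderivM dc1 (@cderivV _ (fun x => x ^+ 2) _ _ z20 d2))
    (cderivZ (rC (- 2 * c)) (@cderivV _ id _ _ z0 (cderiv_id z)))).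
have dg0 : cderiv g 0 (rC (2 * c)).
  have := cderivD dc (cderivZ (-1) (@cderiv_comp _ _ (fun z => -1 * z) 0 _ _
    (cderivZ (-1) (cderiv_id _)) _)).
  move=> /(_ f (rC c)); rewrite mulr0 => /(_ dc); apply: cderiv_eq.
  by rewrite !rCM /rC rmorph_nat; ring.
have g0 : g 0 = 0 by rewrite /g mulr0 mulN1r subrr.
have sq2 (a b : R) : -1 <= a <= 1 -> -1 <= b <= 1 -> cabs (a +I b) < 2.
  move=> a1 b1; rewrite -(@ltr_pXn2r _ 2)// ?nnegrE ?cabs_ge0// cabs_sqr/=; clear -a1 b1; nra.
have neq0 (a b : R) : (a != 0) || (b != 0) -> a +I b != 0.
  by apply: contraTN => /eqP[-> ->]; rewrite eqxx.
have dG' a b : -1 <= a <= 1 -> -1 <= b <= 1 -> (a != 0) || (b != 0) ->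
    exists c', cderiv G (a +I b) c'.
  by move=> a1 b1 /neq0 ab; apply: dG => //; exact: sq2.
have cG a b : -1 <= a <= 1 -> -1 <= b <= 1 -> (a != 0) || (b != 0) -> ccont_at G (a +I b).
  by move=> a1 b1 ab; have [c' /cderiv_cont] := dG' a b a1 b1 ab.
have ch t s r : -1 <= r -> s <= 1 -> -1 <= t -> t <= 1 -> t != 0 -> cont_h G t r s.
  move=> r1 s1 t1 t1' t0 u /andP[u1 u2]; apply: cG => //; rewrite ?t0 ?orbT ?t1//.
  by rewrite (le_trans r1)// (le_trans u2).
have cv t s r : -1 <= r -> s <= 1 -> -1 <= t -> t <= 1 -> t != 0 -> cont_v G t r s.
  move=> r1 s1 t1 t1' t0 u /andP[u1 u2]; apply: cG => //; rewrite ?t0 ?orbT ?t1//.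
  by rewrite (le_trans r1)// (le_trans u2).
have I0 : Im_contour G (-1) 1 (-1) 1 = 0.
  apply/normr0_eq0/eqP; rewrite eq_le normr_ge0 andbT; apply/ler_addgt0Pr => e e0.
  rewrite add0r.
  have [|d d0 Hd] := dg0 (e / 8); first by rewrite divr_gt0.
  pose s := Num.min (d / 4) (1 / 2).
  have s0 : 0 < s by rewrite lt_min !divr_gt0.
  have [sd s12] : s <= d / 4 /\ s <= 1 / 2 by rewrite !ge_min !lexx orbT.
  have s1 : s < 1 by clear -s12; lra.
  have [k1 k2] : -1 <= - s /\ s <= 1 by split; clear -s1; lra.
  have k3 : - s <= s by clear -s0; lra.
  have [k4 k5] := (le_trans k1 k3, le_trans k3 k2).
  have k6 : s != 0 by rewrite gt_eqF.
  have k7 : - s != 0 by rewrite oppr_eq0.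
  rewrite (Im_contour_shrink s0 s1)//.
  (* Since G z = (g z - 2 c z) / z^2, near 0 it is at most (e / 8) / |z|, and |z| >= s on the small
     square; its four sides have length 2 s, for a total of at most e. *)
  have bd a b : - s <= a <= s -> - s <= b <= s -> s <= `|a| \/ s <= `|b| ->
      cabs (G (a +I b)) <= e / 8 / s.
    move=> a1 b1 ab; set z := a +I b.
    have sz : s <= cabs z.
      by case: ab => /le_trans; apply; [exact: (Re_le_cabs z)|exact: (Im_le_cabs z)].
    have z0 : z != 0 by rewrite -cabs_gt0 (lt_le_trans s0).
    have zd : cabs z < d.
      rewrite (le_lt_trans (cabs_le_ReIm z))//=.
      have h1 : `|a| <= s by rewrite ler_norml.
      have h2 : `|b| <= s by rewrite ler_norml.
      by clear -sd h1 h2 d0; lra.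
    have := Hd z zd; rewrite add0r g0 subr0.
    have -> : g z - rC (2 * c) * z = G z * z ^+ 2.
      by rewrite /G mulNr rCN; field.
    rewrite cabsM cabsX => h; rewrite ler_pdivlMr//.
    rewrite -(ler_pM2r (lt_le_trans s0 sz)) (le_trans _ h)//.
    by rewrite expr2 mulrA ler_wpM2r ?cabs_ge0// ler_wpM2l ?cabs_ge0.
  rewrite /Im_contour.
  have t1 : - s <= - s <= s by rewrite lexx.
  have t2 : - s <= s <= s by rewrite lexx k3.
  have ns : `|- s| = s by rewrite normrN gtr0_norm.
  have ns' : `|s| = s by rewrite gtr0_norm.
  have es : e = e / 8 / s * 2 * (s - - s) + e / 8 / s * 2 * (s - - s).
    by field; rewrite gt_eqF.
  rewrite [leRHS]es (le_trans (ler_normD _ _))// lerD//.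
  - apply: J_norm_le => //.
      by apply: cont_segB; apply: cont_seg_Im_h; apply: ch.
    move=> t tt; rewrite mulr_natr mulr2n (le_trans (ler_normB _ _))// lerD//.
      by rewrite (le_trans (Im_le_cabs _))// bd// ns; right.
    by rewrite (le_trans (Im_le_cabs _))// bd// ns'; right.
  - apply: J_norm_le => //.
      by apply: cont_segB; apply: cont_seg_Re_v; apply: cv.
    move=> t tt; rewrite mulr_natr mulr2n (le_trans (ler_normB _ _))// lerD//.
      by rewrite (le_trans (Re_le_cabs _))// bd// ns'; left.
    by rewrite (le_trans (Re_le_cabs _))// bd// ns; left.
have small z : 1 <= cabs z -> cabs z < 2 -> cabs (g z * (z ^+ 2)^-1) <= 2 * M.
  move=> z1 z2; rewrite cabsM cabsV cabsX (le_trans _ (gM z z2))//.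
  by rewrite ler_piMr ?cabs_ge0// invf_le1 ?exprn_ege1// exprn_gt0// (lt_le_trans _ z1).
pose q z := g z * (z ^+ 2)^-1.
have ReG z : complex.Re (G z) = complex.Re (q z) - 2 * c * complex.Re z^-1.
  by rewrite /G -/(q z) cReD [complex.Re (rC _ * _)]cReM /= mul0r subr0 !mulNr.
have ImG z : complex.Im (G z) = complex.Im (q z) - 2 * c * complex.Im z^-1.
  by rewrite /G -/(q z) cImD [complex.Im (rC _ * _)]cImM /= mul0r addr0 !mulNr.
have one (a b : R) : -1 <= a <= 1 -> -1 <= b <= 1 -> 1 <= `|a| \/ 1 <= `|b| ->
    cabs (q (a +I b)) <= 2 * M.
  move=> a1 b1 ab; apply: small; last exact: sq2.
  by case: ab => /le_trans; apply; [exact: (Re_le_cabs (a +I b))|exact: (Im_le_cabs (a +I b))].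
have ReV (a b : R) : complex.Re (a +I b)^-1 = a / (a ^+ 2 + b ^+ 2) by [].
have ImV (a b : R) : complex.Im (a +I b)^-1 = - (b / (a ^+ 2 + b ^+ 2)) by [].
have half (t : R) : -1 <= t <= 1 -> 1 / 2 <= (t ^+ 2 + 1)^-1.
  move=> t1; have t20 : 0 < t ^+ 2 + 1 by rewrite ltr_wpDl ?sqr_ge0 ?ltr01.
  rewrite -[leRHS]mul1r ler_pdivlMr//; case/andP: t1 => t1 t1'.
  have : 0 <= (t - -1) * (1 - t) by rewrite mulr_ge0 ?subr_ge0.
  by clear; move=> *; nra.
have w3 : -1 <= 1 :> R by exact: le_trans (lerN10 _) ler01.
have n1 : `|-1| = 1 :> R by rewrite normrN normr1.
have m1 : 1 <= `|-1 : R| by rewrite n1.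
have m2 : 1 <= `|1 : R| by rewrite normr1.
have t1 : (-1 : R) <= (-1 : R) <= (1 : R) by rewrite lexx w3.
have t2 : (-1 : R) <= (1 : R) <= (1 : R) by rewrite lexx w3.
have n0 : -1 != 0 :> R by rewrite oppr_eq0 oner_eq0.
have n10 := @oner_neq0 R.
have [w1 w2] := (lexx (-1 : R), lexx (1 : R)).
have e8 : 1 - -1 = 2 :> R by rewrite opprK -mulr2n.
(* On two opposite sides of the unit square the bounded part [q] contributes at most 4 M, and the
   pole contributes - 4 c / (t^2 + 1) <= - 2 c. *)
have : 0 <= (4 * M - 2 * c) * (1 - -1) + (4 * M - 2 * c) * (1 - -1).
  rewrite -[leLHS]I0 /Im_contour; apply: lerD.
  - apply: J_le => //.
      by apply: cont_segB; apply: cont_seg_Im_h; apply: ch.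
    move=> t tt; rewrite !ImG !ImV sqrrN !expr1n.
    have := one t (-1) tt t1 (or_intror m1).
    have := one t 1 tt t2 (or_intror m2).
    move=> /(le_trans (Im_le_cabs _)) + /(le_trans (Im_le_cabs _)).
    rewrite !ler_norml => /andP[A1 A2] /andP[B1 B2].
    have := half t tt; rewrite !mul1r mulN1r.
    set p := (t ^+ 2 + 1)^-1 => p12.
    have : c * 2^-1 <= c * p by rewrite ler_wpM2l.
    by clear -A1 A2 B1 B2 p12 c0; move=> *; lra.
  - apply: J_le => //.
      by apply: cont_segB; apply: cont_seg_Re_v; apply: cv.
    move=> t tt; rewrite !ReG !ReV sqrrN !expr1n.
    have := one (-1) t t1 tt (or_introl m1).
    have := one 1 t t2 tt (or_introl m2).
    move=> /(le_trans (Re_le_cabs _)) + /(le_trans (Re_le_cabs _)).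
    rewrite !ler_norml => /andP[A1 A2] /andP[B1 B2].
    have := half t tt; rewrite !mul1r mulN1r [1 + _]addrC.
    set p := (t ^+ 2 + 1)^-1 => p12.
    have : c * 2^-1 <= c * p by rewrite ler_wpM2l.
    by clear -A1 A2 B1 B2 p12 c0; move=> *; lra.
by rewrite e8; clear; move=> *; lra.
Qed.

End CauchyEstimate.

(** Used both to add up increments along a segment and, for a property that propagates, as
    connectedness of the segment. *)
Lemma bisect_seg (R : realType) (P : R -> R -> Prop) :
  (forall x w, 0 < w -> 0 <= x -> x + (w + w) <= 1 -> P x w -> P (x + w) w -> P x (w + w)) ->
  (forall a, 0 <= a <= 1 -> exists2 del, 0 < del &
     forall x w, 0 < w -> 0 <= x -> x + w <= 1 -> x <= a <= x + w -> w < del -> P x w) ->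
  P 0 1.
Proof.
move=> quad loc; apply: (@bisect_rect R (fun x _ w _ => P x w) 0 0 1 1) => //.
  by move=> x y w h w0 h0 x0; rewrite add0r => xw _ _ h1 h2 _ _; exact: quad.
move=> a b; rewrite add0r => /loc[d d0 H] _; exists d => // x y w h w0 h0 x0 xw _ _ xa _ wh.
by apply: H => //; rewrite (le_lt_trans _ wh)// lerDl ltW.
Qed.

(** * Cauchy, Lipschitz and Taylor estimates in one variable *)

Section CauchyOneVariable.
Variable R : realType.
Implicit Types (f g : R[i] -> R[i]) (z w c h : R[i]) (rho M : R).

Definition cdiff_on_disc f z rho := forall w, cabs (w - z) < rho -> exists c, cderiv f w c.
Definition bounded_on_disc f z rho M := forall w, cabs (w - z) < rho -> cabs (f w) <= M.

Lemma disc_sub z w r rho : cabs (w - z) + r <= rho ->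
  forall v, cabs (v - w) < r -> cabs (v - z) < rho.
Proof.
move=> wr v vw; rewrite (le_lt_trans (cabs_tri w _ _))// (lt_le_trans _ wr)//.
by rewrite addrC ltrD2l.
Qed.

Lemma cderiv_shift f z k c w : cderiv f (z + k * w) c -> cderiv (fun x => f (z + k * x)) w (c * k).
Proof.
move=> df; apply: (@cderiv_comp _ f (fun x => z + k * x)) => //.
rewrite -[k in X in cderiv _ _ X]add0r.
apply: cderivD; first exact: cderiv_cst.
by rewrite -[k in X in cderiv _ _ X]mulr1; exact: cderivZ (cderiv_id _).
Qed.

(** A unimodular factor [u] makes the derivative a nonnegative real, and the dilation by [rho / 2]
    brings the disc to radius 2. The constant 4 is not sharp; what matters is that it is the same
    for all [f]. *)
Lemma Cauchy_estimate f z rho M c : 0 < rho -> cdiff_on_disc f z rho ->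
  bounded_on_disc f z rho M -> cderiv f z c -> cabs c <= 4 * M / rho.
Proof.
move=> rho0 df fM dc.
have M0 : 0 <= M by rewrite (le_trans (cabs_ge0 (f z)))// fM// subrr cabs0.
have [->|c0] := eqVneq c 0; first by rewrite cabs0 !mulr_ge0// invr_ge0 ltW.
have c0' : 0 < cabs c by rewrite cabs_gt0.
pose u := rC (cabs c)^-1 * conjc c.
have u1 : cabs u = 1.
  by rewrite cabsM cabs_rC cabs_conj gtr0_norm ?invr_gt0// mulVf// gt_eqF.
pose F x := u * f (z + rC (rho / 2) * x).
have inD x : cabs x < 2 -> cabs (z + rC (rho / 2) * x - z) < rho.
  move=> x2; rewrite [z + _]addrC addrK cabsM cabs_rC gtr0_norm ?divr_gt0//.
  by rewrite mulrAC ltr_pdivrMr// ltr_pM2l.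
have : cabs c * (rho / 2) <= 2 * M.
  apply: (@cderiv_ge0_le_bound R F).
  - move=> x /inD/df[c' dc']; eexists; apply: cderivZ; exact: cderiv_shift dc'.
  - by move=> x /inD/fM; rewrite cabsM u1 mul1r.
  - by rewrite mulr_ge0 ?cabs_ge0// divr_ge0// ltW.
  - have -> : rC (cabs c * (rho / 2)) = u * (c * rC (rho / 2)).
      rewrite rCM mulrA; congr (_ * _).
      by rewrite /u -mulrA [conjc c * c]mulrC -sqr_cabs_conj -rCM expr2 mulKf// gt_eqF.
    by apply: cderivZ; apply: cderiv_shift; rewrite mulr0 addr0.
rewrite mulrA ler_pdivrMr// => h; rewrite ler_pdivlMr//.
by apply: le_trans h _; rewrite le_eqVlt; apply/orP; left; apply/eqP; ring.
Qed.

(** The bound [(B + e') * cabs h * w] is additive in the length [w], so bisection reduces it to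
    short segments, where [e'] absorbs the error term of the derivative. *)
Lemma mean_value_le f z h B :
  (forall t : R, 0 <= t <= 1 -> exists2 c, cderiv f (z + rC t * h) c & cabs c <= B) ->
  cabs (f (z + h) - f z) <= B * cabs h.
Proof.
move=> df; apply/ler_addgt0Pr => e e0.
pose e' := e / (cabs h + 1).
have h0 : 0 < cabs h + 1 by rewrite ltr_wpDl ?cabs_ge0.
have e'0 : 0 < e' by rewrite divr_gt0.
pose phi (t : R) := f (z + rC t * h).
pose P (x w : R) := cabs (phi (x + w) - phi x) <= (B + e') * cabs h * w.
have : P 0 1.
  apply: (@bisect_seg R P); rewrite /P.
    move=> x w _ _ _ h1 h2.
    by rewrite addrA mulrDr [leRHS]addrC (le_trans (cabs_tri (phi (x + w)) _ _))// lerD.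
  move=> a /df[c dc cB]; have [d d0 H] := dc e' e'0.
  exists (d / (cabs h + 1)); first by rewrite divr_gt0.
  move=> x w w0 x0 xw /andP[xa aw] wd.
  have near t : `|t - a| <= w -> cabs (phi t - phi a) <= (B + e') * cabs h * `|t - a|.
    move=> ta; have e1 : phi t = f (z + rC a * h + rC (t - a) * h).
      by rewrite /phi -addrA -mulrDl -rCD [a + _]addrC subrK.
    have h1 : cabs (rC (t - a) * h) < d.
      rewrite cabsM cabs_rC (le_lt_trans (ler_wpM2r (cabs_ge0 _) ta))//.
      apply: le_lt_trans (_ : w * (cabs h + 1) < d); last by rewrite -ltr_pdivlMr.
      by rewrite ler_wpM2l ?lerDl// ltW.
    have := H _ h1; rewrite -e1 -/(phi a) => h2.
    rewrite -[phi t - phi a](subrK (c * (rC (t - a) * h))) (le_trans (cabsD _ _))//.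
    rewrite -mulrA mulrDl addrC lerD//.
    - rewrite !cabsM cabs_rC [cabs h * _]mulrC ler_wpM2r// mulr_ge0// cabs_ge0//.
    - by move: h2; rewrite !cabsM cabs_rC [cabs h * _]mulrC.
  have n1 : `|x + w - a| = x + w - a by rewrite ger0_norm// subr_ge0.
  have n2 : `|x - a| = a - x by rewrite ler0_norm ?subr_le0// opprB.
  have := near (x + w); rewrite n1 => /(_ _) h1.
  have := near x; rewrite n2 => /(_ _) h2.
  rewrite (le_trans (cabs_tri (phi a) _ _))//.
  rewrite -(_ : (B + e') * cabs h * (x + w - a) + (B + e') * cabs h * (a - x) = (B + e') * cabs h * w); last by ring.
  rewrite lerD//; first by apply: h1; rewrite -lerBrDr; clear -xa; lra.
  by rewrite cabsC; apply: h2; clear -aw; lra.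
rewrite /P add0r mulr1 /phi mul0r addr0 rC1 mul1r mulrDl => /le_trans; apply.
rewrite lerD2l /e' mulrAC ler_pdivrMr// ler_wpM2l ?ltW//.
by rewrite ltr_pwDr.
Qed.

Lemma disc_segment z w (t : R) : 0 <= t <= 1 -> cabs (z + rC t * (w - z) - z) <= cabs (w - z).
Proof.
move=> /andP[t0 t1]; rewrite [z + _]addrC addrK cabsM cabs_rC ger0_norm//.
by rewrite ler_piMl// cabs_ge0.
Qed.

(** Up to distance [rho / 2] the derivative along the segment is estimated on discs of radius
    [rho / 2]; farther out the trivial bound 2 M is already at most 4 M / rho times the distance. *)
Lemma Lipschitz_disc f z rho M w : 0 < rho -> cdiff_on_disc f z rho ->
  bounded_on_disc f z rho M -> cabs (w - z) < rho ->
  cabs (f w - f z) <= 8 * M / rho * cabs (w - z).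
Proof.
move=> rho0 df fM wz.
have zz : cabs (z - z) < rho by rewrite subrr cabs0.
have M0 : 0 <= M by rewrite (le_trans (cabs_ge0 (f z)))// fM.
have [w2|w2] := leP (cabs (w - z)) (rho / 2).
  have -> : f w - f z = f (z + (w - z)) - f z by rewrite [z + _]addrC subrK.
  apply: mean_value_le => t /(disc_segment z w) t01.
  set v := z + _; have vz : cabs (v - z) + rho / 2 <= rho.
    by rewrite [leRHS]splitr lerD2r (le_trans t01).
  have [c dc] : exists c, cderiv f v c.
    by apply: df; rewrite (le_lt_trans t01).
  exists c => //; have -> : 8 * M / rho = 4 * M / (rho / 2) by field; rewrite gt_eqF.
  apply: Cauchy_estimate dc; first by rewrite divr_gt0.
  - by move=> v' /(disc_sub vz); exact: df.
  - by move=> v' /(disc_sub vz); exact: fM.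
rewrite (le_trans (cabsB _ _))//.
have h1 := fM w wz; have h2 := fM z zz.
rewrite mulrAC ler_pdivlMr// (le_trans (ler_wpM2r (ltW rho0) (lerD h1 h2)))//.
have -> : (M + M) * rho = (4 * M) * (rho / 2) by field.
apply: ler_pM; [by rewrite mulr_ge0|by rewrite divr_ge0 ?ltW| |exact: ltW].
by rewrite ler_wpM2r// ler_nat.
Qed.

(** The increment of f' from z to v is the derivative at z of the translate difference x |-> f (x +
    v - z) - f x, which is O(|w - z|) by the Lipschitz bound; no second derivative is involved. The
    constant 256 is 4 from Cauchy's estimate, 16 from the Lipschitz bound at radius [rho / 2] and 4
    from the radius [rho / 4]. *)
Lemma Taylor2_disc f z rho M c w : 0 < rho -> cdiff_on_disc f z rho ->
  bounded_on_disc f z rho M -> cderiv f z c -> cabs (w - z) < rho ->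
  cabs (f w - f z - c * (w - z)) <= 256 * M / rho ^+ 2 * cabs (w - z) ^+ 2.
Proof.
move=> rho0 df fM dc wz.
have zz : cabs (z - z) < rho by rewrite subrr cabs0.
have M0 : 0 <= M by rewrite (le_trans (cabs_ge0 (f z)))// fM.
have [w2|w2] := leP (cabs (w - z)) (rho / 4).
  pose g x := f x + - c * x.
  have -> : f w - f z - c * (w - z) = g (z + (w - z)) - g z.
    by rewrite /g [z + _]addrC subrK; ring.
  rewrite expr2 mulrA; apply: mean_value_le => t /(disc_segment z w).
  set v := z + _ => vz.
  have vr : cabs (v - z) < rho by rewrite (le_lt_trans vz).
  have [cv dcv] := df v vr.
  exists (cv + - c * 1); first exact: cderivD dcv (cderivZ _ (cderiv_id _)).
  pose h x := f (v - z + 1 * x) + -1 * f x.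
  have dh : cderiv h z (cv * 1 + -1 * c).
    apply: cderivD; last exact: cderivZ.
    by apply: cderiv_shift; rewrite mul1r subrK.
  have -> : cv + - c * 1 = cv * 1 + -1 * c by ring.
  have r4 : 0 < rho / 4 by rewrite divr_gt0.
  have sub x : cabs (x - z) < rho / 4 -> cabs (v - z + 1 * x - x) < rho / 2 /\
      cabs (x - z) + rho / 2 <= rho.
    move=> xz; split.
      rewrite mul1r addrK (le_lt_trans vz)// (le_lt_trans w2)//.
      by clear -rho0; lra.
    by clear -rho0 xz; lra.
  have hM : bounded_on_disc h z (rho / 4) (16 * M / rho * cabs (w - z)).
    move=> x /sub [x1 x2].
    have := @Lipschitz_disc f x (rho / 2) M (v - z + 1 * x).
    rewrite /h mulN1r => /(_ _ _ _ x1) H.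
    apply: le_trans (H _ _ _) _; first by rewrite divr_gt0.
    - by move=> y /(disc_sub x2); exact: df.
    - by move=> y /(disc_sub x2); exact: fM.
    rewrite mul1r addrK (_ : 8 * M / (rho / 2) = 16 * M / rho); last by field; rewrite gt_eqF.
    by rewrite ler_wpM2l// !mulr_ge0// invr_ge0 ltW.
  have := Cauchy_estimate r4 _ hM dh.
  have -> : 4 * (16 * M / rho * cabs (w - z)) / (rho / 4) = 256 * M / rho ^+ 2 * cabs (w - z).
    by field; rewrite gt_eqF.
  apply => x /sub [x1 x2].
  have [c1 dc1] : exists c1, cderiv f (v - z + 1 * x) c1.
    by apply: df; apply: disc_sub x2 _ x1.
  have [c2 dc2] : exists c1, cderiv f x c1.
    by apply: df; apply: lt_le_trans x2; rewrite ltr_pwDr// divr_gt0.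
  by eexists; apply: cderivD; [exact: cderiv_shift dc1|exact: cderivZ dc2].
have h1 := fM w wz; have h2 := fM z zz; have h3 := Cauchy_estimate rho0 df fM dc.
rewrite (le_trans (cabsB _ _))// (le_trans (lerD (cabsB _ _) (lexx _)))//.
rewrite cabsM; set s := cabs (w - z) in wz w2 *.
rewrite (le_trans (lerD (lerD h1 h2) (ler_wpM2r (cabs_ge0 _) h3)))// -/s.
have q : 1 <= 4 * s / rho.
  by rewrite ler_pdivlMr// mul1r mulrC -ler_pdivrMr// ltW.
have qM : M <= M * (4 * s / rho) by rewrite ler_peMr.
have q2 : M * (4 * s / rho) <= M * (4 * s / rho) * (4 * s / rho).
  by rewrite ler_peMr// (le_trans M0).
have -> : 256 * M / rho ^+ 2 * s ^+ 2 = 16 * (M * (4 * s / rho) * (4 * s / rho)).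
  by field; rewrite gt_eqF.
have -> : 4 * M / rho * s = M * (4 * s / rho) by field; rewrite gt_eqF.
by clear -q2 qM M0; lra.
Qed.

End CauchyOneVariable.

(** * Limits along an ultrafilter and the maximum principle *)

Section UltraLimits.
Local Open Scope classical_set_scope.

Lemma ultra_nat_ex : exists U : set_system nat, UltraFilter U /\ eventually `<=` U.
Proof. exact: ultraFilterLemma. Qed.

Definition ultra_nat : set_system nat := sval (cid ultra_nat_ex).

Lemma ultra_natP : UltraFilter ultra_nat.
Proof. exact: (svalP (cid ultra_nat_ex)).1. Qed.

Lemma ultra_nat_proper : ProperFilter ultra_nat.
Proof. exact: (@ultra_proper _ _ ultra_natP). Qed.

Definition umost (P : nat -> Prop) := ultra_nat [set n | P n].

Lemma umost_eventually (P : nat -> Prop) N : (forall n, (N <= n)%N -> P n) -> umost P.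
Proof. by move=> NP; apply: (svalP (cid ultra_nat_ex)).2; exists N. Qed.

Lemma umost_all (P : nat -> Prop) : (forall n, P n) -> umost P.
Proof. by move=> PP; apply: (@umost_eventually _ 0%N). Qed.

Lemma umostW (P Q : nat -> Prop) : (forall n, P n -> Q n) -> umost P -> umost Q.
Proof. by move=> PQ; apply: (@filterS _ _ ultra_nat_proper). Qed.

Lemma umostI (P Q : nat -> Prop) : umost P -> umost Q -> umost (fun n => P n /\ Q n).
Proof. by move=> hP hQ; apply: (@filterI _ _ ultra_nat_proper). Qed.

Lemma umost_ex (P : nat -> Prop) : umost P -> exists n, P n.
Proof. by move=> hP; apply: (@filter_ex _ _ ultra_nat_proper). Qed.

Lemma umost_em (P : nat -> Prop) : umost P \/ umost (fun n => ~ P n).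
Proof. exact: (in_ultra_setVsetC _ ultra_natP). Qed.

Variable R : realType.
Implicit Types (u v : nat -> R[i]) (l k z : R[i]) (r : nat -> R).

Definition utends u l := forall e : R, 0 < e -> umost (fun n => cabs (u n - l) < e).

Lemma umost_real_ex r (M : R) : (forall n, `|r n| <= M) ->
  exists l : R, forall e, 0 < e -> umost (fun n => `|r n - l| < e).
Proof.
move=> rM; pose S := [set x : R | umost (fun n => x <= r n)].
have hS : has_sup S.
  split; first by exists (- M); apply: umost_all => n; have := rM n; rewrite ler_norml => /andP[].
  exists M => x /umost_ex[n xn]; rewrite (le_trans xn)//.
  by have := rM n; rewrite ler_norml => /andP[].
exists (sup S) => e e0.
have [x Sx xs] := sup_adherent e0 hS.
have nS : ~ S (sup S + e / 2).
  by move=> /(sup_upper_bound hS); rewrite gerDl leNgt divr_gt0.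
have [//|ns] := umost_em (fun n => sup S + e / 2 <= r n).
apply: umostW (umostI Sx ns) => n [xr /negP]; rewrite -ltNge => rn.
by rewrite ltr_norml; apply/andP; split; clear -xs xr rn e0; lra.
Qed.

Lemma utends_ex u (M : R) : (forall n, cabs (u n) <= M) -> exists l, utends u l.
Proof.
move=> uM.
have [|a Ha] := @umost_real_ex (fun n => complex.Re (u n)) M.
  by move=> n; rewrite (le_trans (Re_le_cabs _)).
have [|b Hb] := @umost_real_ex (fun n => complex.Im (u n)) M.
  by move=> n; rewrite (le_trans (Im_le_cabs _)).
exists (Complex a b) => e e0; have e2 : 0 < e / 2 by rewrite divr_gt0.
apply: umostW (umostI (Ha _ e2) (Hb _ e2)) => n [h1 h2].
by rewrite (le_lt_trans (cabs_le_ReIm _))// cReB cImB (splitr e) ltrD.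
Qed.

Lemma utends_cst k : utends (fun=> k) k.
Proof. by move=> e e0; apply: umost_all => n; rewrite subrr cabs0. Qed.

Lemma utends_uniq u l l' : utends u l -> utends u l' -> l = l'.
Proof.
move=> ul ul'; apply/eqP; rewrite -subr_eq0 -cabs_eq0; apply/eqP.
apply/eqP; rewrite eq_le cabs_ge0 andbT; apply/ler_addgt0Pr => e e0; rewrite add0r.
have e2 : 0 < e / 2 by rewrite divr_gt0.
have [n [h1 h2]] := umost_ex (umostI (ul _ e2) (ul' _ e2)).
by rewrite (le_trans (cabs_tri (u n) _ _))// cabsC (splitr e) lerD// ltW.
Qed.

Lemma utends_ext u v l : (umost (fun n => u n = v n)) -> utends u l -> utends v l.
Proof.
by move=> uv ul e e0; apply: umostW (umostI uv (ul e e0)) => n [->].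
Qed.

Lemma utends_le u l (M : R) : utends u l -> umost (fun n => cabs (u n) <= M) -> cabs l <= M.
Proof.
move=> ul uM; apply/ler_addgt0Pr => e e0.
have [n [h1 h2]] := umost_ex (umostI (ul _ e0) uM).
rewrite -[l](subrK (u n)) (le_trans (cabsD _ _))// addrC lerD//.
by rewrite cabsC ltW.
Qed.

Lemma utends_ge u l (M : R) : utends u l -> umost (fun n => M <= cabs (u n)) -> M <= cabs l.
Proof.
move=> ul uM; apply/ler_addgt0Pr => e e0.
have [n [h1 h2]] := umost_ex (umostI (ul _ e0) uM).
rewrite (le_trans h2)// -[u n](subrK l) (le_trans (cabsD _ _))// addrC lerD//.
by rewrite ltW.
Qed.

Lemma utends_squeeze u l (r : nat -> R) :
  (umost (fun n => cabs (u n - l) <= r n)) ->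
  (forall e, 0 < e -> umost (fun n => r n < e)) -> utends u l.
Proof.
move=> h hr e e0; apply: umostW (umostI h (hr e e0)) => n [h1]; exact: le_lt_trans.
Qed.

Lemma utendsD u v l k : utends u l -> utends v k -> utends (fun n => u n + v n) (l + k).
Proof.
move=> ul vk e e0; have e2 : 0 < e / 2 by rewrite divr_gt0.
apply: umostW (umostI (ul _ e2) (vk _ e2)) => n [h1 h2].
by rewrite opprD addrACA (le_lt_trans (cabsD _ _))// (splitr e) ltrD.
Qed.

Lemma utends_cont (f : R[i] -> R[i]) u l : ccont_at f l -> utends u l ->
  utends (fun n => f (u n)) (f l).
Proof.
move=> cf ul e e0; have e2 : 0 < e / 2 by rewrite divr_gt0.
have [d d0 H] := cf _ e2; apply: umostW (ul _ d0) => n /H h.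
by rewrite (le_lt_trans h)// ltr_pdivrMr// ltr_pMr// ltr1n.
Qed.

Lemma utendsZ u l k : utends u l -> utends (fun n => k * u n) (k * l).
Proof.
apply: (@utends_cont (fun x => k * x)).
exact: cderiv_cont (cderivZ k (cderiv_id l)).
Qed.

Lemma utendsB u v l k : utends u l -> utends v k -> utends (fun n => u n - v n) (l - k).
Proof.
move=> ul /(utendsZ (-1)) vk; rewrite -[- k]mulN1r.
by apply: utends_ext (utendsD ul vk); apply: umost_all => n; rewrite mulN1r.
Qed.

Lemma utends_sum d (F : nat -> 'I_d -> R[i]) (L : 'I_d -> R[i]) :
  (forall i, utends (fun n => F n i) (L i)) ->
  utends (fun n => \sum_i F n i) (\sum_i L i).
Proof.
move=> FL.
have H (s : seq 'I_d) : utends (fun n => \sum_(i <- s) F n i) (\sum_(i <- s) L i).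
  elim: s => [|a s IH].
    rewrite big_nil; apply: utends_ext (utends_cst 0).
    by apply: umost_all => n; rewrite big_nil.
  rewrite big_cons; apply: utends_ext (utendsD (FL a) IH).
  by apply: umost_all => n; rewrite big_cons.
exact: H.
Qed.

Lemma umost_forall_ord d (P : nat -> 'I_d -> Prop) :
  (forall i, umost (fun n => P n i)) -> umost (fun n => forall i, P n i).
Proof.
move=> HP.
have H (s : seq 'I_d) : umost (fun n => forall i, i \in s -> P n i).
  elim: s => [|a s IH]; first by apply: umost_all.
  apply: umostW (umostI (HP a) IH) => n [h1 h2] i.
  by rewrite inE => /orP[/eqP ->//|]; exact: h2.
by apply: umostW (H (enum 'I_d)) => n h i; apply: h; rewrite mem_enum.
Qed.

(** The value depends on the sequence alone (0 if there is no limit), so pointwise limits form a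
    function, and equal sequences have equal limits even where convergence is unknown. *)
Definition ulim u : R[i] := xget 0 [set l | utends u l].

Lemma ulimP u (M : R) : (forall n, cabs (u n) <= M) -> utends u (ulim u).
Proof. by move=> /utends_ex h; exact: (xgetPex 0 h). Qed.

Lemma ulim_eq u l : utends u l -> ulim u = l.
Proof.
by move=> ul; apply: (@utends_uniq u) => //; apply: (xgetPex 0); exists l.
Qed.

Lemma umost_small (e : R) : 0 < e -> umost (fun n => n.+1%:R^-1 < e).
Proof.
move=> e0; apply: (@umost_eventually _ (Num.truncn e^-1)) => n hn.
rewrite -[e]invrK ltf_pV2 ?posrE ?ltr0n ?invr_gt0//.
by apply: lt_le_trans (truncnS_gt _) _; rewrite ler_nat ltnS.
Qed.

End UltraLimits.

(** * Maximum principles on segments and on the unit disc *)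

Section MaximumPrinciple.
Variable R : realType.
Implicit Types (f g : R[i] -> R[i]) (z w c h : R[i]) (rho M m : R).

(* Repeated squaring would multiply the distance to [1] by at least [3/2]. *)
Lemma powers_near_one z : (forall n, cabs (z ^+ n - 1) <= 1 / 2) -> z = 1.
Proof.
move=> zn; apply/eqP; rewrite -subr_eq0; apply/negPn/negP => z1.
have z0 : 0 < cabs (z - 1) by rewrite cabs_gt0.
have grow k : (1 + k%:R / 2) * cabs (z - 1) <= cabs (z ^+ (2 ^ k) - 1).
  elim: k => [|k IH]; first by rewrite mul0r addr0 mul1r expn0 expr1.
  set y := z ^+ (2 ^ k) in IH.
  have -> : z ^+ (2 ^ k.+1) - 1 = (y - 1) * (y + 1).
    by rewrite expnS mulnC exprM -/y; ring.
  have y1 : 3 / 2 <= cabs (y + 1).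
    have := cabs_ger 2 (1 - y).
    have -> : 2 - (1 - y) = y + 1 :> R[i] by ring.
    rewrite cabs_two; have := zn (2 ^ k)%N; rewrite -/y cabsC.
    by clear; move=> *; lra.
  have s1 : 0 <= (1 + k%:R / 2) * cabs (z - 1).
    by rewrite mulr_ge0 ?cabs_ge0// addr_ge0// divr_ge0.
  have s2 : 0 <= 3 / 2 :> R by rewrite divr_ge0.
  rewrite cabsM (le_trans _ (ler_pM s1 s2 IH y1))//.
  rewrite -natr1 mulrAC ler_wpM2r ?cabs_ge0//.
  have : 0 <= k%:R :> R by rewrite ler0n.
  by clear; move=> *; lra.
have [k Hk] : exists k : nat, 1 / 2 < (1 + k%:R / 2) * cabs (z - 1).
  pose k := (Num.truncn (cabs (z - 1))^-1).+1; exists k.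
  have : (cabs (z - 1))^-1 < k%:R by rewrite /k truncnS_gt.
  rewrite -[_^-1]mul1r ltr_pdivrMr// => kk.
  rewrite mulrDl mul1r mulrAC; move: kk z0; set D := cabs (z - 1); set p := _ * D.
  by clear; move=> *; lra.
by have := lt_le_trans Hk (grow k); rewrite ltNge zn.
Qed.

(* All powers of [f / f z] are bounded by [1], hence uniformly Lipschitz at [z],
   where they take the value [1]. *)
Lemma local_max_const f z rho M : 0 < rho -> cdiff_on_disc f z rho ->
  bounded_on_disc f z rho M -> cabs (f z) = M ->
  forall w, cabs (w - z) < rho / 16 -> f w = f z.
Proof.
move=> rho0 df fM fz w wz.
have wz' : cabs (w - z) < rho.
  by rewrite (lt_trans wz)// ltr_pdivrMr// ltr_pMr// ltr1n.
have [z0|z0] := eqVneq (f z) 0.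
  have := fM w wz'; rewrite -fz z0 cabs0 => h; apply/eqP.
  by rewrite -cabs_eq0 eq_le cabs_ge0 h.
suff : (f z)^-1 * f w = 1.
  by move=> /(congr1 ( *%R (f z))); rewrite mulrA mulfV// mul1r mulr1.
apply: powers_near_one => n.
pose g x := ((f z)^-1 * f x) ^+ n.
have gz : g z = 1 by rewrite /g mulVf ?expr1n.
have := @Lipschitz_disc R g z rho 1 w rho0.
rewrite gz -/(g w) mulr1 => /(_ _ _ wz') h; apply: le_trans (h _ _) _.
- move=> x /df[c dc]; eexists; exact: (cderivX n (cderivZ _ dc)).
- move=> x /fM fx; rewrite cabsX exprn_ile1 ?cabs_ge0// cabsM cabsV fz mulrC.
  by rewrite ler_pdivrMr ?mul1r// -fz cabs_gt0.
(* The Lipschitz constant 8 / rho times a distance below rho / 16 is at most 1/2. *)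
- rewrite mulrAC ler_pdivrMr//; move: wz; rewrite ltr_pdivlMr// => wz.
  by clear -wz; lra.
Qed.

(** The bisected property is directed: maximality at the left end of a subsegment passes to its
    right end. On short subsegments this is the local statement around the left end, in a disc of
    radius [rho / 2]; hence the length [rho / 32]. *)
Lemma max_principle_seg f m :
  (forall t : R, 0 <= t <= 1 -> exists2 rho, 0 < rho &
    cdiff_on_disc f (rC t) rho /\ bounded_on_disc f (rC t) rho m) ->
  cabs (f 0) = m -> f 1 = f 0.
Proof.
move=> H f0.
pose P (x w : R) := cabs (f (rC x)) = m -> f (rC (x + w)) = f (rC x).
have : P 0 1.
  apply: (@bisect_seg R P); rewrite /P.
    move=> x w _ _ _ h1 h2 fx; rewrite addrA h2 h1//.
  move=> a /H[rho rho0 [df fM]]; exists (rho / 32); first by rewrite divr_gt0.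
  move=> x w w0 x0 xw /andP[xa aw] wr fx.
  have r2 : 0 < rho / 2 by rewrite divr_gt0.
  have sub : cabs (rC x - rC a) + rho / 2 <= rho.
    rewrite -rCB cabs_rC ler0_norm ?subr_le0//.
    by clear -xa aw wr rho0; lra.
  apply: (local_max_const r2 _ _ fx).
  - by move=> v /(disc_sub sub); exact: df.
  - by move=> v /(disc_sub sub); exact: fM.
  - rewrite -rCB [x + w]addrC addrK cabs_rC gtr0_norm//.
    by clear -wr; lra.
by rewrite /P add0r => /(_ f0).
Qed.

Lemma cabs_segment_lt1 z w (t : R) : 0 <= t <= 1 -> cabs z < 1 -> cabs w < 1 ->
  cabs (z + (w - z) * rC t) < 1.
Proof.
move=> /andP[t0 t1] z1 w1.
have -> : z + (w - z) * rC t = rC (1 - t) * z + rC t * w by rewrite rCB rC1; ring.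
rewrite (le_lt_trans (cabsD _ _))// !cabsM !cabs_rC (ger0_norm t0) ger0_norm ?subr_ge0//.
pose k := Num.max (cabs z) (cabs w); have k1 : k < 1 by rewrite gt_max z1.
apply: le_lt_trans k1; rewrite [leRHS](_ : _ = (1 - t) * k + t * k); last by ring.
by rewrite lerD// ler_wpM2l// ?subr_ge0// le_max lexx ?orbT.
Qed.

Lemma cdiff_unit_ccont f z : cdiff_on_disc f 0 1 -> cabs z < 1 -> ccont_at f z.
Proof. by move=> df z1; have [|c /cderiv_cont] := df z; rewrite ?subr0. Qed.

(** If |f| exceeded m at z0, the points where |f| >= |f z0| would stay in a disc of radius s < 1.
    Limits along the ultrafilter then show that |f| is bounded and attains its supremum, and the
    segment principle carries the maximal value to a point beyond s. *)
Lemma weak_max_unit_disc f m : cdiff_on_disc f 0 1 ->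
  (forall e, 0 < e -> exists2 s, s < 1 & forall z, s < cabs z -> cabs z < 1 -> cabs (f z) <= m + e) ->
  forall z, cabs z < 1 -> cabs (f z) <= m.
Proof.
move=> df bd z0 z01; rewrite leNgt; apply/negP => mz0.
pose e := (cabs (f z0) - m) / 2.
have e0 : 0 < e by rewrite divr_gt0// subr_gt0.
have [s s1 Hs] := bd e e0.
have big z : cabs z < 1 -> cabs (f z0) <= cabs (f z) -> cabs z <= s.
  move=> z1 fz; rewrite leNgt; apply/negP => sz; have := Hs z sz z1.
  by apply/negP; rewrite -ltNge (lt_le_trans _ fz)// /e; clear -mz0; lra.
pose S := [set cabs (f z) | z in [set z | cabs z < 1 /\ cabs (f z0) <= cabs (f z)]]%classic.
have conv (zn : nat -> R[i]) : (forall n, cabs (zn n) < 1 /\ cabs (f z0) <= cabs (f (zn n))) ->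
    exists2 y, cabs y < 1 & utends zn y /\ utends (fun n => f (zn n)) (f y).
  move=> hz; have hs n : cabs (zn n) <= s by apply: big; case: (hz n).
  have [y zy] := utends_ex hs.
  have y1 : cabs y < 1 by rewrite (le_lt_trans _ s1)// (utends_le zy)//; exact: umost_all.
  by exists y => //; split => //; apply: utends_cont => //; exact: cdiff_unit_ccont.
have supS : has_sup S.
  split; first by exists (cabs (f z0)), z0.
  apply: contrapT => nub.
  have /choice[zn Hzn] n : exists z, (cabs z < 1 /\ cabs (f z0) <= cabs (f z)) /\ n%:R < cabs (f z).
    apply: contrapT => nz; apply: nub; exists n%:R => _ [z hz <-].
    by rewrite leNgt; apply/negP => nfz; apply: nz; exists z.
  have [y y1 [_ fy]] := conv zn (fun n => (Hzn n).1).
  have [k Hk] : exists k : nat, cabs (f y) + 1 <= k%:R.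
    by exists (Num.truncn (cabs (f y) + 1)).+1; rewrite ltW// truncnS_gt.
  have : cabs (f y) + 1 <= cabs (f y).
    apply: (utends_ge fy); apply: (@umost_eventually _ k) => n kn.
    by rewrite (le_trans Hk)// (le_trans _ (ltW (Hzn n).2))// ler_nat.
  by rewrite gerDl ler10.
pose M := sup S.
have fM z : cabs z < 1 -> cabs (f z) <= M.
  move=> z1; have [h|/ltW h] := leP (cabs (f z0)) (cabs (f z)).
    by apply: sup_upper_bound => //; exists z.
  by apply: le_trans h _; apply: sup_upper_bound => //; exists z0.
have [y y1 fyM] : exists2 y, cabs y < 1 & cabs (f y) = M.
  have /choice[zn Hzn] (n : nat) : exists z, (cabs z < 1 /\ cabs (f z0) <= cabs (f z)) /\
      M - n.+1%:R^-1 < cabs (f z).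
    have n0 : 0 < n.+1%:R^-1 :> R by rewrite invr_gt0.
    by have [_ [z hz <-] Mz] := sup_adherent n0 supS; exists z.
  have [y y1 [_ fy]] := conv zn (fun n => (Hzn n).1).
  exists y => //; apply/eqP; rewrite eq_le fM//=.
  apply/ler_addgt0Pr => d d0; rewrite -lerBlDr.
  apply: (utends_ge fy); apply: umostW (umost_small d0) => n nd.
  by rewrite (le_trans _ (ltW (Hzn n).2))// lerB// ltW.
have ms : Num.max s 0 < 1 by rewrite gt_max s1 ltr01.
pose b : R := (Num.max s 0 + 1) / 2.
have b0 : 0 < b by rewrite divr_gt0// ltr_wpDl// le_max lexx orbT.
have b1 : b < 1 by rewrite /b; clear -ms; lra.
have sb : s < b.
  by rewrite (le_lt_trans (_ : s <= Num.max s 0)) ?le_max ?lexx// /b; clear -ms; lra.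
have e1 : f (rC b) = f y.
  pose F x := f (y + (rC b - y) * x).
  have <- : F 0 = f y by rewrite /F mulr0 addr0.
  have <- : F 1 = f (rC b) by rewrite /F mulr1 [y + _]addrC subrK.
  apply: (@max_principle_seg F M); last by rewrite /F mulr0 addr0.
  move=> t t01; set v := y + (rC b - y) * rC t.
  have v1 : cabs v < 1 by rewrite cabs_segment_lt1// cabs_rC gtr0_norm.
  pose K := cabs (rC b - y) + 1.
  have K0 : 0 < K by rewrite ltr_wpDl ?cabs_ge0.
  have sub x : cabs (x - rC t) < (1 - cabs v) / K -> cabs (y + (rC b - y) * x - 0) < 1.
    move=> xt; rewrite subr0.
    have -> : y + (rC b - y) * x = v + (rC b - y) * (x - rC t) by rewrite /v; ring.
    rewrite (le_lt_trans (cabsD _ _))// -ltrBrDl cabsM.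
    move: xt; rewrite ltr_pdivlMr// mulrC; apply: le_lt_trans.
    by rewrite ler_wpM2r ?cabs_ge0// lerDl.
  exists ((1 - cabs v) / K); first by rewrite divr_gt0// subr_gt0.
  split; last by move=> x /sub; rewrite subr0; exact: fM.
  by move=> x /sub/df[c dc]; eexists; exact: (cderiv_shift dc).
have fz0 : cabs (f z0) <= M by exact: fM.
have := Hs (rC b); rewrite cabs_rC gtr0_norm// => /(_ sb b1).
rewrite e1 fyM; apply/negP; rewrite -ltNge (lt_le_trans _ fz0)// /e.
by clear -mz0; lra.
Qed.

Lemma zero_of_boundary f : cdiff_on_disc f 0 1 ->
  (forall e, 0 < e -> exists2 s, s < 1 & forall z, s < cabs z -> cabs z < 1 -> cabs (f z) <= e) ->
  forall z, cabs z < 1 -> f z = 0.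
Proof.
move=> df bd z z1; apply/eqP; rewrite -cabs_eq0 eq_le cabs_ge0 andbT.
apply: (weak_max_unit_disc df _ z1) => e /bd[s s1 Hs]; exists s => // w sw w1.
by rewrite add0r Hs.
Qed.

End MaximumPrinciple.

(** * Holomorphic functions of several variables *)

Section SeveralVariables.
Variables (R : realType) (d : nat).
Local Notation C := R[i].
Local Notation pt := (pt R d).
Local Notation cset := (cset R d).
Implicit Types (a h z w : pt) (f g : pt -> C) (U Om : cset).

Definition padd a h : pt := fun i => a i + h i.
Definition psub a h : pt := fun i => a i - h i.
Definition pscale (k : C) h : pt := fun i => k * h i.
Definition l1norm h : R := \sum_(i < d) cabs (h i).
Definition pairing (c h : pt) : C := \sum_(i < d) c i * h i.

Lemma padd_sub a z : padd a (psub z a) = z.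
Proof. by apply/funext => i; rewrite /psub /padd addrC subrK. Qed.

Lemma l1norm_ge0 h : 0 <= l1norm h.
Proof. by apply: sumr_ge0 => i _; exact: cabs_ge0. Qed.

Lemma cabs_le_l1norm h i : cabs (h i) <= l1norm h.
Proof.
by rewrite /l1norm (bigD1 i)//= lerDl sumr_ge0// => j _; exact: cabs_ge0.
Qed.

Lemma l1norm_le h (e : R) : (forall i, cabs (h i) <= e) -> l1norm h <= d%:R * e.
Proof.
move=> he; apply: le_trans (ler_sum _ (fun i _ => he i)) _.
by rewrite sumr_const card_ord mulr_natl.
Qed.

(** Compares the sup-norm balls defining open sets with the l1 norm in the error term of
    [holomorphic]; the denominator [d%:R + 1] is positive also for d = 0. *)
Lemma l1norm_lt h (e : R) : 0 < e -> (forall i, cabs (h i) < e / (d%:R + 1)) ->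
  l1norm h < e.
Proof.
move=> e0 he; apply: (@le_lt_trans _ _ (d%:R * (e / (d%:R + 1)))).
  by apply: l1norm_le => i; exact/ltW.
by rewrite mulrCA gtr_pMr// ltr_pdivrMr ?mul1r ?ltrDl// ltr_wpDl.
Qed.

Lemma l1norm_scale k h : l1norm (pscale k h) = cabs k * l1norm h.
Proof. by rewrite /l1norm mulr_sumr; apply: eq_bigr => i _; rewrite cabsM. Qed.

Lemma l1norm_eq0 h : l1norm h = 0 -> forall i, h i = 0.
Proof.
move=> h0 i; apply/eqP; rewrite -cabs_eq0 eq_le cabs_ge0 andbT -h0.
exact: cabs_le_l1norm.
Qed.

Lemma pairing_le (c h : pt) (K : R) : (forall i, cabs (c i) <= K) ->
  cabs (pairing c h) <= K * l1norm h.
Proof.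
move=> cK; rewrite (le_trans (cabs_sum _ _))// mulr_sumr ler_sum// => i _.
by rewrite cabsM ler_wpM2r ?cabs_ge0.
Qed.

Lemma pairing_big_O (c : pt) : big_O l1norm (pairing c).
Proof.
exists (l1norm c), 1 => // h _; apply: pairing_le => i; exact: cabs_le_l1norm.
Qed.

Lemma cballE z (e : R) w : cball z e w <-> forall i, cabs (w i - z i) < e.
Proof. by split=> H i; move: (H i); rewrite normcE_cabs rC_lt. Qed.

Definition hderiv f a (c : pt) := expansion l1norm (fun h => f (padd a h)) (f a) (pairing c).
Definition hdiff f a := exists c, hderiv f a c.

Lemma padd0 a h : (forall i, h i = 0) -> padd a h = a.
Proof. by move=> h0; apply/funext => i; rewrite /padd h0 addr0. Qed.

Lemma is_open_l1 U a : is_open U -> U a ->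
  exists2 e : R, 0 < e & forall h, l1norm h < e -> U (padd a h).
Proof.
move=> oU /oU[e [e0 He]]; exists e => // h he; apply: He; apply/cballE => i.
by rewrite /padd [a i + _]addrC addrK (le_lt_trans (cabs_le_l1norm _ _)).
Qed.

Lemma holomorphicP U f : holomorphic U f <-> is_open U /\ forall a, U a -> hdiff f a.
Proof.
have normE h : \sum_(i < d) `|h i| = rC (l1norm h).
  by rewrite /l1norm /rC rmorph_sum; apply: eq_bigr => i _; rewrite normcE_cabs.
split=> [[oU H]|[oU H]]; split=> // a Ua.
- have [c Hc] := H a Ua; exists c => e e0.
  have [e1 e10 He1] := is_open_l1 oU Ua; have [del [d0 Hd]] := Hc e e0.
  exists (Num.min e1 del); first by rewrite lt_min e10.
  move=> h; rewrite lt_min => /andP[h1 h2].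
  have := Hd h; rewrite normcE_cabs normE -rCM rC_le; apply; last exact: He1.
  by move=> i; rewrite normcE_cabs rC_lt (le_lt_trans (cabs_le_l1norm _ _)).
- have [c Hc] := H a Ua; exists c => e e0.
  have [del d0 Hd] := Hc e e0; exists (del / (d%:R + 1)).
  have d10 : 0 < d%:R + 1 :> R by rewrite ltr_wpDl.
  split; first by rewrite divr_gt0.
  move=> h hd _; rewrite normcE_cabs normE -rCM rC_le; apply: Hd.
  by apply: l1norm_lt => // i; have := hd i; rewrite normcE_cabs rC_lt.
Qed.

Lemma holo_hdiff U f a : holomorphic U f -> U a -> hdiff f a.
Proof. by move=> /holomorphicP[_]; apply. Qed.

Lemma hdiffD f g a : hdiff f a -> hdiff g a -> hdiff (fun z => f z + g z) a.
Proof.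
move=> [c dc] [c' dc']; exists (padd c c').
apply: expansion_eq (expansionD dc dc') => h.
by rewrite /pairing -big_split/=; apply: eq_bigr => i _; rewrite mulrDl.
Qed.

Lemma hdiffZ k f a : hdiff f a -> hdiff (fun z => k * f z) a.
Proof.
move=> [c dc]; exists (pscale k c).
apply: expansion_eq (expansionZ dc k) => h.
by rewrite /pairing mulr_sumr; apply: eq_bigr => i _; rewrite mulrA.
Qed.

Lemma hdiffB f g a : hdiff f a -> hdiff g a -> hdiff (fun z => f z - g z) a.
Proof.
move=> df /(hdiffZ (-1)) dg; have := hdiffD df dg.
by rewrite (_ : (fun z => _ + -1 * _) = (fun z => f z - g z))//; apply/funext => z; rewrite mulN1r.
Qed.

Lemma hdiffM f g a : hdiff f a -> hdiff g a -> hdiff (fun z => f z * g z) a.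
Proof.
move=> [c dc] [c' dc']; exists (padd (pscale (f a) c') (pscale (g a) c)).
apply: expansion_eq (expansionM l1norm_ge0 (pairing_big_O c) (pairing_big_O c') dc dc') => h.
rewrite /pairing !mulr_sumr -big_split/=; apply: eq_bigr => i _.
by rewrite mulrDl !mulrA.
Qed.

Lemma hdiffV f a : f a != 0 -> hdiff f a -> hdiff (fun z => (f z)^-1) a.
Proof.
move=> f0 [c dc]; exists (pscale (- f a ^- 2) c).
apply: expansion_eq (expansion_inv l1norm_ge0 (pairing_big_O c) dc f0) => h.
by rewrite /pairing mulr_sumr; apply: eq_bigr => i _; rewrite mulrA.
Qed.

Lemma hdiff_cst k a : hdiff (fun=> k) a.
Proof.
exists (fun=> 0) => e e0; exists 1 => // h _.
rewrite subrr /pairing big1 => [|i _]; last by rewrite mul0r.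
by rewrite subrr cabs0 mulr_ge0 ?l1norm_ge0 ?ltW.
Qed.

Lemma hdiff_proj i a : hdiff (fun z => z i) a.
Proof.
exists (fun j => (j == i)%:R) => e e0; exists 1 => // h _.
rewrite /pairing (bigD1 i)//= eqxx mul1r big1 => [|j /negPf ->]; last by rewrite mul0r.
by rewrite addr0 /padd [a i + _]addrC addrK subrr cabs0 mulr_ge0 ?l1norm_ge0 ?ltW.
Qed.

Lemma hdiffX f a n : hdiff f a -> hdiff (fun z => f z ^+ n) a.
Proof.
move=> df; elim: n => [|n IH]; first exact: hdiff_cst.
have := hdiffM df IH; rewrite (_ : (fun z => _ * _) = (fun z => f z ^+ n.+1))//.
by apply/funext => z; rewrite exprS.
Qed.

Lemma hdiff_sum n (F : 'I_n -> pt -> C) (P : pred 'I_n) a : (forall i, hdiff (F i) a) ->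
  hdiff (fun z => \sum_(i | P i) F i z) a.
Proof.
move=> dF; rewrite /index_enum; elim: (Finite.enum _) => [|b s IH].
  rewrite (_ : (fun z => _) = fun=> 0); first exact: hdiff_cst.
  by apply/funext => z; rewrite big_nil.
rewrite (_ : (fun z => _) = fun z => (if P b then F b z else 0) + \sum_(i <- s | P i) F i z).
  by apply: hdiffD => //; case: (P b) => //; exact: hdiff_cst.
by apply/funext => z; rewrite big_cons; case: (P b) => //; rewrite add0r.
Qed.

Lemma hdiff_lip f a : hdiff f a -> exists2 K : R, 0 < K & exists2 del, 0 < del &
  forall h, l1norm h < del -> cabs (f (padd a h) - f a) <= K * l1norm h.
Proof.
move=> [c df]; apply: big_O_pos; first exact: l1norm_ge0.
exact: expansion_big_O (pairing_big_O c) df.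
Qed.

Lemma hdiff_cont f a : hdiff f a -> forall e : R, 0 < e -> exists2 del, 0 < del &
  forall h, l1norm h < del -> cabs (f (padd a h) - f a) <= e.
Proof.
move=> /hdiff_lip[K K0 [del d0 H]] e e0.
exists (Num.min del (e / K)); first by rewrite lt_min d0 divr_gt0.
move=> h; rewrite lt_min => /andP[/H h1 h2]; rewrite (le_trans h1)//.
by rewrite mulrC -ler_pdivlMr// ltW.
Qed.

Lemma hdiff_comp f (G : pt -> pt) a : (forall i, hdiff (fun z => G z i) a) ->
  hdiff f (G a) -> hdiff (fun z => f (G z)) a.
Proof.
move=> dG [c df].
have /choice[D HD] : forall i, exists c, hderiv (fun z => G z i) a c by [].
pose L h : pt := fun i => pairing (D i) h.
have bL i : big_O l1norm (fun h => G (padd a h) i - G a i).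
  exact: expansion_big_O (pairing_big_O _) (HD i).
have [K K0 [del d0 Hdel]] : exists2 K : R, 0 < K & exists2 del, 0 < del &
    forall h, l1norm h < del -> l1norm (psub (G (padd a h)) (G a)) <= K * l1norm h.
  have /choice[k Hk] i : exists k : R * R, [/\ 0 < k.1, 0 < k.2 & forall h, l1norm h < k.2 ->
      cabs (G (padd a h) i - G a i) <= k.1 * l1norm h].
    by have [K K0 [dl d0 H]] := big_O_pos l1norm_ge0 (bL i); exists (K, dl).
  exists (1 + \sum_i (k i).1); first by rewrite ltr_pwDl// sumr_ge0// => i _; have [/ltW] := Hk i.
  exists (\big[Num.min/1]_(i < d) (k i).2).
    by elim/big_ind : _ => [//|x y x0 y0|i _]; [rewrite lt_min x0|have [] := Hk i].
  move=> h hm; rewrite mulrDl mul1r mulr_suml ler_wpDl ?l1norm_ge0//.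
  apply: ler_sum => i _; have [_ _] := Hk i; apply; apply: lt_le_trans hm _.
  by rewrite (bigD1 i)//= ge_min lexx.
exists (fun j => \sum_i c i * D i j).
have h1 : little_o l1norm (fun h => f (G (padd a h)) - f (G a) -
    pairing c (psub (G (padd a h)) (G a))).
  move=> e e0; have [|d' d'0 H'] := df (e / K); first by rewrite divr_gt0.
  exists (Num.min del (d' / K)); first by rewrite lt_min d0 divr_gt0.
  move=> h; rewrite lt_min => /andP[/Hdel gh h2].
  have /H' : l1norm (psub (G (padd a h)) (G a)) < d'.
    by rewrite (le_lt_trans gh)// mulrC -ltr_pdivlMr.
  rewrite padd_sub => /le_trans; apply.
  by rewrite -mulrA ler_pM2l// ler_pdivrMl.
have h2 : little_o l1norm (fun h => \sum_i c i * (G (padd a h) i - G a i - L h i)).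
  have H (s : seq 'I_d) : little_o l1norm
      (fun h => \sum_(i <- s) c i * (G (padd a h) i - G a i - L h i)).
    elim: s => [|b s IH].
      by move=> e e0; exists 1 => // h _; rewrite big_nil cabs0 mulr_ge0 ?l1norm_ge0 ?ltW.
    apply: little_o_ext (little_oD (little_oZ (c b) (HD b)) IH).
    by exists 1 => // h _; rewrite big_cons.
  exact: H.
apply: little_o_ext (little_oD h1 h2); exists 1 => // h _.
rewrite -addrA; congr (_ + _).
rewrite /pairing -[- _ + _]opprK opprD opprK; congr (- _).
rewrite -sumrB; under [RHS]eq_bigr => j _ do rewrite mulr_suml.
rewrite exchange_big/=; apply: eq_bigr => i _.
rewrite -mulrBr /psub opprB addrCA subrr addr0 /L /pairing mulr_sumr.
by apply: eq_bigr => j _; rewrite mulrA.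
Qed.

Definition line a h (x : C) : pt := padd a (pscale x h).

Lemma hderiv_line f a h x c : hderiv f (line a h x) c ->
  cderiv (fun y => f (line a h y)) x (pairing c h).
Proof.
move=> df e e0; have h0 : 0 < l1norm h + 1 by rewrite ltr_wpDl ?l1norm_ge0.
have [|del d0 H] := df (e / (l1norm h + 1)); first by rewrite divr_gt0.
exists (del / (l1norm h + 1)); first by rewrite divr_gt0.
move=> y yd; have := H (pscale y h); rewrite l1norm_scale.
have -> : padd (line a h x) (pscale y h) = line a h (x + y).
  by apply/funext => i; rewrite /line /padd /pscale mulrDl addrA.
have -> : pairing c (pscale y h) = pairing c h * y.
  by rewrite /pairing mulr_suml; apply: eq_bigr => i _; rewrite /pscale mulrA mulrAC.
have yh : cabs y * l1norm h <= cabs y * (l1norm h + 1).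
  by rewrite ler_wpM2l ?cabs_ge0// lerDl.
move=> /(_ _)/le_trans; apply.
  by rewrite (le_lt_trans yh)// -ltr_pdivlMr.
rewrite mulrAC ler_pdivrMr// -mulrA ler_wpM2l// ltW//.
Qed.

Lemma hdiff_line f a h x : hdiff f (line a h x) ->
  exists c, cderiv (fun y => f (line a h y)) x c.
Proof. by move=> [c /hderiv_line H]; eexists; exact: H. Qed.

Section Ball.
Variables (f : pt -> C) (a : pt) (e M : R).
Hypotheses (e0 : 0 < e) (df : forall h, l1norm h < e -> hdiff f (padd a h))
  (fM : forall h, l1norm h < e -> cabs (f (padd a h)) <= M).

Let line0 h : line a h 0 = a.
Proof. by apply/funext => i; rewrite /line /padd /pscale mul0r addr0. Qed.

Let line1 h : line a h 1 = padd a h.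
Proof. by apply/funext => i; rewrite /line /padd /pscale mul1r. Qed.

Let dl h (s : R) : 0 < s -> l1norm h <= s ->
  cdiff_on_disc (fun x => f (line a h x)) 0 (e / s).
Proof.
move=> s0 hs x; rewrite subr0 ltr_pdivlMr// => xs.
apply: hdiff_line; apply: df; rewrite l1norm_scale (le_lt_trans _ xs)//.
by rewrite ler_wpM2l// cabs_ge0.
Qed.

Let bl h (s : R) : 0 < s -> l1norm h <= s ->
  bounded_on_disc (fun x => f (line a h x)) 0 (e / s) M.
Proof.
move=> s0 hs x; rewrite subr0 ltr_pdivlMr// => xs.
apply: fM; rewrite l1norm_scale (le_lt_trans _ xs)//.
by rewrite ler_wpM2l// cabs_ge0.
Qed.

(** On the complex line through a and a + h the parameter runs over a disc of radius [e / l1norm h]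
    around 0, and a + h is the parameter 1. The Taylor bound below uses the same restriction. *)
Lemma Lipschitz_ball h : l1norm h < e -> cabs (f (padd a h) - f a) <= 8 * M / e * l1norm h.
Proof.
move=> he; have [h0|h0] := eqVneq (l1norm h) 0.
  by rewrite padd0 ?subrr ?cabs0 ?h0 ?mulr0//; exact: l1norm_eq0.
have s0 : 0 < l1norm h by rewrite lt_def h0 l1norm_ge0.
have := Lipschitz_disc (divr_gt0 e0 s0) (dl s0 (lexx _)) (bl s0 (lexx _)) (w := 1).
rewrite subr0 cabs1 mulr1 line0 line1 ltr_pdivlMr// mul1r => /(_ he).
by rewrite invf_div mulrA mulrAC.
Qed.

Lemma Taylor2_ball c h : hderiv f a c -> l1norm h < e ->
  cabs (f (padd a h) - f a - pairing c h) <= 256 * M / e ^+ 2 * l1norm h ^+ 2.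
Proof.
move=> dc he; have [h0|h0] := eqVneq (l1norm h) 0.
  rewrite padd0 ?subrr; last exact: l1norm_eq0.
  rewrite h0 expr0n mulr0 /pairing big1 ?subr0 ?cabs0// => i _.
  by rewrite (l1norm_eq0 h0) mulr0.
have s0 : 0 < l1norm h by rewrite lt_def h0 l1norm_ge0.
have dc0 : cderiv (fun x => f (line a h x)) 0 (pairing c h).
  by apply: hderiv_line; rewrite line0.
have := Taylor2_disc (divr_gt0 e0 s0) (dl s0 (lexx _)) (bl s0 (lexx _)) dc0 (w := 1).
rewrite subr0 cabs1 expr1n !mulr1 line0 line1 ltr_pdivlMr// mul1r => /(_ he).
by rewrite exprMn invfM exprVn invrK mulrA.
Qed.

Lemma Cauchy_ball c i : hderiv f a c -> cabs (c i) <= 4 * M / e.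
Proof.
move=> dc; pose h : pt := fun j => (j == i)%:R.
have h1 : l1norm h = 1.
  rewrite /l1norm (bigD1 i)//= /h eqxx cabs1 big1 ?addr0// => j /negPf ->.
  by rewrite cabs0.
have ch : pairing c h = c i.
  rewrite /pairing (bigD1 i)//= /h eqxx mulr1 big1 ?addr0// => j /negPf ->.
  by rewrite mulr0.
have dc0 : cderiv (fun x => f (line a h x)) 0 (c i).
  by rewrite -ch; apply: hderiv_line; rewrite line0.
have l1 : l1norm h <= 1 by rewrite h1.
have := Cauchy_estimate (divr_gt0 e0 ltr01) (dl ltr01 l1) (bl ltr01 l1) dc0.
by rewrite divr1.
Qed.

End Ball.

Section UltraLimitHolomorphic.
Variables (Om : cset) (F : nat -> pt -> C) (f : pt -> C) (M : R).
Hypotheses (oOm : is_open Om) (dF : forall n z, Om z -> hdiff (F n) z)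
  (FM : forall n z, Om z -> cabs (F n z) <= M)
  (Ff : forall z, Om z -> utends (fun n => F n z) (f z)).

(** Cauchy's estimate bounds the derivatives of all [F n] at a, so they have a limit [c]; the
    quadratic Taylor remainder has the same constant for every n and passes to the limit. *)
Lemma utends_hdiff a : Om a -> hdiff f a.
Proof.
move=> Oa; have [e e0 He] := is_open_l1 oOm Oa.
have /choice[D HD] n : exists c, hderiv (F n) a c by exact: dF.
have bD n i : cabs (D n i) <= 4 * M / e.
  by apply: (Cauchy_ball e0 _ _ _ (HD n)) => h /He; [exact: dF|exact: FM].
have /choice[c Hc] i : exists l, utends (fun n => D n i) l.
  by apply: utends_ex => n; exact: bD.
exists c => eps eps0.
pose K := 256 * M / e ^+ 2.
have K0 : 0 <= K.
  have M0 : 0 <= M by rewrite (le_trans (cabs_ge0 _) (FM 0%N Oa)).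
  by rewrite mulr_ge0 ?mulr_ge0// invr_ge0 exprn_ge0// ltW.
have K1 : 0 < K + 1 by rewrite ltr_wpDl.
exists (Num.min e (eps / (K + 1))); first by rewrite lt_min e0 divr_gt0.
move=> h; rewrite lt_min => /andP[he heps].
apply: (@le_trans _ _ (K * l1norm h ^+ 2)).
  have T : utends (fun n => F n (padd a h) - F n a - pairing (D n) h)
      (f (padd a h) - f a - pairing c h).
    apply: utendsB; first by apply: utendsB; apply: Ff => //; exact: He.
    apply: utends_sum => i; have := utendsZ (h i) (Hc i); rewrite mulrC.
    by apply: utends_ext; apply: umost_all => n; rewrite mulrC.
  apply: (utends_le T); apply: umost_all => n.
  by apply: (Taylor2_ball e0 _ _ (HD n) he) => h' /He; [exact: dF|exact: FM].
rewrite expr2 mulrA ler_wpM2r ?l1norm_ge0//.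
move: heps; rewrite ltr_pdivlMr// => /ltW; apply: le_trans.
by rewrite mulrC ler_wpM2l ?l1norm_ge0// lerDl.
Qed.

(** A Lipschitz bound near z common to all [F n] allows evaluation at points that move with n. *)
Lemma utends_equicont (zn : nat -> pt) z : Om z ->
  (forall i, utends (fun n => zn n i) (z i)) ->
  utends (fun n => F n (zn n)) (f z).
Proof.
move=> Oz znz; have [e e0 He] := is_open_l1 oOm Oz.
have sm : forall del, 0 < del -> umost (fun n => l1norm (psub (zn n) z) < del).
  move=> del d0; have dd : 0 < del / (d%:R + 1) by rewrite divr_gt0// ltr_wpDl.
  have := umost_forall_ord (fun i => znz i _ dd).
  by apply: umostW => n Hn; exact: l1norm_lt.
have T : utends (fun n => F n (zn n) - F n z) 0.
  apply: (@utends_squeeze _ _ _ (fun n => (8 * M / e) * l1norm (psub (zn n) z))).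
    apply: umostW (sm e e0) => n hn; rewrite subr0.
    rewrite -{1}[zn n](padd_sub z).
    by apply: Lipschitz_ball => // h /He; [exact: dF|exact: FM].
  move=> eps eps0; set K := 8 * M / e.
  have K1 : 0 < `|K| + 1 by rewrite ltr_wpDl.
  apply: umostW (sm _ (divr_gt0 eps0 K1)) => n; rewrite ltr_pdivlMr//.
  apply: le_lt_trans; rewrite mulrC ler_wpM2l ?l1norm_ge0//.
  by rewrite (le_trans (ler_norm K))// lerDl.
have := utendsD T (Ff Oz); rewrite add0r; apply: utends_ext.
by apply: umost_all => n; rewrite subrK.
Qed.

End UltraLimitHolomorphic.

Lemma max_principle_convex Om f (m : R) y z : is_open Om -> convex_set Om ->
  (forall a, Om a -> hdiff f a) -> (forall a, Om a -> cabs (f a) <= m) ->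
  Om y -> cabs (f y) = m -> Om z -> f z = f y.
Proof.
move=> oOm cOm df fm Oy fy Oz.
pose h := psub z y.
have <- : f (line y h 1) = f z.
  congr f; apply/funext => i; rewrite /line /padd /pscale mul1r /h /psub.
  by rewrite addrC subrK.
have l0 : line y h 0 = y by apply/funext => i; rewrite /line /padd /pscale mul0r addr0.
rewrite -[in RHS]l0.
apply: (@max_principle_seg _ (fun x => f (line y h x)) m); last by rewrite l0.
move=> t /andP[t0 t1].
have Ot : Om (line y h (rC t)).
  rewrite (_ : line y h (rC t) = fun i => rC t * z i + rC (1 - t) * y i); first exact: cOm.
  by apply/funext => i; rewrite /line /padd /pscale /h /psub rCB rC1; ring.
have [e e0 He] := is_open_l1 oOm Ot.
have h0 : 0 < l1norm h + 1 by rewrite ltr_wpDl ?l1norm_ge0.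
have sub x : cabs (x - rC t) < e / (l1norm h + 1) -> Om (line y h x).
  move=> xt.
  rewrite (_ : line y h x = padd (line y h (rC t)) (pscale (x - rC t) h)).
    apply: He; rewrite l1norm_scale; move: xt; rewrite ltr_pdivlMr//.
    by apply: le_lt_trans; rewrite ler_wpM2l ?cabs_ge0// lerDl.
  by apply/funext => i; rewrite /line /padd /pscale; ring.
exists (e / (l1norm h + 1)); first by rewrite divr_gt0.
by split => x /sub Ox; [exact/hdiff_line/df|exact: fm].
Qed.

End SeveralVariables.

(** * Support functionals of balanced convex open sets *)

Section SupportFunctional.
Variables (R : realType) (d : nat).
Local Notation C := R[i].
Local Notation pt := (pt R d).
Implicit Types (a h x w : pt) (Om : cset R d).

Definition sqnorm h : R := \sum_(i < d) cabs (h i) ^+ 2.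
Definition pconj h : pt := fun i => conjc (h i).

Lemma sqnorm_ge0 h : 0 <= sqnorm h.
Proof. by apply: sumr_ge0 => i _; rewrite sqr_ge0. Qed.

Lemma sqnorm_gt0 h i : h i != 0 -> 0 < sqnorm h.
Proof.
move=> hi; rewrite /sqnorm (bigD1 i)//= ltr_pwDl ?exprn_gt0 ?cabs_gt0//.
by apply: sumr_ge0 => j _; rewrite sqr_ge0.
Qed.

Lemma sqnormE h : rC (sqnorm h) = pairing (pconj h) h.
Proof.
rewrite /sqnorm /rC rmorph_sum; apply: eq_bigr => i _.
by rewrite -[LHS]/(rC (cabs (h i) ^+ 2)) sqr_cabs_conj mulrC.
Qed.

Lemma Re_sum (n : nat) (F : 'I_n -> C) : complex.Re (\sum_i F i) = \sum_i complex.Re (F i).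
Proof. by rewrite (big_morph (@complex.Re R) (@cReD R) (erefl _)). Qed.

Lemma sqnorm_expand (u v : pt) (s : R) :
  sqnorm (padd u (pscale (rC s) v)) =
  sqnorm u + 2 * s * complex.Re (pairing (pconj u) v) + s ^+ 2 * sqnorm v.
Proof.
rewrite /pairing Re_sum !mulr_sumr /sqnorm -!big_split/=; apply: eq_bigr => i _.
rewrite !cabs_sqr /padd /pscale /pconj.
by case: (u i) => a b; case: (v i) => a' b'; rewrite /=; ring.
Qed.

Lemma pairing_scale (k : C) a h : pairing a (pscale k h) = k * pairing a h.
Proof. by rewrite /pairing mulr_sumr; apply: eq_bigr => i _; rewrite mulrCA. Qed.

Lemma pairing_scalel (k : C) a h : pairing (pscale k a) h = k * pairing a h.
Proof. by rewrite /pairing mulr_sumr; apply: eq_bigr => i _; rewrite mulrA. Qed.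

Lemma pairing_sub a (h k : pt) : pairing a (psub h k) = pairing a h - pairing a k.
Proof. by rewrite /pairing -sumrB; apply: eq_bigr => i _; rewrite mulrBr. Qed.

Lemma sqr_cabs_ccont (z : C) : ccont_at (fun x : C => rC (cabs x ^+ 2)) z.
Proof.
move=> e e0; have K0 : 0 < 2 * cabs z + 1 by rewrite ltr_wpDl// mulr_ge0// cabs_ge0.
exists (Num.min 1 (e / (2 * cabs z + 1))); first by rewrite lt_min ltr01 divr_gt0.
move=> w; rewrite lt_min ltr_pdivlMr// => /andP[w1 w2].
rewrite -rCB cabs_rC subr_sqr normrM [`|cabs w + cabs z|]ger0_norm ?addr_ge0 ?cabs_ge0//.
apply: le_trans (ltW w2); apply: ler_pM; rewrite ?addr_ge0 ?cabs_ge0//.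
  rewrite ler_norml; have := cabs_ger w z; have := cabs_ger z w; rewrite (cabsC z w).
  by clear; move=> *; lra.
by have := cabs_ger w z; move: w1; clear; move=> *; lra.
Qed.

Lemma phase_ex (z : C) : exists2 u : C, cabs u = 1 & u * z = rC (cabs z).
Proof.
have [->|z0] := eqVneq z 0; first by exists 1; rewrite ?cabs1// mulr0 cabs0.
have c0 : 0 < cabs z by rewrite cabs_gt0.
exists (rC (cabs z)^-1 * conjc z).
  by rewrite cabsM cabs_rC cabs_conj gtr0_norm ?invr_gt0// mulVf// gt_eqF.
by rewrite -mulrA [conjc z * z]mulrC -sqr_cabs_conj -rCM expr2 mulKf// gt_eqF.
Qed.

Section Separation.
Variables (Om : cset R d).
Hypotheses (oOm : is_open Om) (neOm : exists z, Om z) (bOm : bounded_set Om)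
  (cOm : convex_set Om) (balOm : balanced Om).

Lemma balanced_scale (k : C) z : cabs k <= 1 -> Om z -> Om (pscale k z).
Proof. by move=> k1; apply: balOm; rewrite normcE_cabs -rC1 rC_le. Qed.

Lemma balanced0 : Om (fun=> 0).
Proof.
have [z Oz] := neOm; have : Om (pscale 0 z) by apply: balanced_scale; rewrite ?cabs0.
by rewrite (_ : pscale 0 z = fun=> 0)//; apply/funext => i; rewrite /pscale mul0r.
Qed.

Lemma ball0_ex : exists2 e : R, 0 < e & forall h, l1norm h < e -> Om h.
Proof.
have [e e0 He] := is_open_l1 oOm balanced0; exists e => // h /He.
by rewrite (_ : padd _ h = h)//; apply/funext => i; rewrite /padd add0r.
Qed.

Lemma convex_comb x y (t : R) : Om x -> Om y -> 0 <= t <= 1 ->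
  Om (padd (pscale (rC t) x) (pscale (rC (1 - t)) y)).
Proof. by move=> Ox Oy /andP[t0 t1]; exact: cOm. Qed.

Lemma bounded_cabs : exists M : R, forall z, Om z -> forall i, cabs (z i) <= M.
Proof.
have [M HM] := bOm; exists M => z Oz i.
by have := HM z Oz i; rewrite normcE_cabs rC_le.
Qed.

(* [t w] has positive distance to [Om], and the functional is given by a nearest
   point [q] of the closure. *)
Lemma separation_approx w (t : R) : 1 < t -> ~ Om w ->
  exists2 a, (forall x, Om x -> cabs (pairing a x) <= 1) & 1 / t <= cabs (pairing a w).
Proof.
move=> t1 nOw; have [e e0 He] := ball0_ex; have [M HM] := bounded_cabs.
have t0 : 0 < t by rewrite (lt_trans ltr01).
pose w' := pscale (rC t) w.
(* If t w = x + (t - 1) y with y in the ball around 0, then w = (1/t) x + (1 - 1/t) y would be a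
   convex combination of points of Om. *)
have far x : Om x -> (t - 1) * e <= l1norm (psub w' x).
  move=> Ox; rewrite leNgt; apply/negP => wx; apply: nOw.
  have t10 : 0 < t - 1 by rewrite subr_gt0.
  pose y := pscale (rC (t - 1)^-1) (psub w' x).
  have Oy : Om y.
    apply: He; rewrite l1norm_scale cabs_rC gtr0_norm ?invr_gt0//.
    by rewrite mulrC ltr_pdivrMr// mulrC.
  have tt : 0 <= t^-1 <= 1 by rewrite invr_ge0 ltW//= invf_le1// ltW.
  have := convex_comb Ox Oy tt.
  rewrite (_ : padd _ _ = w)//; apply/funext => i.
  rewrite /padd /y /w' /psub /pscale.
  have -> : rC (1 - t^-1) = rC t^-1 * rC (t - 1).
    by rewrite -rCM mulrBr mulr1 mulVf ?gt_eqF.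
  rewrite [rC t^-1 * rC (t - 1) * _]mulrA -[_ * rC (t - 1) * rC (t - 1)^-1]mulrA -rCM.
  rewrite divff ?gt_eqF// rC1 mulr1 mulrBr addrC subrK mulrA -rCM mulVf ?gt_eqF// rC1.
  by rewrite mul1r.
pose S := [set sqnorm (psub x w') | x in [set x | Om x]]%classic.
have infS : has_inf S.
  split; first by exists (sqnorm (psub (fun=> 0) w')), (fun=> 0) => //; exact: balanced0.
  by exists 0 => _ [x _ <-]; exact: sqnorm_ge0.
pose D := inf S.
have HD x : Om x -> D <= sqnorm (psub x w').
  by move=> Ox; apply: ge_inf; [exact: infS.2|exists x].
have /choice[xn Hxn] (n : nat) : exists x, Om x /\ sqnorm (psub x w') < D + n.+1%:R^-1.
  have n0 : 0 < n.+1%:R^-1 :> R by rewrite invr_gt0.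
  by have [_ [x Ox <-] h] := inf_adherent n0 infS; exists x.
have /choice[q Hq] i : exists l, utends (fun n => xn n i) l.
  by apply: (@utends_ex _ _ M) => n; apply: HM; case: (Hxn n).
have lim_sq (u : nat -> pt) (v : pt) : (forall i, utends (fun n => u n i) (v i)) ->
    utends (fun n => rC (sqnorm (u n))) (rC (sqnorm v)).
  move=> uv.
  have := utends_sum (fun i => utends_cont (@sqr_cabs_ccont (v i)) (uv i)).
  rewrite (_ : \sum_i _ = rC (sqnorm v)); last by rewrite /rC rmorph_sum.
  by apply: utends_ext; apply: umost_all => n; rewrite /rC rmorph_sum.
have cabs_sq h : cabs (rC (sqnorm h)) = sqnorm h.
  by rewrite cabs_rC ger0_norm// sqnorm_ge0.
pose p := psub q w'.
have Hp : sqnorm p <= D.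
  apply/ler_addgt0Pr => eps eps0; rewrite -cabs_sq.
  have T := lim_sq (fun n => psub (xn n) w') p
    (fun i => utendsB (Hq i) (utends_cst (w' i))).
  apply: (utends_le T); apply: umostW (umost_small eps0) => n hn.
  rewrite cabs_sq; have [_ h] := Hxn n; rewrite (le_trans (ltW h))// lerD2l ltW//.
have var x (s : R) : Om x -> 0 <= s <= 1 -> D <= sqnorm (padd p (pscale (rC s) (psub x q))).
  move=> Ox s01; rewrite -cabs_sq.
  pose y n := padd (pscale (rC s) x) (pscale (rC (1 - s)) (xn n)).
  have T : utends (fun n => rC (sqnorm (psub (y n) w')))
      (rC (sqnorm (padd p (pscale (rC s) (psub x q))))).
    apply: lim_sq => i.
    have -> : padd p (pscale (rC s) (psub x q)) i =
        rC s * x i + rC (1 - s) * q i - w' i.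
      by rewrite /padd /p /pscale /psub rCB rC1; ring.
    apply: utendsB (utends_cst _); apply: utendsD (utends_cst _) _.
    exact: utendsZ.
  apply: (utends_ge T); apply: umost_all => n; rewrite cabs_sq; apply: HD.
  by apply: convex_comb => //; case: (Hxn n).
have Re0 x : Om x -> 0 <= complex.Re (pairing (pconj p) (psub x q)).
  move=> Ox; rewrite leNgt; apply/negP => neg.
  set k := complex.Re _ in neg; pose W := sqnorm (psub x q).
  have W0 : 0 <= W by exact: sqnorm_ge0.
  (* With this s the variation 2 s k + s^2 W is at most s (k - s) < 0, against the minimality of
     D. *)
  pose s := Num.min 1 (- k / (W + 1)).
  have W1 : 0 < W + 1 by rewrite ltr_wpDl.
  have s0 : 0 < s by rewrite lt_min ltr01 divr_gt0// oppr_gt0.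
  have s1 : s <= 1 by rewrite ge_min lexx.
  have sk : s * (W + 1) <= - k by rewrite -ler_pdivlMr// ge_min lexx orbT.
  have := var x s Ox; rewrite (ltW s0) s1 => /(_ isT).
  rewrite sqnorm_expand -/k -/W => h.
  have : 0 <= s * (2 * k + s * W) by move: h Hp; clear -oOm neOm bOm cOm balOm; move=> *; lra.
  rewrite pmulr_rge0// => h2.
  by move: sk neg s0 h2; rewrite mulrDr; clear -oOm neOm bOm cOm balOm; move=> *; lra.
pose b := pscale (-1) (pconj p).
have pb x : Om x -> complex.Re (pairing b x) <= complex.Re (pairing b q).
  move=> /Re0; rewrite /b !pairing_scalel pairing_sub cReB !mulN1r.
  case: (pairing (pconj p) x) => ? ?; case: (pairing (pconj p) q) => ? ? /=.
  by clear -oOm neOm bOm cOm balOm; move=> *; lra.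
set c := complex.Re (pairing b q) in pb.
(* Balancedness allows x to be rotated, which turns the bound on real parts into one on moduli. *)
have bx x : Om x -> cabs (pairing b x) <= c.
  move=> Ox; have [u u1 ux] := phase_ex (pairing b x).
  have Oux : Om (pscale u x) by apply: balanced_scale; rewrite ?u1.
  by have := pb _ Oux; rewrite pairing_scale ux.
have sp0 : 0 < sqnorm p.
  have [i pi0] : exists i, p i != 0.
    apply: contrapT => np.
    have p0 i : p i = 0 by apply: contrapT => /eqP pi; apply: np; exists i.
    have eps0 : 0 < (t - 1) * e / (d%:R + 1).
      by rewrite divr_gt0 ?mulr_gt0 ?subr_gt0// ltr_wpDl.
    have [n Hn] := umost_ex (umost_forall_ord (fun i => Hq i _ eps0)).
    have [On _] := Hxn n; have := far _ On; apply/negP; rewrite -ltNge.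
    apply: l1norm_lt => [|i]; first by rewrite mulr_gt0 ?subr_gt0.
    by have := p0 i; rewrite /p /psub cabsC => /eqP; rewrite subr_eq0 => /eqP <-.
  exact: sqnorm_gt0 pi0.
have bp : pairing b (psub w' q) = rC (sqnorm p).
  rewrite sqnormE /b pairing_scalel (_ : psub w' q = pscale (-1) p).
    by rewrite pairing_scale mulrA mulrNN !mul1r.
  by apply/funext => i; rewrite /psub /pscale /p /psub; ring.
have c0 : 0 < c.
  pose s := e / 2 / (l1norm p + 1).
  have l0 : 0 < l1norm p + 1 by rewrite ltr_wpDl// l1norm_ge0.
  have s0 : 0 < s by rewrite !divr_gt0.
  have Ox : Om (pscale (rC (- s)) p).
    apply: He; rewrite l1norm_scale cabs_rC normrN gtr0_norm//.
    rewrite /s mulrAC ltr_pdivrMr//.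
    apply: (@le_lt_trans _ _ (e / 2 * (l1norm p + 1))).
      by rewrite ler_wpM2l ?lerDl ?divr_ge0// ltW.
    by rewrite ltr_pM2r// ltr_pdivrMr// ltr_pMr// ltr1n.
  apply: lt_le_trans (pb _ Ox).
  rewrite pairing_scale /b pairing_scalel -sqnormE mulrA.
  have -> : (-1 : C) = rC (-1) by rewrite rCN rC1.
  rewrite -!rCM /=.
  by rewrite mulrN1 opprK mulr_gt0.
exists (pscale (rC c^-1) b).
  move=> x /bx bxc; rewrite pairing_scalel cabsM cabs_rC gtr0_norm ?invr_gt0//.
  by rewrite mulrC ler_pdivrMr// mul1r.
rewrite pairing_scalel cabsM cabs_rC gtr0_norm ?invr_gt0//.
rewrite ler_pdivrMr// mulrC mulrCA [X in _ <= _ * X](_ : _ = cabs (pairing b w')).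
  rewrite mulrC ler_pdivlMr// mul1r (le_trans _ (Re_le_cabs _))// (le_trans _ (ler_norm _))//.
  have -> : pairing b w' = pairing b q + rC (sqnorm p).
    by rewrite -bp pairing_sub addrC subrK.
  by rewrite cReD -/c lerDl/= ltW.
by rewrite /w' pairing_scale cabsM cabs_rC gtr0_norm.
Qed.

(** The approximate functionals for t = 1 + 1/(n+1) have bounded coefficients because Om contains a
    ball around 0; their limit has modulus at least 1 at w, also when w is a boundary point. *)
Lemma support_functional w : ~ Om w ->
  exists2 a, (forall x, Om x -> cabs (pairing a x) <= 1) & 1 <= cabs (pairing a w).
Proof.
move=> nOw; have [e e0 He] := ball0_ex.
have /choice[an Han] (n : nat) : exists a, (forall x, Om x -> cabs (pairing a x) <= 1) /\
    1 / (1 + n.+1%:R^-1) <= cabs (pairing a w).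
  have [|a a1 a2] := @separation_approx w (1 + n.+1%:R^-1) _ nOw; last by exists a.
  by rewrite ltrDl invr_gt0.
have bd n i : cabs (an n i) <= 2 / e.
  pose x : pt := fun j => if j == i then rC (e / 2) else 0.
  have e2 : 0 < e / 2 by rewrite divr_gt0.
  have Ox : Om x.
    apply: He; rewrite /l1norm (bigD1 i)//= {1}/x eqxx big1 ?addr0; last first.
      by move=> j /negPf ji; rewrite /x ji cabs0.
    by rewrite cabs_rC gtr0_norm// ltr_pdivrMr// ltr_pMr// ltr1n.
  have := (Han n).1 x Ox; rewrite /pairing (bigD1 i)//= {1}/x eqxx big1 ?addr0; last first.
    by move=> j /negPf ji; rewrite /x ji mulr0.
  by rewrite cabsM cabs_rC gtr0_norm// -ler_pdivlMr// mul1r invf_div.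
have /choice[a Ha] i : exists l, utends (fun n => an n i) l.
  by apply: utends_ex => n; exact: bd.
have T x : utends (fun n => pairing (an n) x) (pairing a x).
  apply: utends_sum => i; have := utendsZ (x i) (Ha i); rewrite mulrC.
  by apply: utends_ext; apply: umost_all => n; rewrite mulrC.
exists a.
  by move=> x Ox; apply: (utends_le (T x)); apply: umost_all => n; case: (Han n) => ->.
apply/ler_addgt0Pr => eps eps0; rewrite -lerBlDr.
apply: (utends_ge (T w)); apply: umostW (umost_small eps0) => n hn.
have [_ h] := Han n; apply: le_trans h.
have n0 : 0 < n.+1%:R^-1 :> R by rewrite invr_gt0.
set s := n.+1%:R^-1 in hn n0 *.
rewrite ler_pdivlMr ?addr_gt0// mulrDr mulr1 mulrBl mul1r.
have := mulr_gt0 eps0 n0.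
by move: hn n0; clear -oOm neOm bOm cOm balOm; move=> *; lra.
Qed.

(** Openness puts (1 + s) z in Om for some s > 0, which leaves room below 1. *)
Lemma support_lt1 a z : (forall x, Om x -> cabs (pairing a x) <= 1) -> Om z ->
  cabs (pairing a z) < 1.
Proof.
move=> a1 Oz; have [e e0 He] := is_open_l1 oOm Oz.
have l0 : 0 < l1norm z + 1 by rewrite ltr_wpDl// l1norm_ge0.
pose s := e / 2 / (l1norm z + 1).
have s0 : 0 < s by rewrite !divr_gt0.
have : Om (padd z (pscale (rC s) z)).
  apply: He; rewrite l1norm_scale cabs_rC gtr0_norm// /s mulrAC ltr_pdivrMr//.
  apply: (@le_lt_trans _ _ (e / 2 * (l1norm z + 1))).
    by rewrite ler_wpM2l ?lerDl ?divr_ge0// ltW.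
  by rewrite ltr_pM2r// ltr_pdivrMr// ltr_pMr// ltr1n.
rewrite (_ : padd _ _ = pscale (rC (1 + s)) z); last first.
  by apply/funext => i; rewrite /padd /pscale rCD rC1 mulrDl mul1r.
move=> /a1; rewrite pairing_scale cabsM cabs_rC gtr0_norm ?addr_gt0// => h.
have [h0|h0] := eqVneq (cabs (pairing a z)) 0; first by rewrite h0.
apply: lt_le_trans h; rewrite ltr_pMl ?ltrDl//.
by rewrite lt_def h0 cabs_ge0.
Qed.

End Separation.
End SupportFunctional.

(** * Polynomials as functions *)

Section PolynomialFunctions.
Variables (R : realType) (d : nat).
Local Notation C := R[i].
Local Notation pt := (pt R d).

(** Statements about polynomials become inductions on sums and products of functions;
    [polyfun_meval] gives the link to the polynomials of [rel_poly_convex]. *)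
Inductive polyfun : (pt -> C) -> Prop :=
| polyfun_cst k : polyfun (fun=> k)
| polyfun_proj i : polyfun (fun z => z i)
| polyfunD f g : polyfun f -> polyfun g -> polyfun (fun z => f z + g z)
| polyfunM f g : polyfun f -> polyfun g -> polyfun (fun z => f z * g z).

Lemma polyfun_meval (p : mpoly.mpoly d C) : polyfun (fun z => mpoly.meval z p).
Proof.
have poly_big (I : Type) (s : seq I) (op : C -> C -> C) (k : C) (F : I -> pt -> C) :
    (forall f g, polyfun f -> polyfun g -> polyfun (fun z => op (f z) (g z))) ->
    (forall i, polyfun (F i)) -> polyfun (fun z => \big[op/k]_(i <- s) F i z).
  move=> Pop PF; elim: s => [|i s IH].
    rewrite (_ : (fun z => _) = fun=> k); first exact: polyfun_cst.
    by apply/funext => z; rewrite big_nil.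
  rewrite (_ : (fun z => _) = fun z => op (F i z) (\big[op/k]_(j <- s) F j z)).
    exact: Pop.
  by apply/funext => z; rewrite big_cons.
rewrite (_ : (fun z => _) = fun z => \sum_(m <- mpoly.msupp p)
  mpoly.mcoeff m p * \prod_(i < d) z i ^+ (mpoly.fun_of_multinom m i)); last first.
  by apply/funext => z; rewrite mpoly.mevalE.
apply: (poly_big) => [f g|m]; first exact: polyfunD.
apply: polyfunM; first exact: polyfun_cst.
apply: (poly_big) => [f g|i]; first exact: polyfunM.
elim: (mpoly.fun_of_multinom m i) => [|n IH]; first exact: polyfun_cst.
rewrite (_ : (fun z => _) = fun z => z i * z i ^+ n); last first.
  by apply/funext => z; rewrite exprS.
by apply: polyfunM => //; exact: polyfun_proj.
Qed.

Lemma polyfun_hdiff P a : polyfun P -> hdiff P a.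
Proof.
elim=> [k|i|f g _ h1 _ h2|f g _ h1 _ h2].
- exact: hdiff_cst.
- exact: hdiff_proj.
- exact: hdiffD.
- exact: hdiffM.
Qed.

Lemma polyfun_bounded (S : cset R d) P : polyfun P ->
  (exists M : R, forall z, S z -> forall i, cabs (z i) <= M) ->
  exists M : R, forall z, S z -> cabs (P z) <= M.
Proof.
move=> pP [M HM]; elim: pP => [k|i|f g _ [Mf Hf] _ [Mg Hg]|f g _ [Mf Hf] _ [Mg Hg]].
- by exists (cabs k).
- by exists M => z Sz; exact: HM.
- by exists (Mf + Mg) => z Sz; rewrite (le_trans (cabsD _ _))// lerD ?Hf ?Hg.
- by exists (Mf * Mg) => z Sz; rewrite cabsM ler_pM ?cabs_ge0 ?Hf ?Hg.
Qed.

Lemma hdiff_utends f (zn : nat -> pt) z : hdiff f z ->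
  (forall i, utends (fun n => zn n i) (z i)) -> utends (fun n => f (zn n)) (f z).
Proof.
move=> df znz e e0; have e2 : 0 < e / 2 by rewrite divr_gt0.
have [del d0 H] := hdiff_cont df e2.
have dd : 0 < del / (d%:R + 1) by rewrite divr_gt0// ltr_wpDl.
apply: umostW (umost_forall_ord (fun i => znz i _ dd)) => n Hn.
have /H : l1norm (psub (zn n) z) < del by exact: l1norm_lt.
rewrite padd_sub => /le_lt_trans; apply.
by rewrite ltr_pdivrMr// ltr_pMr// ltr1n.
Qed.

End PolynomialFunctions.

(** * The algebra of bounded holomorphic functions on V *)

Section BoundedHolomorphic.
Variables (R : realType) (d : nat).
Local Notation C := R[i].
Local Notation pt := (pt R d).
Variables (Om V : cset R d).
Hypotheses (oOm : is_open Om) (VOm : forall z, V z -> Om z).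
Implicit Types (f g : pt -> C).

Lemma bounded_onP (S : cset R d) f : bounded_on S f <->
  exists M : R, forall z, S z -> cabs (f z) <= M.
Proof.
by split=> [[M H]|[M H]]; exists M => z /H; rewrite normcE_cabs rC_le.
Qed.

Lemma is_openI (U W : cset R d) : is_open U -> is_open W -> is_open (fun z => U z /\ W z).
Proof.
move=> oU oW z [/oU[e [e0 He]] /oW[e' [e'0 He']]].
exists (Num.min e e'); split; first by rewrite lt_min e0.
move=> w /cballE H; split; [apply: He|apply: He']; apply/cballE => i.
  by have := H i; rewrite lt_min => /andP[].
by have := H i; rewrite lt_min => /andP[].
Qed.

Lemma Hinf_restrict f : (forall a, Om a -> hdiff f a) ->
  (exists M : R, forall z, Om z -> cabs (f z) <= M) -> Hinf_var V f.
Proof.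
move=> df [M HM]; split; last by apply/bounded_onP; exists M => z /VOm; exact: HM.
move=> p Vp; exists Om, f; split; first exact: VOm.
by split => //; apply/holomorphicP; split.
Qed.

Lemma Hinf_cst k : Hinf_var V (fun=> k).
Proof. by apply: Hinf_restrict => [a _|]; [exact: hdiff_cst|exists (cabs k)]. Qed.

Lemma Hinf_binop (op : C -> C -> C) (bd : R -> R -> R) f g :
  (forall F G (a : pt), hdiff F a -> hdiff G a -> hdiff (fun z => op (F z) (G z)) a) ->
  (forall x y (M N : R), cabs x <= M -> cabs y <= N -> cabs (op x y) <= bd M N) ->
  Hinf_var V f -> Hinf_var V g -> Hinf_var V (fun z => op (f z) (g z)).
Proof.
move=> hop bop [hf /bounded_onP[M HM]] [hg /bounded_onP[N HN]]; split; last first.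
  by apply/bounded_onP; exists (bd M N) => z Vz; apply: bop; [exact: HM|exact: HN].
move=> p Vp; have [U [F [Up [/holomorphicP[oU dF] FU]]]] := hf p Vp.
have [W [G [Wp [/holomorphicP[oW dG] GW]]]] := hg p Vp.
exists (fun z => U z /\ W z), (fun z => op (F z) (G z)); split=> //; split.
  apply/holomorphicP; split; first exact: is_openI.
  by move=> a [Ua Wa]; apply: hop; [exact: dF|exact: dG].
by move=> w [Uw Ww] Vw; rewrite FU// GW.
Qed.

Lemma HinfD f g : Hinf_var V f -> Hinf_var V g -> Hinf_var V (fun z => f z + g z).
Proof.
apply: (@Hinf_binop _ (fun M N => M + N)) => [F G a|x y M N xM yN]; first exact: hdiffD.
by rewrite (le_trans (cabsD _ _))// lerD.
Qed.

Lemma HinfM f g : Hinf_var V f -> Hinf_var V g -> Hinf_var V (fun z => f z * g z).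
Proof.
apply: (@Hinf_binop _ (fun M N => M * N)) => [F G a|x y M N xM yN]; first exact: hdiffM.
by rewrite cabsM ler_pM ?cabs_ge0.
Qed.

Lemma HinfZ k f : Hinf_var V f -> Hinf_var V (fun z => k * f z).
Proof. exact: HinfM (Hinf_cst k). Qed.

Lemma HinfX n f : Hinf_var V f -> Hinf_var V (fun z => f z ^+ n).
Proof.
move=> Hf; elim: n => [|n IH]; first exact: (Hinf_cst 1).
rewrite (_ : (fun z => _) = fun z => f z * f z ^+ n); first exact: HinfM.
by apply/funext => z; rewrite exprS.
Qed.

(** The local extension is 1/f on the open set where f is nonzero, which contains V by the lower
    bound; f may well vanish elsewhere in Om. *)
Lemma HinfV f (del : R) : 0 < del -> (forall a, Om a -> hdiff f a) ->
  (forall z, V z -> del <= cabs (f z)) -> Hinf_var V (fun z => (f z)^-1).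
Proof.
move=> d0 df fd; split; last first.
  apply/bounded_onP; exists del^-1 => z Vz; rewrite cabsV lef_pV2 ?posrE ?fd//.
  exact: lt_le_trans d0 (fd _ Vz).
move=> p Vp; exists (fun z => Om z /\ f z != 0), (fun z => (f z)^-1); split.
  by split; [exact: VOm|rewrite -cabs_gt0 (lt_le_trans d0)// fd].
split=> //; apply/holomorphicP; split; last first.
  by move=> a [Oa fa]; apply: hdiffV => //; exact: df.
move=> z [Oz fz]; have [e [e0 He]] := oOm Oz.
have fz0 : 0 < cabs (f z) / 2 by rewrite divr_gt0// cabs_gt0.
have [e' e'0 He'] := hdiff_cont (df z Oz) fz0.
have dd : 0 < e' / (d%:R + 1) by rewrite divr_gt0// ltr_wpDl.
exists (Num.min e (e' / (d%:R + 1))); split; first by rewrite lt_min e0.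
move=> w /cballE H; split.
  by apply: He; apply/cballE => i; have := H i; rewrite lt_min => /andP[].
rewrite -cabs_gt0.
have : cabs (f w - f z) <= cabs (f z) / 2.
  rewrite -{1}(padd_sub z w); apply: He'.
  by apply: l1norm_lt => // i; have := H i; rewrite lt_min => /andP[].
have := cabs_ger (f z) (f w); rewrite (cabsC (f w)) => h1 h2.
by move: fz0 h1 h2; lra.
Qed.

End BoundedHolomorphic.

(** * Extension operators *)

Section ExtensionOperator.
Variables (R : realType) (d : nat).
Local Notation C := R[i].
Local Notation pt := (pt R d).
Variables (Om V : cset R d) (E : (pt -> C) -> (pt -> C)).
Hypotheses (oOm : is_open Om) (neOm : exists z, Om z) (bOm : bounded_set Om)
  (cOm : convex_set Om) (balOm : balanced Om) (VOm : forall z, V z -> Om z)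
  (Eop : isometric_extension_operator Om V E).
Implicit Types (f g : pt -> C).

Lemma ext_eq f g z : Hinf_var V f -> Hinf_var V g -> (forall v, V v -> f v = g v) ->
  Om z -> E f z = E g z.
Proof. by case: Eop => H _ Hf Hg fg; exact: H. Qed.

Lemma ext_holo f : Hinf_var V f -> forall a, Om a -> hdiff (E f) a.
Proof. by case: Eop => _ [H _] /H[h _] a; exact: holo_hdiff h. Qed.

Lemma ext_lin k f g z : Hinf_var V f -> Hinf_var V g -> Om z ->
  E (fun w => k * f w + g w) z = k * E f z + E g z.
Proof. by case: Eop => _ [_ [H _]] Hf Hg; exact: H. Qed.

Lemma ext_on_V f v : Hinf_var V f -> V v -> E f v = f v.
Proof. by case: Eop => _ [_ [_ [H _]]] Hf; exact: H. Qed.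

Lemma ext_le f (M : R) z : Hinf_var V f -> (forall v, V v -> cabs (f v) <= M) ->
  Om z -> cabs (E f z) <= M.
Proof.
case: Eop => _ [_ [_ [_ H]]] Hf fM Oz; rewrite -rC_le -normcE_cabs.
by apply: (H f Hf M).2 => // v Vv; rewrite normcE_cabs rC_le fM.
Qed.

(** On an empty set even -1 bounds the modulus of the function 0, and isometry would transfer this
    bound to the nonempty Om. *)
Lemma V_nonempty : exists v, V v.
Proof.
apply: contrapT => nV; have [z Oz] := neOm.
have Vf v : V v -> False by move=> Vv; apply: nV; exists v.
have := @ext_le (fun=> 0) (-1) z (Hinf_cst oOm VOm 0) _ Oz.
move=> /(_ (fun v Vv => False_ind _ (Vf v Vv))); apply/negP; rewrite -ltNge.
by rewrite (lt_le_trans _ (cabs_ge0 _))// oppr_lt0.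
Qed.

Lemma ext0 z : Om z -> E (fun=> 0) z = 0.
Proof.
move=> Oz; apply/eqP; rewrite -cabs_eq0 eq_le cabs_ge0 andbT.
by apply: ext_le => // [|v _]; [exact: (Hinf_cst oOm VOm)|rewrite cabs0].
Qed.

(** The extension of k has modulus at most |k| and attains it on V, so the maximum principle makes
    it constant. *)
Lemma ext_cst k z : Om z -> E (fun=> k) z = k.
Proof.
move=> Oz; have [v Vv] := V_nonempty; have Hk := Hinf_cst oOm VOm k.
rewrite -[RHS](@ext_on_V (fun=> k) v)//.
apply: (max_principle_convex oOm cOm _ _ (VOm Vv) (m := cabs k)) => //.
- exact: ext_holo.
- by move=> a Oa; exact: ext_le.
- by rewrite ext_on_V.
Qed.

Lemma extD f g z : Hinf_var V f -> Hinf_var V g -> Om z ->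
  E (fun w => f w + g w) z = E f z + E g z.
Proof.
move=> Hf Hg Oz; rewrite -[E f z]mul1r -ext_lin//.
apply: ext_eq => //; first exact: HinfD.
  by apply: HinfD => //; apply: (HinfZ oOm VOm).
by move=> v _; rewrite mul1r.
Qed.

Lemma extZ k f z : Hinf_var V f -> Om z -> E (fun w => k * f w) z = k * E f z.
Proof.
move=> Hf Oz; have H0 := Hinf_cst oOm VOm (0 : C).
rewrite -[RHS]addr0 -(ext0 Oz) -ext_lin//.
apply: ext_eq => //; first exact: (HinfZ oOm VOm).
  by apply: HinfD => //; apply: (HinfZ oOm VOm).
by move=> v _; rewrite addr0.
Qed.

Lemma ext_sum n (F : 'I_n -> pt -> C) z : (forall i, Hinf_var V (F i)) -> Om z ->
  E (fun w => \sum_i F i w) z = \sum_i E (F i) z.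
Proof.
move=> HF Oz.
suff H (s : seq 'I_n) : Hinf_var V (fun w => \sum_(i <- s) F i w) /\
    E (fun w => \sum_(i <- s) F i w) z = \sum_(i <- s) E (F i) z by exact: (H _).2.
elim: s => [|i s [IH1 IH2]].
  have -> : (fun w => \sum_(i <- [::]) F i w) = fun=> 0.
    by apply/funext => w; rewrite big_nil.
  by rewrite big_nil; split; [exact: (Hinf_cst oOm VOm)|exact: ext0].
have -> : (fun w => \sum_(j <- i :: s) F j w) = fun w => F i w + \sum_(j <- s) F j w.
  by apply/funext => w; rewrite big_cons.
by split; [exact: HinfD|rewrite extD// big_cons IH2].
Qed.

Lemma Hinf_proj i : Hinf_var V (fun z => z i).
Proof.
apply: (Hinf_restrict oOm VOm) => [a _|]; first exact: hdiff_proj.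
by have [M HM] := bounded_cabs bOm; exists M => z Oz; exact: HM.
Qed.

Definition ext_map (z : pt) : pt := fun i => E (fun w => w i) z.

Lemma Hinf_pairing a : Hinf_var V (pairing a).
Proof.
apply: (Hinf_restrict oOm VOm) => [b _|].
  by apply: hdiff_sum => i; apply: hdiffZ; exact: hdiff_proj.
have [M HM] := bounded_cabs bOm; exists (M * l1norm a) => z Oz.
have -> : pairing a z = pairing z a by apply: eq_bigr => i _; rewrite mulrC.
by apply: pairing_le; exact: HM.
Qed.

Lemma ext_pairing a z : Om z -> E (pairing a) z = pairing a (ext_map z).
Proof.
move=> Oz; rewrite /pairing ext_sum//; last first.
  by move=> i; apply: (HinfZ oOm VOm); exact: Hinf_proj.
by apply: eq_bigr => i _; rewrite extZ//; exact: Hinf_proj.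
Qed.

Lemma ext_map_hdiff i a : Om a -> hdiff (fun z => ext_map z i) a.
Proof. exact: (ext_holo (Hinf_proj i)). Qed.

Lemma ext_map_on_V v : V v -> ext_map v = v.
Proof. by move=> Vv; apply/funext => i; rewrite /ext_map ext_on_V//; exact: Hinf_proj. Qed.

(** If [ext_map z] left Om, the extension of a functional supporting Om there would attain its bound
    1 at z and be constant. On V it agrees with the functional, whose modulus is below 1 at points
    of Om. *)
Lemma ext_map_in z : Om z -> Om (ext_map z).
Proof.
move=> Oz; apply: contrapT => nO.
have [a a1 az] := support_functional oOm neOm bOm cOm balOm nO.
have Hp := Hinf_pairing a.
have le1 y : Om y -> cabs (E (pairing a) y) <= 1.
  by move=> Oy; apply: ext_le => // v /VOm; exact: a1.
have eq1 : cabs (E (pairing a) z) = 1.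
  by apply/eqP; rewrite eq_le le1// ext_pairing.
have [v Vv] := V_nonempty; have Ov := VOm Vv.
have e : E (pairing a) v = E (pairing a) z.
  exact: (max_principle_convex oOm cOm (ext_holo Hp) le1 Oz eq1 Ov).
have := support_lt1 oOm a1 Ov; rewrite -(ext_on_V Hp Vv) e eq1.
by rewrite ltxx.
Qed.

Definition poly_hull_in (z : pt) := forall (P : pt -> C) (c : R), polyfun P ->
  (forall v, V v -> cabs (P v) <= c) -> cabs (P z) <= c.

Lemma rel_poly_convex_hull z : rel_poly_convex Om V -> Om z -> poly_hull_in z -> V z.
Proof.
move=> rpc Oz hz; apply: contrapT => nV.
have [p [c [pc pV]]] := rpc z Oz nV.
have := hz _ c (polyfun_meval p); move: pc; rewrite normcE_cabs rC_lt ltNge => /negP pc H.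
apply: pc; apply: H => v /pV; rewrite normcE_cabs rC_le//.
Qed.

Lemma retract_of_map (s : pt -> pt) : (forall i a, Om a -> hdiff (fun z => s z i) a) ->
  (forall z, Om z -> V (s z)) -> (forall v, V v -> s v = v) -> retract Om V.
Proof.
move=> ds sV sid; exists s; split; first by move=> k; apply/holomorphicP; split => // a; exact: ds.
split; first by move=> z /sV/VOm.
split; first exact: sV.
by split => // v Vv; exists v; split; [exact: VOm|exact: sid].
Qed.

Lemma retract_of_multiplicative : rel_poly_convex Om V -> multiplicative_op Om V E ->
  retract Om V.
Proof.
move=> rpc mult; apply: (@retract_of_map ext_map).
- by move=> i a; exact: ext_map_hdiff.
- move=> z Oz; apply: rel_poly_convex_hull => //; first exact: ext_map_in.
  move=> P c pP Pc.
  have [HP EP] : Hinf_var V P /\ E P z = P (ext_map z).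
    elim: pP {Pc} => [k|i|f g _ [Hf Ef] _ [Hg Eg]|f g _ [Hf Ef] _ [Hg Eg]].
    - by split; [exact: (Hinf_cst oOm VOm)|exact: ext_cst].
    - by split; [exact: Hinf_proj|].
    - by split; [exact: HinfD|rewrite extD// Ef Eg].
    - by split; [exact: HinfM|rewrite mult// Ef Eg].
  by rewrite -EP; exact: ext_le.
- exact: ext_map_on_V.
Qed.

End ExtensionOperator.

(** * Self-maps of the unit disc *)

Section DiscSelfMaps.
Variable R : realType.
Local Notation C := R[i].
Implicit Types (a b z w : C) (g : C -> C).

Lemma Bernoulli (x : R) n : -1 <= x -> 1 + n%:R * x <= (1 + x) ^+ n.
Proof.
move=> x1; elim: n => [|n IH]; first by rewrite mul0r addr0 expr0.
have x0 : 0 <= 1 + x by rewrite -lerBlDl sub0r.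
rewrite exprS (le_trans _ (ler_wpM2l x0 IH))// -natr1.
rewrite -subr_ge0 (_ : _ - _ = n%:R * x ^+ 2); last by ring.
by rewrite mulr_ge0// sqr_ge0.
Qed.

Lemma real_unbounded (x y : R) : 0 < x -> exists n : nat, y < n%:R * x.
Proof.
move=> x0; exists (Num.truncn (y / x)).+1.
by rewrite -ltr_pdivrMr// truncnS_gt.
Qed.

(** Otherwise (x / y)^n would stay below 1 / x^2, whereas Bernoulli's inequality makes it
    unbounded. *)
Lemma le_of_powers (x y : R) : 0 <= x -> 0 < y -> (forall n, x ^+ n.+2 <= y ^+ n) -> x <= y.
Proof.
move=> x0 y0 H; rewrite leNgt; apply/negP => yx.
have xp : 0 < x by rewrite (lt_trans y0).
pose rho := x / y - 1.
have rho0 : 0 < rho by rewrite subr_gt0 ltr_pdivlMr// mul1r.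
have x20 : 0 < x ^+ 2 by rewrite exprn_gt0.
have [n Hn] := real_unbounded ((x ^+ 2)^-1) rho0.
have h1 : x ^+ 2 * (1 + rho) ^+ n <= 1.
  rewrite /rho [1 + _]addrC subrK expr_div_n mulrA -exprD add2n.
  by rewrite ler_pdivrMr ?exprn_gt0// mul1r H.
have h2 : 1 + n%:R * rho <= (1 + rho) ^+ n.
  by apply: Bernoulli; rewrite (le_trans _ (ltW rho0))// oppr_le0.
have : x ^+ 2 * (1 + n%:R * rho) <= 1 by rewrite (le_trans _ h1)// ler_wpM2l// ltW.
apply/negP; rewrite -ltNge mulrDr mulr1 ltr_wpDl ?ltW//.
by move: Hn; rewrite -[_^-1]mul1r ltr_pdivrMr// mulrC.
Qed.

(** The automorphism of the disc taking [a] to 0; its modulus is the pseudo-hyperbolic distance to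
    [a]. *)
Definition moeb a z : C := (z - a) / (1 - conjc a * z).

Lemma moeb_den_ge a z : cabs z < 1 -> 1 - cabs a <= cabs (1 - conjc a * z).
Proof.
move=> z1; have := cabs_ger 1 (conjc a * z); rewrite cabs1 cabsM cabs_conj.
apply: le_trans; rewrite lerB// ler_piMr ?cabs_ge0//; exact: ltW.
Qed.

Lemma moeb_den_neq0 a z : cabs a < 1 -> cabs z < 1 -> 1 - conjc a * z != 0.
Proof.
by move=> a1 z1; rewrite -cabs_gt0 (lt_le_trans _ (moeb_den_ge a z1))// subr_gt0.
Qed.

Lemma moeb_identity a z : cabs (1 - conjc a * z) ^+ 2 - cabs (z - a) ^+ 2 =
  (1 - cabs a ^+ 2) * (1 - cabs z ^+ 2).
Proof.
by rewrite !cabs_sqr; case: a => ? ?; case: z => ? ? /=; ring.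
Qed.

Lemma sqr_lt1 (x : R) : 0 <= x -> x < 1 -> x ^+ 2 < 1.
Proof. by move=> x0 x1; rewrite exprn_ilt1. Qed.

Lemma cabs_moeb a z : cabs (moeb a z) = cabs (z - a) / cabs (1 - conjc a * z).
Proof. by rewrite /moeb cabsM cabsV. Qed.

Lemma moeb_lt1 a z : cabs a < 1 -> cabs z < 1 -> cabs (moeb a z) < 1.
Proof.
move=> a1 z1; have d0 : 0 < cabs (1 - conjc a * z) by rewrite cabs_gt0 moeb_den_neq0.
rewrite cabs_moeb ltr_pdivrMr// mul1r -(@ltr_pXn2r _ 2)// ?nnegrE ?cabs_ge0//.
by rewrite -subr_gt0 moeb_identity; apply: mulr_gt0; rewrite subr_gt0 sqr_lt1 ?cabs_ge0.
Qed.

Lemma moeb_eq0 a z : cabs a < 1 -> cabs z < 1 -> (moeb a z == 0) = (z == a).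
Proof.
move=> a1 z1; rewrite /moeb mulf_eq0 invr_eq0 (negPf (moeb_den_neq0 a1 z1)) orbF.
by rewrite subr_eq0.
Qed.

Lemma moeb_inj a z w : cabs a < 1 -> cabs z < 1 -> cabs w < 1 ->
  moeb a z = moeb a w -> z = w.
Proof.
move=> a1 z1 w1; have dz := moeb_den_neq0 a1 z1; have dw := moeb_den_neq0 a1 w1.
move=> /eqP; rewrite /moeb eqr_div// -subr_eq0 => /eqP e.
have a2 : 1 - a * conjc a != 0.
  rewrite -sqr_cabs_conj -rC1 -rCB; apply/eqP => /(@rC_inj R _ 0)/eqP.
  by rewrite gt_eqF// subr_gt0 sqr_lt1// cabs_ge0.
apply/eqP; rewrite -subr_eq0.
have : (1 - a * conjc a) * (z - w) = 0 by rewrite -e; ring.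
by move=> /eqP; rewrite mulf_eq0 (negPf a2).
Qed.

Lemma moeb_cderiv a z : cabs a < 1 -> cabs z < 1 -> exists c, cderiv (moeb a) z c.
Proof.
move=> a1 z1; have dz := moeb_den_neq0 a1 z1.
have d1 : cderiv (fun x => x - a) z (1 + 0).
  exact: (cderivD (cderiv_id z) (cderiv_cst (- a) z)).
have d2 : cderiv (fun x => 1 - conjc a * x) z (0 + - conjc a * 1).
  have := cderivD (cderiv_cst 1 z) (cderivZ (- conjc a) (cderiv_id z)).
  by rewrite (_ : (fun x => _) = fun x => 1 - conjc a * x)//; apply/funext => x; rewrite mulNr.
by eexists; exact: (cderivM d1 (@cderivV _ (fun x => 1 - conjc a * x) _ _ dz d2)).
Qed.

(** By [moeb_identity], 1 - |moeb a z|^2 is at most x = 2 (1 - |z|) / (1 - |a|)^2, and Bernoulli's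
    inequality gives |moeb a z|^n >= 1 - n x; [eta] makes n x at most e / (1 + e). *)
Lemma moeb_boundary a n (e : R) : cabs a < 1 -> 0 < e -> exists2 s : R, s < 1 &
  forall z, s < cabs z -> cabs z < 1 -> z != a /\ 1 <= (1 + e) * cabs (moeb a z) ^+ n.
Proof.
move=> a1 e0; pose kap := 1 - cabs a.
have kap0 : 0 < kap by rewrite subr_gt0.
have k20 : 0 < kap ^+ 2 by rewrite exprn_gt0.
pose B := 2 / kap ^+ 2 * (n%:R + 1).
have n0 : 0 < n%:R + 1 :> R by rewrite ltr_wpDl.
have B0 : 0 < B by rewrite !mulr_gt0// invr_gt0.
pose eta := Num.min 1 (e / (1 + e)) / B.
have e10 : 0 < 1 + e by rewrite addr_gt0.
have eta0 : 0 < eta by rewrite divr_gt0// lt_min ltr01 divr_gt0.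
exists (Num.max (1 - eta) (cabs a)).
  by rewrite gt_max a1 andbT ltrBlDr ltrDl.
move=> z; rewrite gt_max => /andP[z1 za] z2; split.
  by apply/eqP => za'; move: za; rewrite za' ltxx.
pose x := 2 / kap ^+ 2 * (1 - cabs z).
have x0 : 0 <= x by rewrite mulr_ge0 ?divr_ge0 ?ltW// subr_gt0.
have xB : x * (n%:R + 1) <= Num.min 1 (e / (1 + e)).
  rewrite /x mulrAC -/B mulrC -ler_pdivlMr// -/eta.
  by move: z1; clear; move=> *; lra.
have x1 : x <= 1.
  apply: (@le_trans _ _ (x * (n%:R + 1))); first by rewrite ler_peMr// lerDr.
  by rewrite (le_trans xB)// ge_min lexx.
have xn : n%:R * x <= e / (1 + e).
  apply: (@le_trans _ _ (x * (n%:R + 1))); first by rewrite mulrC ler_wpM2l// lerDl.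
  by rewrite (le_trans xB)// ge_min lexx orbT.
have m1 := moeb_lt1 a1 z2.
have d0 : 0 < cabs (1 - conjc a * z) by rewrite cabs_gt0 moeb_den_neq0.
have mx : 1 - x <= cabs (moeb a z).
  apply: (@le_trans _ _ (cabs (moeb a z) ^+ 2)); last first.
    by rewrite expr2 ler_piMr ?cabs_ge0// ltW.
  rewrite lerBlDr -lerBlDl.
  have -> : 1 - cabs (moeb a z) ^+ 2 =
      (1 - cabs a ^+ 2) * (1 - cabs z ^+ 2) / cabs (1 - conjc a * z) ^+ 2.
    rewrite -moeb_identity cabs_moeb expr_div_n mulrBl divff//.
    by rewrite gt_eqF// exprn_gt0.
  rewrite ler_pdivrMr ?exprn_gt0//.
  have dk : kap ^+ 2 <= cabs (1 - conjc a * z) ^+ 2.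
    by rewrite ler_pXn2r ?nnegrE ?cabs_ge0 ?(ltW kap0)// moeb_den_ge.
  apply: (@le_trans _ _ (x * kap ^+ 2)); last by rewrite ler_wpM2l.
  have -> : x * kap ^+ 2 = 2 * (1 - cabs z) by rewrite /x; field; rewrite gt_eqF.
  have c0 := cabs_ge0 z; have a0 := cabs_ge0 a.
  have c1 : 0 <= 1 - cabs z ^+ 2 by rewrite subr_ge0 ltW// sqr_lt1.
  apply: (@le_trans _ _ (1 * (1 - cabs z ^+ 2))).
    by rewrite ler_wpM2r// gerBl sqr_ge0.
  have : 0 <= (1 - cabs z) * (1 - cabs z) by rewrite mulr_ge0 ?subr_ge0 ?ltW.
  by clear; move=> *; lra.
have bern : 1 - n%:R * x <= cabs (moeb a z) ^+ n.
  have := @Bernoulli (- x) n; rewrite mulrN lerN2 => /(_ x1) h; apply: le_trans h _.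
  by rewrite lerXn2r// nnegrE ?subr_ge0// cabs_ge0.
have : 1 <= (1 + e) * (1 - e / (1 + e)) by rewrite mulrBr mulr1 mulrCA divff ?gt_eqF// mulr1 addrK.
move=> /le_trans; apply; apply: ler_wpM2l; first exact: ltW.
by apply: le_trans bern; rewrite lerB.
Qed.

(** * The Schwarz-Pick inequality and fixed points *)

Section SelfMap.
Variables (g : C -> C) (a : C).
Hypotheses (dg : cdiff_on_disc g 0 1) (g1 : forall z, cabs z < 1 -> cabs (g z) < 1)
  (a1 : cabs a < 1) (ga : g a = a).

(* The functions [(moeb a o g)^(n+2) / (moeb a)^n] are holomorphic also at [a],
   which spares a removable singularity theorem. *)
Lemma Schwarz_Pick z : cabs z < 1 -> cabs (moeb a (g z)) <= cabs (moeb a z).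
Proof.
move=> z1; have [->|za] := eqVneq z a; first by rewrite ga.
have mz0 : 0 < cabs (moeb a z) by rewrite cabs_gt0 moeb_eq0.
pose f x := moeb a (g x).
have df x : cabs x < 1 -> exists c, cderiv f x c.
  move=> x1; have [|c dc] := dg (w := x); first by rewrite subr0.
  have [c' dc'] := moeb_cderiv a1 (g1 x1).
  by eexists; exact: cderiv_comp dc dc'.
have fa : f a = 0 by apply/eqP; rewrite /f ga moeb_eq0.
apply: le_of_powers => // [|n]; first exact: cabs_ge0.
pose F x := f x ^+ n.+2 * (moeb a x ^+ n)^-1.
have f1 x : cabs x < 1 -> cabs (f x) <= 1 by move=> x1; rewrite ltW// moeb_lt1// g1.
suff : cabs (F z) <= 1.
  by rewrite /F cabsM cabsV !cabsX ler_pdivrMr ?exprn_gt0// mul1r.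
apply: (@weak_max_unit_disc R F) z1 => [x|e e0]; last first.
  have [s s1 Hs] := moeb_boundary n a1 e0; exists s => // w sw w1.
  have [wa wn] := Hs w sw w1.
  have mw0 : 0 < cabs (moeb a w) by rewrite cabs_gt0 moeb_eq0.
  rewrite /F cabsM cabsV !cabsX ler_pdivrMr ?exprn_gt0// (le_trans _ wn)//.
  by rewrite exprn_ile1// ?cabs_ge0// f1.
rewrite subr0 => x1; have [->|xa] := eqVneq x a; last first.
  have [c dc] := df x x1; have [c' dc'] := moeb_cderiv a1 x1.
  have m0 : moeb a x ^+ n != 0 by rewrite expf_neq0// moeb_eq0.
  by eexists; exact: (cderivM (cderivX n.+2 dc) (@cderivV _ (fun y => moeb a y ^+ n) _ _ m0 (cderivX n dc'))).
(* At a both the value and the derivative are 0: the numerator is at most (K |h|)^(n+2) and |moeb a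
   (a + h)| >= |h| / 2, so the quotient is O(|h|^2). *)
exists 0 => e e0; have [c dc] := df a a1.
have [K K0 [d d0 Hd]] := cderiv_lip dc.
pose B := K ^+ n.+2 * 2 ^+ n.
have B0 : 0 < B by rewrite mulr_gt0// exprn_gt0.
have a10 : 0 < 1 - cabs a by rewrite subr_gt0.
exists (Num.min (Num.min d (1 - cabs a)) (e / B)).
  by rewrite !lt_min d0 a10 divr_gt0.
move=> h; rewrite !lt_min => /andP[/andP[hd ha] hB].
have -> : F a = 0 by rewrite /F fa expr0n mul0r.
rewrite mul0r !subr0.
have [->|h0] := eqVneq h 0; first by rewrite addr0 /F fa expr0n mul0r cabs0 mulr0.
have hp : 0 < cabs h by rewrite cabs_gt0.
have ah1 : cabs (a + h) < 1.
  by rewrite (le_lt_trans (cabsD _ _))// -ltrBrDl.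
have fh : cabs (f (a + h)) <= K * cabs h by have := Hd h hd; rewrite fa subr0.
have mh : cabs h / 2 <= cabs (moeb a (a + h)).
  rewrite cabs_moeb [a + h - a]addrC addKr ler_wpM2l ?cabs_ge0// lef_pV2 ?posrE ?cabs_gt0 ?moeb_den_neq0//.
  rewrite (le_trans (cabsB _ _))// cabs1 cabsM cabs_conj.
  have : cabs a * cabs (a + h) <= 1 by rewrite mulr_ile1 ?cabs_ge0 ?ltW.
  by clear -dg g1 a1 ga; move=> *; lra.
have h20 : 0 < cabs h / 2 by rewrite divr_gt0.
rewrite /F cabsM cabsV !cabsX.
apply: (@le_trans _ _ ((K * cabs h) ^+ n.+2 * ((cabs h / 2) ^+ n)^-1)).
  apply: ler_pM; rewrite ?exprn_ge0 ?invr_ge0 ?exprn_ge0 ?cabs_ge0//.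
    by rewrite lerXn2r ?nnegrE ?cabs_ge0// mulr_ge0 ?cabs_ge0// ltW.
  rewrite lef_pV2 ?posrE ?exprn_gt0//; last by rewrite (lt_le_trans h20).
  by rewrite lerXn2r ?nnegrE ?cabs_ge0// ltW.
have -> : (K * cabs h) ^+ n.+2 * ((cabs h / 2) ^+ n)^-1 = B * cabs h * cabs h.
  rewrite /B !exprMn exprVn invfM invrK -[n.+2]addn2 !exprD.
  have := expf_neq0 n (lt0r_neq0 hp); move: (cabs h) => y y0.
  by rewrite expr2; field.
rewrite ler_wpM2r ?cabs_ge0// mulrC -ler_pdivlMr// ltW//.
Qed.

(** The quotient of moeb a (g w) by moeb a w has modulus at most 1 by Schwarz-Pick and equals 1 at
    x, so it is 1 along a segment avoiding its singular point a; injectivity of [moeb a]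
    concludes. *)
Lemma fixed_along_segment x y : cabs x < 1 -> cabs y < 1 -> x != a -> g x = x ->
  (forall t : R, 0 <= t <= 1 -> x + rC t * (y - x) != a) -> g y = y.
Proof.
move=> x1 y1 xa gx seg.
pose q w := moeb a (g w) * (moeb a w)^-1.
pose p w := x + (y - x) * w.
have p1 (t : R) : 0 <= t <= 1 -> cabs (p (rC t)) < 1.
  by move=> t01; exact: cabs_segment_lt1.
have pa (t : R) : 0 <= t <= 1 -> p (rC t) != a by rewrite /p mulrC; exact: seg.
have mx : moeb a x != 0 by rewrite moeb_eq0.
have q1 : q (p 0) = 1 by rewrite /q /p mulr0 addr0 gx mulfV.
have : q (p 1) = q (p 0).
  apply: (@max_principle_seg R (fun w => q (p w)) 1); last by rewrite q1 cabs1.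
  move=> t t01; have vt := p1 t t01; have va := pa t t01.
  set v := p (rC t) in vt va.
  have va' : 0 < cabs (v - a) by rewrite cabs_gt0 subr_eq0.
  pose r := Num.min (1 - cabs v) (cabs (v - a)).
  have r0 : 0 < r by rewrite lt_min subr_gt0 vt.
  pose K := cabs (y - x) + 1.
  have K0 : 0 < K by rewrite ltr_wpDl ?cabs_ge0.
  have sub w : cabs (w - rC t) < r / K -> cabs (p w) < 1 /\ p w != a.
    rewrite ltr_pdivlMr// => wt.
    have pv : cabs (p w - v) < r.
      have -> : p w - v = (y - x) * (w - rC t) by rewrite /p /v /p; ring.
      apply: le_lt_trans wt; rewrite cabsM mulrC ler_wpM2l ?cabs_ge0// lerDl//.
    move: pv; rewrite lt_min => /andP[h1 h2]; split.
      by rewrite -(subrK v (p w)) (le_lt_trans (cabsD _ _))// -ltrBrDr.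
    by apply/eqP => pwa; move: h2; rewrite pwa cabsC ltxx.
  exists (r / K); first by rewrite divr_gt0.
  split=> w /sub[w1 wa].
    have [|c dc] := dg (w := p w); first by rewrite subr0.
    have [c' dc'] := moeb_cderiv a1 (g1 w1); have [c'' dc''] := moeb_cderiv a1 w1.
    have mw : moeb a (p w) != 0 by rewrite moeb_eq0.
    by eexists; apply: cderiv_shift; exact: (cderivM (cderiv_comp dc dc') (@cderivV _ (moeb a) _ _ mw dc'')).
  rewrite /q cabsM cabsV ler_pdivrMr ?mul1r ?Schwarz_Pick//.
  by rewrite cabs_gt0 moeb_eq0.
have -> : p 1 = y by rewrite /p mulr1 addrC subrK.
have my : moeb a y != 0.
  rewrite moeb_eq0//; have := pa 1; rewrite ler01 lexx => /(_ isT).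
  by rewrite /p rC1 mulr1 addrC subrK.
rewrite q1 /q => /(congr1 ( *%R^~ (moeb a y))); rewrite mulfVK// mul1r.
by apply: moeb_inj => //; exact: g1.
Qed.

Lemma two_fixed_points b : cabs b < 1 -> b != a -> g b = b ->
  forall z, cabs z < 1 -> g z = z.
Proof.
move=> b1 ba gb z z1; have [->//|za] := eqVneq z a.
have [seg|] := pselect (forall t : R, 0 <= t <= 1 -> b + rC t * (z - b) != a).
  exact: fixed_along_segment seg.
move=> /existsNP[t /not_implyP[t01 /negP]]; rewrite negbK => /eqP ta.
have ba0 : b - a != 0 by rewrite subr_eq0.
have a10 : 0 < 1 - cabs a by rewrite subr_gt0.
(* Here the segment from b to z runs through a, so the path is bent through c: in the coordinate (w
   - a) / (b - a) the points b, c, z are 1, i eta and - mu with mu > 0, and neither leg meets 0. The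
   size of [eta] keeps c in the disc. *)
pose eta := (1 - cabs a) / 2 / (cabs (b - a) + 1).
have K0 : 0 < cabs (b - a) + 1 by rewrite ltr_wpDl ?cabs_ge0.
have eta0 : 0 < eta by rewrite !divr_gt0.
pose ie : C := Complex 0 eta.
have cie : cabs ie = eta.
  by rewrite /cabs/= expr0n add0r sqrtr_sqr gtr0_norm.
pose c := a + ie * (b - a).
have c1 : cabs c < 1.
  rewrite (le_lt_trans (cabsD _ _))// -ltrBrDl cabsM cie /eta mulrAC ltr_pdivrMr//.
  rewrite mulrAC ltr_pdivrMr// -mulrA ltr_pM2l// mulr2n mulrDr mulr1.
  by apply: ltr_pwDr => //; rewrite lerDl.
have ca : c != a.
  rewrite -subr_eq0 [c - a](_ : _ = ie * (b - a)); last by rewrite /c addrC addKr.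
  by rewrite mulf_neq0// -cabs_gt0 cie.
have [t0 t1] := andP t01.
have tn0 : t != 0 by apply/eqP => t00; move: ta; rewrite t00 mul0r addr0 => /eqP; rewrite (negPf ba).
have tp : 0 < t by rewrite lt_def tn0.
have gc : g c = c.
  apply: (@fixed_along_segment b c) => // u u01; rewrite -subr_eq0.
  have -> : b + rC u * (c - b) - a = (b - a) * Complex (1 - u) (u * eta).
    have -> : Complex (1 - u) (u * eta) = 1 - rC u + rC u * ie.
      by apply/eqP; rewrite eq_complex /= !(mul0r, mulr0, subr0, addr0, add0r, oppr0) !eqxx.
    by rewrite /c; ring.
  rewrite mulf_neq0//; apply/eqP => -[h1 h2].
  have u1 : u = 1 by apply/esym/eqP; rewrite -subr_eq0 h1.
  by move: h2; rewrite u1 mul1r => /eqP; rewrite gt_eqF.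
apply: (@fixed_along_segment c z) => // u u01; rewrite -subr_eq0.
pose mu := (1 - t) / t.
have zE : z - a = - rC mu * (b - a).
  have tb : rC t * (z - a) = - rC (1 - t) * (b - a).
    by rewrite rCB rC1 -[in LHS]ta -[in RHS]ta; ring.
  have rt0 : rC t != 0 by apply/eqP => /(@rC_inj R _ 0)/eqP; rewrite gt_eqF.
  apply: (mulfI rt0); rewrite tb /mu mulrA; congr (_ * _).
  by rewrite mulrN -rCM mulrCA divff ?gt_eqF// mulr1.
have -> : c + rC u * (z - c) - a = (b - a) * Complex (- (u * mu)) ((1 - u) * eta).
  have -> : Complex (- (u * mu)) ((1 - u) * eta) = (1 - rC u) * ie - rC u * rC mu.
    apply/eqP; rewrite eq_complex /= !(mul0r, mulr0, subr0, addr0, add0r, oppr0) !eqxx//.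
  have -> : c + rC u * (z - c) - a = (1 - rC u) * (c - a) + rC u * (z - a) by ring.
  by rewrite zE /c; ring.
rewrite mulf_neq0//; apply/eqP => -[h1 h2].
have u1 : u = 1.
  move/eqP: h2; rewrite mulf_eq0 (gt_eqF eta0) orbF subr_eq0 => /eqP ->//.
move/eqP: h1; rewrite u1 mul1r oppr_eq0 /mu mulf_eq0 invr_eq0 (negPf tn0) orbF subr_eq0.
move=> /eqP t11; move: ta; rewrite -t11 rC1 mul1r addrC subrK => /eqP.
by rewrite (negPf za).
Qed.

Let h z := (g z + z) / 2.

(** The condition |moeb a x| <= del reads |x - a|^2 - del^2 |1 - conj(a) x|^2 <= 0, whose left side
    is quadratic with leading coefficient 1 - del^2 |a|^2 > 0, hence strictly convex. *)
Lemma moeb_midpoint z w (del : R) : cabs z < 1 -> cabs w < 1 -> 0 <= del -> del < 1 ->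
  cabs (moeb a z) <= del -> cabs (moeb a w) <= del -> z != w ->
  cabs (moeb a ((z + w) / 2)) < del.
Proof.
move=> z1 w1 del0 del1 mz mw zw.
have mid1 : cabs ((z + w) / 2) < 1.
  rewrite cabsM cabsV cabs_two.
  rewrite ltr_pdivrMr// mul1r (le_lt_trans (cabsD _ _))// mulr2n ltrD//.
have Q x : cabs x < 1 -> (cabs (moeb a x) <= del) =
    (cabs (x - a) ^+ 2 - del ^+ 2 * cabs (1 - conjc a * x) ^+ 2 <= 0).
  move=> x1; have d0 : 0 < cabs (1 - conjc a * x) by rewrite cabs_gt0 moeb_den_neq0.
  rewrite cabs_moeb ler_pdivrMr// subr_le0 -exprMn ler_pXn2r// nnegrE ?cabs_ge0//.
  by rewrite mulr_ge0 ?cabs_ge0.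
have Q' x : cabs x < 1 -> (cabs (moeb a x) < del) =
    (cabs (x - a) ^+ 2 - del ^+ 2 * cabs (1 - conjc a * x) ^+ 2 < 0).
  move=> x1; have d0 : 0 < cabs (1 - conjc a * x) by rewrite cabs_gt0 moeb_den_neq0.
  rewrite cabs_moeb ltr_pdivrMr// subr_lt0 -exprMn ltr_pXn2r// nnegrE ?cabs_ge0//.
  by rewrite mulr_ge0 ?cabs_ge0.
move: mz mw; rewrite (Q z z1) (Q w w1) (Q' _ mid1) => hz hw.
have two : (2 : C)^-1 = Complex 2^-1 0.
  have -> : (2 : C) = rC 2 by rewrite /rC rmorph_nat.
  by rewrite /rC -fmorphV.
have id : cabs ((z + w) / 2 - a) ^+ 2 - del ^+ 2 * cabs (1 - conjc a * ((z + w) / 2)) ^+ 2 =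
    (cabs (z - a) ^+ 2 - del ^+ 2 * cabs (1 - conjc a * z) ^+ 2) / 2 +
    (cabs (w - a) ^+ 2 - del ^+ 2 * cabs (1 - conjc a * w) ^+ 2) / 2 -
    (1 - del ^+ 2 * cabs a ^+ 2) * cabs (z - w) ^+ 2 / 4.
  rewrite two !cabs_sqr; clear; case: z => z1 z2; case: w => w1 w2; case: a => a1 a2 /=.
  by field.
have pos : 0 < (1 - del ^+ 2 * cabs a ^+ 2) * cabs (z - w) ^+ 2.
  rewrite mulr_gt0 ?exprn_gt0 ?cabs_gt0 ?subr_eq0// subr_gt0.
  by rewrite mulr_ilt1 ?sqr_ge0// sqr_lt1 ?cabs_ge0.
rewrite id; move: hz hw pos; set X := _ - _; set Y := _ - _; set Z := _ * _.
by clear -dg g1 a1 ga; move=> *; lra.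
Qed.

(* Pseudo-hyperbolic discs are strictly convex, so [|moeb a|] is a strict Lyapunov
   function for [h] away from the fixed points of [g]. *)
Lemma averaged_iterates b : cabs b < 1 -> g b != b ->
  utends (fun n => iter n h 0) a.
Proof.
move=> b1 gb.
have hM z : cabs z < 1 -> cabs (h z) < 1.
  move=> z1; rewrite /h cabsM cabsV cabs_two.
  by rewrite ltr_pdivrMr// mul1r (le_lt_trans (cabsD _ _))// mulr2n ltrD// g1.
have dec z : cabs z < 1 -> cabs (moeb a (h z)) <= cabs (moeb a z).
  move=> z1; have [gz|gz] := eqVneq (g z) z.
    by rewrite /h gz (_ : (z + z) / 2 = z)//; field.
  by apply/ltW/moeb_midpoint => //; rewrite ?g1 ?cabs_ge0 ?moeb_lt1// Schwarz_Pick.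
pose x n := iter n h 0.
have x1 n : cabs (x n) < 1 by elim: n => [|n IH]; rewrite ?cabs0//= hM.
pose p n := cabs (moeb a (x n)).
have pS n : p n.+1 <= p n by exact: dec.
have pm n k : p (n + k)%N <= p n.
  by elim: k => [|k IH]; rewrite ?addn0// addnS (le_trans (pS _)).
have [y xy] : exists y, utends x y.
  by apply: (@utends_ex _ _ 1) => n; exact: ltW.
have y1' : cabs y <= 1 by apply: (utends_le xy); apply: umost_all => n; exact: ltW.
(* On the unit circle |y - a| = |1 - conj(a) y|, whereas the iterates, starting at 0, satisfy |x n -
   a| <= |a| |1 - conj(a) x n|; in the limit this contradicts |a| < 1. *)
have y1 : cabs y < 1.
  rewrite lt_neqAle y1' andbT; apply/eqP => yy.
  have : cabs (y - a) <= cabs a * cabs (1 - conjc a * y).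
    have dS : cderiv (fun z => 1 + - conjc a * z) y (0 + - conjc a * 1).
      exact: cderivD (cderiv_cst 1 y) (cderivZ (- conjc a) (cderiv_id y)).
    apply/ler_addgt0Pr => e e0; have e2 : 0 < e / 2 by rewrite divr_gt0.
    have T1 := utends_cont (cderiv_cont dS) xy.
    have [n [h1 h2]] := umost_ex (umostI (xy _ e2) (T1 _ e2)).
    have d0 : 0 < cabs (1 - conjc a * x n) by rewrite cabs_gt0 moeb_den_neq0.
    have h3 : cabs (x n - a) <= cabs a * cabs (1 - conjc a * x n).
      have := pm 0%N n; rewrite add0n {1}/p cabs_moeb ler_pdivrMr// => h3.
      apply: le_trans h3 _; rewrite ler_wpM2r ?cabs_ge0//.
      by rewrite /p /x /= /moeb mulr0 subr0 divr1 sub0r cabsN.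
    have h4 : cabs (1 - conjc a * x n) <= cabs (1 - conjc a * y) + e / 2.
      have -> : 1 - conjc a * x n = (1 - conjc a * y) + (1 + - conjc a * x n - (1 + - conjc a * y)) by ring.
      by rewrite (le_trans (cabsD _ _))// lerD2l ltW.
    have h5 : cabs (y - a) <= cabs (x n - a) + e / 2.
      have -> : y - a = (x n - a) + (y - x n) by ring.
      by rewrite (le_trans (cabsD _ _))// lerD2l cabsC ltW.
    apply: (le_trans h5); apply: (le_trans (lerD h3 (lexx _))).
    rewrite [e in leRHS]splitr addrA lerD2r.
    apply: le_trans (ler_wpM2l (cabs_ge0 a) h4) _.
    rewrite mulrDr lerD2l ler_piMl ?ltW//.
  have -> : cabs (1 - conjc a * y) = cabs (y - a).
    apply/eqP; rewrite -(@eqrXn2 _ 2)// ?cabs_ge0// -subr_eq0 moeb_identity yy.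
    by rewrite expr1n subrr mulr0.
  have D0 : 0 < cabs (y - a).
    by rewrite cabs_gt0 subr_eq0; apply/eqP => ya; move: a1; rewrite -ya yy ltxx.
  by rewrite -[X in X <= _]mul1r ler_pM2r// leNgt a1.
have cm z : cabs z < 1 -> ccont_at (moeb a) z.
  by move=> z1; have [c /cderiv_cont] := moeb_cderiv a1 z1.
have ch : ccont_at h y.
  have [|c dc] := dg (w := y); first by rewrite subr0.
  have := cderivZ 2^-1 (cderivD dc (cderiv_id y)).
  by rewrite (_ : (fun z => _) = h); [exact: cderiv_cont|apply/funext => z; rewrite /h mulrC].
have T1 := utends_cont (cm y y1) xy.
have T2 := utends_cont (cm _ (hM y y1)) (utends_cont ch xy).
(* Both x n and h (x n) run through the nonincreasing sequence [p], so |moeb a| cannot drop from y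
   to h y; the strict decrease at points not fixed by g then forces g y = y. *)
have le12 : cabs (moeb a y) <= cabs (moeb a (h y)).
  apply/ler_addgt0Pr => e e0; have e2 : 0 < e / 2 by rewrite divr_gt0.
  have [n h1] := umost_ex (T2 _ e2).
  have q1 : cabs (moeb a y) <= p n.+1.
    apply: (utends_le T1); apply: (@umost_eventually _ n.+1) => k nk.
    by have := pm n.+1 (k - n.+1)%N; rewrite subnKC.
  apply: le_trans q1 _.
  have -> : p n.+1 = cabs (moeb a (h y) + (moeb a (h (x n)) - moeb a (h y))).
    by rewrite [_ + (_ - _)]addrC subrK.
  rewrite (le_trans (cabsD _ _))// lerD2l (le_trans (ltW h1))//.
  by rewrite ler_pdivrMr// ler_peMr ?ler1n// ltW.
suff -> : a = y by [].
apply/eqP; rewrite eq_sym; apply: contrapT => /negP ya.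
have gy : g y = y.
  apply/eqP; apply: contrapT => /negP gy.
  have := @moeb_midpoint (g y) y (cabs (moeb a y)).
  rewrite g1// y1 cabs_ge0 moeb_lt1// lexx Schwarz_Pick// gy.
  by move=> /(_ isT isT isT isT isT isT isT); rewrite -/(h y) ltNge le12.
by move/eqP: gb; apply; exact: (two_fixed_points y1 ya gy).
Qed.

End SelfMap.
End DiscSelfMaps.

(** * Strictly convex domains *)

Section StrictlyConvex.
Variables (R : realType) (d : nat).
Local Notation C := R[i].
Local Notation pt := (pt R d).
Variables (Om V : cset R d) (E : (pt -> C) -> (pt -> C)).
Hypotheses (oOm : is_open Om) (neOm : exists z, Om z) (bOm : bounded_set Om)
  (cOm : convex_set Om) (balOm : balanced Om) (VOm : forall z, V z -> Om z)
  (Eop : isometric_extension_operator Om V E).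

Lemma eq_of_extremal_sum (x y : C) (m : R) :
  cabs x <= m -> cabs y <= m -> 2 * m <= cabs (x + y) -> x = y.
Proof.
move=> xm ym xym; apply/eqP; rewrite -subr_eq0 -cabs_eq0.
have m0 : 0 <= m by rewrite (le_trans (cabs_ge0 x)).
have par : cabs (x - y) ^+ 2 + cabs (x + y) ^+ 2 = 2 * cabs x ^+ 2 + 2 * cabs y ^+ 2.
  by rewrite !cabs_sqr !cReD !cImD; case: x {xm xym} => ? ?; case: y {ym} => ? ? /=; ring.
have sqle (u w : R) : 0 <= u -> u <= w -> u ^+ 2 <= w ^+ 2.
  by move=> u0 uw; rewrite ler_pXn2r ?nnegrE// (le_trans u0).
have h1 := sqle _ _ (cabs_ge0 x) xm; have h2 := sqle _ _ (cabs_ge0 y) ym.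
have h3 := sqle _ _ (mulr_ge0 (ler0n R 2) m0) xym.
rewrite -sqrf_eq0 eq_le sqr_ge0 andbT.
move: par h1 h2 h3; rewrite exprMn; set u := cabs (x - y) ^+ 2; set w := cabs (x + y) ^+ 2.
set p := cabs x ^+ 2; set q := cabs y ^+ 2; set s := m ^+ 2.
by rewrite (_ : 2 ^+ 2 * s = 4 * s); [lra|ring].
Qed.

Lemma closure_utends (S : cset R d) (zn : nat -> pt) b : (forall n, S (zn n)) ->
  (forall i, utends (fun n => zn n i) (b i)) -> closure S b.
Proof.
move=> Sz zb e e0; have [n Hn] := umost_ex (umost_forall_ord (fun i => zb i _ e0)).
by exists (zn n); split => //; apply/cballE.
Qed.

Lemma coord_utends_ex (zn : nat -> pt) : (forall n, Om (zn n)) ->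
  exists z : pt, forall i, utends (fun n => zn n i) (z i).
Proof.
move=> Oz; have [M HM] := bounded_cabs bOm.
have /choice[z Hz] i : exists l, utends (fun n => zn n i) l.
  by apply: (@utends_ex _ _ M) => n; exact: HM.
by exists z.
Qed.

(** A limit of self-maps could reach the boundary. A functional supporting Om at such a value would
    be maximal along F, hence constant, against its value at a fixed point in V. *)
Lemma limit_map_in (G : nat -> pt -> pt) (F : pt -> pt) z :
  (forall n i a, Om a -> hdiff (fun z => G n z i) a) -> (forall n a, Om a -> Om (G n a)) ->
  (forall n v, V v -> G n v = v) ->
  (forall a i, Om a -> utends (fun n => G n a i) (F a i)) ->
  Om z -> Om (F z).
Proof.
move=> dG GO GV GF Oz; apply: contrapT => nO.
have [M HM] := bounded_cabs bOm.
have [a a1 az] := support_functional oOm neOm bOm cOm balOm nO.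
have dF i b : Om b -> hdiff (fun z => F z i) b.
  move=> Ob; apply: (@utends_hdiff _ _ Om (fun n z => G n z i) _ M) => //.
  - by move=> n y Oy; exact: dG.
  - by move=> n y Oy; apply: HM; exact: GO.
  - by move=> y Oy; exact: GF.
have Fv v : V v -> F v = v.
  move=> Vv; apply/funext => i; apply: utends_uniq (GF v i (VOm Vv)) _.
  apply: utends_ext (utends_cst (v i)).
  by apply: umost_all => n; rewrite GV.
have lim y : Om y -> utends (fun n => pairing a (G n y)) (pairing a (F y)).
  by move=> Oy; apply: utends_sum => i; apply: utendsZ; exact: GF.
have le1 y : Om y -> cabs (pairing a (F y)) <= 1.
  move=> Oy; apply: (utends_le (lim y Oy)); apply: umost_all => n.
  by apply: a1; exact: GO.
have eq1 : cabs (pairing a (F z)) = 1 by apply/eqP; rewrite eq_le le1.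
have [v Vv] := V_nonempty oOm neOm VOm Eop.
have dp b : Om b -> hdiff (fun z => pairing a (F z)) b.
  by move=> Ob; apply: hdiff_sum => i; apply: hdiffZ; exact: dF.
have := max_principle_convex oOm cOm dp le1 Oz eq1 (VOm Vv).
rewrite (Fv v Vv) => e.
have := support_lt1 oOm a1 (VOm Vv).
by rewrite e eq1 ltxx.
Qed.

Local Notation r := (ext_map E).

Lemma ext_map_iter_in n z : Om z -> Om (iter n r z).
Proof. by move=> Oz; elim: n => [//|n IH]; rewrite iterS; apply: (ext_map_in oOm neOm bOm cOm balOm VOm Eop). Qed.

Lemma ext_map_iter_on_V n v : V v -> iter n r v = v.
Proof.
move=> Vv; elim: n => [//|n IH]; rewrite iterS IH.
exact: (ext_map_on_V oOm bOm VOm Eop).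
Qed.

Lemma ext_map_iter_hdiff n i a : Om a -> hdiff (fun z => iter n r z i) a.
Proof.
move=> Oa; elim: n i => [|n IH] i; first exact: hdiff_proj.
rewrite (_ : (fun z => _) = fun z => (fun y => r y i) (iter n r z)); last first.
  by apply/funext => z; rewrite iterS.
apply: hdiff_comp => //.
by apply: (ext_map_hdiff oOm bOm VOm Eop); exact: ext_map_iter_in.
Qed.

Hypothesis scOm : strictly_convex Om.

(* The hyperplane at [b] gives [|pairing a z + k| < 2 |c|] on [Om], where
   [k = pairing a b]; its extension has the same supremum, so values on [V] come
   close to [2 |c|] too, which happens only near [b]. *)
Lemma boundary_limit_in_closure (xn : nat -> pt) b : (forall n, Om (xn n)) -> ~ Om b ->
  (forall i, utends (fun n => r (xn n) i) (b i)) ->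
  exists2 vn : nat -> pt, (forall n, V (vn n)) & forall i, utends (fun n => vn n i) (b i).
Proof.
move=> Ox nOb xb.
have clb : closure Om b.
  apply: (@closure_utends _ (fun n => r (xn n))) => // n.
  exact: (ext_map_in oOm neOm bOm cOm balOm VOm Eop).
have [a [c [a0 Hac]]] := scOm (conj clb nOb).
have [cb _] := (Hac b).2 erefl; rewrite /real_hyperplane -/(pairing a b) in cb.
(* A point of Om with |pairing a z| >= |c| could be rotated and shrunk, by balancedness, onto the
   hyperplane, which meets the closure only at b, outside Om. *)
have lt_c z : Om z -> cabs (pairing a z) < `|c|.
  move=> Oz; rewrite ltNge; apply/negP => cz.
  have [u u1 uz] := phase_ex (pairing a z).
  have O1 : Om (pscale (rC (c / cabs (pairing a z)) * u) z).
    apply: (balanced_scale balOm) => //; rewrite cabsM u1 mulr1 cabs_rC normrM normfV.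
    rewrite (ger0_norm (cabs_ge0 _)).
    have [z0|z0] := eqVneq (cabs (pairing a z)) 0; first by rewrite z0 invr0 mulr0 ler01.
    by rewrite ler_pdivrMr ?mul1r// lt_def z0 cabs_ge0.
  have cl1 : closure Om (pscale (rC (c / cabs (pairing a z)) * u) z).
    by move=> e e0; eexists; split; [exact: O1|apply/cballE => i; rewrite subrr cabs0].
  suff e : pscale (rC (c / cabs (pairing a z)) * u) z = b by apply: nOb; rewrite -e.
  apply: (Hac _).1; split => //; rewrite /real_hyperplane -/(pairing a _).
  rewrite pairing_scale -mulrA uz -rCM /=.
  have [z0|z0] := eqVneq (cabs (pairing a z)) 0; last by rewrite divfK.
  move: cz; rewrite z0 mulr0 => c0; apply/esym/eqP; rewrite -normr_eq0 eq_le normr_ge0 andbT.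
  exact: c0.
set k := pairing a b.
have le_k : cabs k <= `|c|.
  have T : utends (fun n => pairing a (r (xn n))) k.
    by apply: utends_sum => i; apply: utendsZ.
  apply: (utends_le T); apply: umost_all => n; rewrite ltW// lt_c//.
  exact: (ext_map_in oOm neOm bOm cOm balOm VOm Eop).
have ck : `|c| <= cabs k by rewrite -cb Re_le_cabs.
have ek : cabs k = `|c| by apply/eqP; rewrite eq_le le_k.
have Hp : Hinf_var V (fun z => pairing a z + k).
  by apply: HinfD; [exact: (Hinf_pairing oOm bOm VOm a)|exact: (Hinf_cst oOm VOm)].
have /choice[vn Hvn] (n : nat) : exists v, V v /\ 2 * `|c| - n.+1%:R^-1 <= cabs (pairing a v + k).
  apply: contrapT => nv.
  have bd v : V v -> cabs (pairing a v + k) <= 2 * `|c| - n.+1%:R^-1.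
    by move=> Vv; rewrite leNgt; apply/negP => /ltW h; apply: nv; exists v.
  have T : utends (fun m => E (fun z => pairing a z + k) (xn m)) (k + k).
    have T' : utends (fun n => pairing a (r (xn n)) + k) (k + k).
      by apply: utendsD (utends_cst k); apply: utends_sum => i; apply: utendsZ.
    apply: utends_ext T'; apply: umost_all => m.
    rewrite (extD oOm VOm Eop _ _ (Ox m)); last 2 first.
    - exact: (Hinf_pairing oOm bOm VOm a).
    - exact: (Hinf_cst oOm VOm).
    by rewrite (ext_pairing oOm bOm VOm Eop)// (ext_cst oOm neOm cOm VOm Eop).
  have := utends_le T (umost_all (fun m => ext_le Eop Hp bd (Ox m))).
  have -> : k + k = 2 * k by rewrite mulr_natl mulr2n.
  rewrite cabsM ek cabs_two.
  by rewrite lerDl oppr_ge0 leNgt invr_gt0 ltr0n.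
exists vn; first by move=> n; case: (Hvn n).
have [v Hv] : exists v : pt, forall i, utends (fun n => vn n i) (v i).
  by apply: coord_utends_ex => n; apply: VOm; case: (Hvn n).
suff <- : v = b by [].
apply: (Hac v).1; split; last first.
  by apply: closure_utends Hv => n; apply: VOm; case: (Hvn n).
rewrite /real_hyperplane -/(pairing a v).
have T : utends (fun n => pairing a (vn n)) (pairing a v).
  by apply: utends_sum => i; apply: utendsZ.
suff -> : pairing a v = k by [].
apply: (@eq_of_extremal_sum _ _ `|c|) => //.
  by apply: (utends_le T); apply: umost_all => n; rewrite ltW// lt_c//; apply: VOm; case: (Hvn n).
apply/ler_addgt0Pr => e e0; rewrite -lerBlDr.
apply: (utends_ge (utendsD T (utends_cst k))); apply: umostW (umost_small e0) => n ne.
by have [_] := Hvn n; apply: le_trans; rewrite lerB// ltW.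
Qed.

(* Let [m] be the supremum over [z] of [limsup |P (r^n z)|] and suppose [S < m].
   Choose almost optimal [y_k = r^(n1 k) (z_k)] whose [mk k]-th iterate is still
   almost optimal, and let [y] be their limit.  If [y] is in the boundary, it is a
   limit of points of [V]; otherwise [|P o F|], where [F] is the limit of
   [r^(mk k)], attains its maximum [m] at [y] and is constant. *)
Lemma iterate_limit_in_hull (rho : pt -> pt) :
  (forall a i, Om a -> utends (fun n => iter n r a i) (rho a i)) ->
  forall z, Om z -> poly_hull_in V (rho z).
Proof.
move=> Hrho z0 Oz0 P S pP PS; rewrite leNgt; apply/negP => SP.
have [M HM] := bounded_cabs bOm.
have [MP HMP] := polyfun_bounded pP (bounded_cabs bOm).
have limP (zn : nat -> pt) y : (forall i, utends (fun n => zn n i) (y i)) ->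
    utends (fun n => P (zn n)) (P y).
  by move=> H; apply: hdiff_utends => //; exact: polyfun_hdiff.
(* Asking for arbitrarily large n, instead of almost all n, makes the supremum of T bound limits
   along every sequence of iterates, in particular along r^(mk k). *)
pose T := [set x : R | exists2 z, Om z & forall N, exists2 n, (N <= n)%N &
  x <= cabs (P (iter n r z))]%classic.
have ubT : ubound T MP.
  move=> x [z Oz /(_ 0%N)[n _ xn]]; rewrite (le_trans xn)// HMP//.
  exact: ext_map_iter_in.
have inT x z : Om z -> umost (fun n => x <= cabs (P (iter n r z))) -> T x.
  move=> Oz H; exists z => // N.
  have [n [Nn xn]] := umost_ex (umostI (@umost_eventually (fun n => (N <= n)%N) N (fun n => id)) H).
  by exists n.
have Tx0 eps : 0 < eps -> T (cabs (P (rho z0)) - eps).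
  move=> eps0; apply: (inT _ _ Oz0).
  have := limP (fun n => iter n r z0) (rho z0) (fun i => Hrho z0 i Oz0).
  move=> /(_ _ eps0); apply: umostW => n h.
  by have := cabs_ger (P (rho z0)) (P (iter n r z0)); rewrite cabsC; move: h; lra.
have hT : has_sup T by split; [exists (cabs (P (rho z0)) - 1); exact: Tx0|exists MP].
pose m := sup T.
have Sm : S < m.
  have e0 : 0 < (cabs (P (rho z0)) - S) / 2 by rewrite divr_gt0// subr_gt0.
  apply: lt_le_trans (sup_upper_bound hT (Tx0 _ e0)).
  by clear -SP oOm neOm bOm cOm balOm VOm Eop scOm; lra.
(* The first index is positive so that y_k is a value of r, as the boundary case requires; the gap
   of at least k makes [mk k] tend to infinity. *)
have /choice[D HD] (k : nat) : exists p : pt * (nat * nat), [/\ Om p.1, (0 < p.2.1)%N,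
    (p.2.1 + k <= p.2.2)%N, m - k.+1%:R^-1 <= cabs (P (iter p.2.1 r p.1)) &
    m - k.+1%:R^-1 <= cabs (P (iter p.2.2 r p.1))].
  have k0 : 0 < k.+1%:R^-1 :> R by rewrite invr_gt0.
  have [x [z Oz Hz] /ltW xm] := sup_adherent k0 hT.
  have [n n0 h1] := Hz 1%N; have [n' nn' h2] := Hz (n + k)%N.
  by exists (z, (n, n')); split => //=; exact: le_trans xm _.
pose zk k := (D k).1; pose n1 k := (D k).2.1; pose mk k := ((D k).2.2 - n1 k)%N.
pose yk k := iter (n1 k) r (zk k).
have Oyk k : Om (yk k) by apply: ext_map_iter_in; have [] := HD k.
have mk_ge k : (k <= mk k)%N.
  by rewrite /mk leq_subRL; [have [] := HD k|have [_ _ h _ _] := HD k; exact: leq_trans (leq_addr _ _) h].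
have e2 k : iter (mk k) r (yk k) = iter (D k).2.2 r (zk k).
  rewrite /yk -iterD subnK//; have [_ _ h _ _] := HD k; exact: leq_trans (leq_addr _ _) h.
have [y Hy] := coord_utends_ex Oyk.
have approach (u : nat -> pt) (w : pt) : (forall i, utends (fun n => u n i) (w i)) ->
    (forall k, m - k.+1%:R^-1 <= cabs (P (u k))) -> m <= cabs (P w).
  move=> uw um; apply/ler_addgt0Pr => e e0; rewrite -lerBlDr.
  apply: (utends_ge (limP _ _ uw)); apply: umostW (umost_small e0) => n ne.
  by apply: le_trans (um n); rewrite lerB// ltW.
have Py : m <= cabs (P y) by apply: (approach _ _ Hy) => k; have [] := HD k.
have [Oy|nOy] := pselect (Om y); last first.
  have [xk Oxk xkE] : exists2 xk : nat -> pt, (forall k, Om (xk k)) & forall k, r (xk k) = yk k.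
    exists (fun k => iter (n1 k).-1 r (zk k)).
      by move=> k; apply: ext_map_iter_in; have [] := HD k.
    by move=> k; rewrite /yk -iterS prednK//; have [] := HD k.
  have [vn Vvn vny] : exists2 vn : nat -> pt, (forall n, V (vn n)) &
      forall i, utends (fun n => vn n i) (y i).
    apply: (@boundary_limit_in_closure xk) => // i.
    by apply: utends_ext (Hy i); apply: umost_all => k; rewrite xkE.
  have : cabs (P y) <= S by apply: (utends_le (limP _ _ vny)); apply: umost_all => n; exact: PS.
  by move=> /(le_trans Py); rewrite leNgt Sm.
have /choice[F HF] z : exists w : pt, Om z -> forall i, utends (fun k => iter (mk k) r z i) (w i).
  have [Oz|nOz] := pselect (Om z); last by exists z.
  by have [w Hw] := coord_utends_ex (fun k => ext_map_iter_in (mk k) Oz); exists w.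
have dF i a : Om a -> hdiff (fun z => F z i) a.
  move=> Oa; apply: (@utends_hdiff _ _ Om (fun k z => iter (mk k) r z i) _ M) => //.
  - by move=> n w Ow; exact: ext_map_iter_hdiff.
  - by move=> n w Ow; apply: HM; exact: ext_map_iter_in.
  - by move=> w Ow; exact: HF.
have PFm z : Om z -> cabs (P (F z)) <= m.
  move=> Oz; rewrite leNgt; apply/negP => mP.
  pose x := (m + cabs (P (F z))) / 2.
  have x1 : m < x by rewrite /x; clear -mP oOm neOm bOm cOm balOm VOm Eop scOm; lra.
  suff Tx : T x by have := sup_upper_bound hT Tx; rewrite leNgt x1.
  exists z => // N.
  have e0 : 0 < (cabs (P (F z)) - m) / 2 by rewrite divr_gt0// subr_gt0.
  have H := limP _ _ (HF z Oz) _ e0.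
  have [k [Nk hk]] := umost_ex (umostI (@umost_eventually (fun n => (N <= n)%N) N (fun n => id)) H).
  exists (mk k); first exact: leq_trans Nk (mk_ge k).
  have := cabs_ger (P (F z)) (P (iter (mk k) r z)); rewrite cabsC /x.
  by move: hk; clear -oOm neOm bOm cOm balOm VOm Eop scOm; move=> *; lra.
have PFy : cabs (P (F y)) = m.
  apply/eqP; rewrite eq_le PFm//=.
  apply: (approach (fun k => iter (mk k) r (yk k))); last first.
    by move=> k; rewrite e2; have [] := HD k.
  move=> i; apply: (@utends_equicont _ _ Om (fun k z => iter (mk k) r z i) (fun z => F z i) M) => //.
  - by move=> n w Ow; exact: ext_map_iter_hdiff.
  - by move=> n w Ow; apply: HM; exact: ext_map_iter_in.
  - by move=> w Ow; exact: HF.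
have dPF a : Om a -> hdiff (fun z => P (F z)) a.
  by move=> Oa; apply: hdiff_comp => [i|]; [exact: dF|exact: polyfun_hdiff].
have [v Vv] := V_nonempty oOm neOm VOm Eop.
have Fv : F v = v.
  apply/funext => i; apply: utends_uniq (HF v (VOm Vv) i) _.
  apply: utends_ext (utends_cst (v i)).
  by apply: umost_all => n; rewrite ext_map_iter_on_V.
have := max_principle_convex oOm cOm dPF PFm Oy PFy (VOm Vv); rewrite Fv => e.
by have := PS v Vv; rewrite e PFy leNgt Sm.
Qed.

Lemma retract_of_strictly_convex : rel_poly_convex Om V -> retract Om V.
Proof.
move=> rpc; have [M HM] := bounded_cabs bOm.
have /choice[rho Hrho] z : exists w : pt, Om z -> forall i, utends (fun k => iter k r z i) (w i).
  have [Oz|nOz] := pselect (Om z); last by exists z.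
  by have [w Hw] := coord_utends_ex (fun k => ext_map_iter_in k Oz); exists w.
apply: (@retract_of_map _ _ Om V oOm VOm rho).
- move=> i a Oa; apply: (@utends_hdiff _ _ Om (fun k z => iter k r z i) _ M) => //.
  + by move=> n w Ow; exact: ext_map_iter_hdiff.
  + by move=> n w Ow; apply: HM; exact: ext_map_iter_in.
  + by move=> w Ow; exact: Hrho.
- move=> z Oz; apply: (rel_poly_convex_hull rpc).
    apply: (@limit_map_in (fun n => iter n r)) => //.
    + by move=> n i a Oa; exact: ext_map_iter_hdiff.
    + by move=> n a Oa; exact: ext_map_iter_in.
    + by move=> n v Vv; exact: ext_map_iter_on_V.
    + by move=> a i Oa; exact: Hrho.
  by apply: iterate_limit_in_hull => // a i Oa; exact: Hrho.
- move=> v Vv; apply/funext => i; apply: utends_uniq (Hrho v (VOm Vv) i) _.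
  apply: utends_ext (utends_cst (v i)).
  by apply: umost_all => n; rewrite ext_map_iter_on_V.
Qed.

End StrictlyConvex.

(** * The polydisk *)

Section Polydisk.
Variables (R : realType) (d : nat).
Local Notation C := R[i].
Local Notation pt := (pt R d).
Implicit Types (z w v a : pt) (i j : 'I_d) (x y : C).

Definition upd z i x : pt := fun j => if j == i then x else z j.
Definition unit_vec i : pt := fun j => (j == i)%:R.

Lemma upd_same z i x : upd z i x i = x.
Proof. by rewrite /upd eqxx. Qed.

Lemma upd_self z i : upd z i (z i) = z.
Proof. by apply/funext => j; rewrite /upd; case: eqP => [->|]. Qed.

Lemma upd_upd z i x y : upd (upd z i x) i y = upd z i y.
Proof. by apply/funext => j; rewrite /upd; case: eqP. Qed.

Lemma upd_line z i x : upd z i x = line (upd z i 0) (unit_vec i) x.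
Proof.
apply/funext => j; rewrite /line /padd /pscale /upd /unit_vec.
by case: eqP => _; rewrite ?mulr1 ?mulr0 ?add0r ?addr0.
Qed.

Lemma hdiff_upd (sigma : pt -> C) i j a : hdiff sigma a ->
  hdiff (fun z => upd z i (sigma z) j) a.
Proof.
by move=> ds; rewrite /upd; case: eqP => // _; exact: hdiff_proj.
Qed.

Variables (Om V : cset R d) (E : (pt -> C) -> (pt -> C)).
Hypotheses (oOm : is_open Om) (neOm : exists z, Om z) (bOm : bounded_set Om)
  (cOm : convex_set Om) (balOm : balanced Om) (VOm : forall z, V z -> Om z)
  (Eop : isometric_extension_operator Om V E)
  (polyOm : forall z, Om z <-> forall i, cabs (z i) < 1).

Local Notation r := (ext_map E).

Lemma upd_in z i x : Om z -> cabs x < 1 -> Om (upd z i x).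
Proof.
by move=> /polyOm Oz x1; apply/polyOm => j; rewrite /upd; case: eqP.
Qed.

Lemma slice_cdiff (F : pt -> C) z i : (forall a, Om a -> hdiff F a) -> Om z ->
  cdiff_on_disc (fun x => F (upd z i x)) 0 1.
Proof.
move=> dF Oz x; rewrite subr0 => x1.
have -> : (fun x => F (upd z i x)) = fun x => F (line (upd z i 0) (unit_vec i) x).
  by apply/funext => y; rewrite upd_line.
by apply: hdiff_line; rewrite -upd_line; apply: dF; exact: upd_in.
Qed.

(* A bounded family of holomorphic functions tending to a unimodular constant at
   one point tends to it everywhere; applied with the slice variable going to the
   unit circle, this propagates [F = z i] from one slice to all slices. *)
Lemma slice_id_propagates (F : pt -> C) i v : (forall a, Om a -> hdiff F a) ->
  (forall a, Om a -> cabs (F a) <= 1) -> Om v ->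
  (forall x, cabs x < 1 -> F (upd v i x) = x) -> forall z, Om z -> F z = z i.
Proof.
move=> dF F1 Ov Fv z Oz.
pose phi x := F (upd z i x) + -1 * x.
have dphi : cdiff_on_disc phi 0 1.
  move=> x x1; have [c dc] := slice_cdiff i dF Oz x1.
  by eexists; exact: cderivD dc (cderivZ (-1) (cderiv_id x)).
suff H : phi (z i) = 0.
  by move/eqP: H; rewrite /phi upd_self mulN1r subr_eq0 => /eqP.
apply: (zero_of_boundary dphi); last exact: (polyOm z).1.
move=> e e0; apply: contrapT => nex.
have /choice[xn Hxn] (n : nat) : exists x : C, [/\ 1 - n.+1%:R^-1 < cabs x, cabs x < 1 & e < cabs (phi x)].
  apply: contrapT => nx; apply: nex; exists (1 - n.+1%:R^-1).
    by rewrite ltrBlDr ltrDl invr_gt0.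
  move=> x x1 x2; rewrite leNgt; apply/negP => ex; apply: nx; exists x; split => //.
have xn1 n : cabs (xn n) < 1 by have [] := Hxn n.
have [om xom] : exists l, utends xn l by apply: (@utends_ex _ _ 1) => n; exact: ltW.
have om1 : cabs om = 1.
  apply/eqP; rewrite eq_le; apply/andP; split.
    by apply: (utends_le xom); apply: umost_all => n; exact: ltW.
  apply/ler_addgt0Pr => eps eps0; rewrite -lerBlDr.
  apply: (utends_ge xom); apply: umostW (umost_small eps0) => n neps.
  by have [h _ _] := Hxn n; apply: le_trans (ltW h); rewrite lerB// ltW.
pose Fn n a := F (upd a i (xn n)).
have dFn n a : Om a -> hdiff (Fn n) a.
  move=> Oa; apply: hdiff_comp; last by apply: dF; exact: upd_in.
  by move=> j; apply: hdiff_upd; exact: hdiff_cst.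
have Fn1 n a : Om a -> cabs (Fn n a) <= 1 by move=> Oa; apply: F1; exact: upd_in.
have lim a : Om a -> utends (fun n => Fn n a) (ulim (fun n => Fn n a)).
  by move=> Oa; apply: (@ulimP _ _ 1) => n; exact: Fn1.
pose Fl a := ulim (fun n => Fn n a).
have Flv : Fl v = om.
  by apply: ulim_eq; apply: utends_ext xom; apply: umost_all => n; rewrite /Fn Fv.
have Flz : Fl z = Fl v.
  apply: (max_principle_convex oOm cOm (m := 1)) => //; last by rewrite Flv.
    by move=> a Oa; apply: (utends_hdiff oOm dFn Fn1 lim).
  by move=> a Oa; apply: (utends_le (lim a Oa)); apply: umost_all => n; exact: Fn1.
have T : utends (fun n => phi (xn n)) 0.
  have := utendsB (lim z Oz) xom; rewrite -/(Fl z) Flz Flv subrr.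
  by apply: utends_ext; apply: umost_all => n; rewrite /phi /Fn mulN1r.
have [n] := umost_ex (T e e0); rewrite subr0.
by have [_ _ h] := Hxn n; move=> /(lt_trans h); rewrite ltxx.
Qed.

(** As s fixes V, the last clause makes each point of V a function of its coordinates in J. It is
    asked of all points, inside Om or not. *)
Definition section_over (J : {set 'I_d}) (s : pt -> pt) :=
  [/\ forall i a, Om a -> hdiff (fun z => s z i) a,
      forall z, Om z -> Om (s z), forall v, V v -> s v = v &
      forall z z', (forall i, i \in J -> z i = z' i) -> s z = s z'].

(* If [r (s z) i] is not [z i], the averaged slice maps have [v i] as attracting
   fixed point, so the limit of their iterates recovers [v i] from the other
   coordinates. *)
Lemma section_drop_coord J s i z0 : section_over J s -> i \in J -> Om z0 ->
  r (s z0) i != z0 i -> exists s', section_over (J :\ i) s'.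
Proof.
move=> [ds sO sV sJ] iJ Oz0 rz0.
pose G z := r (s z) i.
have rO z : Om z -> Om (r z) by exact: (ext_map_in oOm neOm bOm cOm balOm VOm Eop).
have dG a : Om a -> hdiff G a.
  move=> Oa; apply: (@hdiff_comp _ _ (fun z => r z i) s) => [j|]; first exact: ds.
  by apply: (ext_map_hdiff oOm bOm VOm Eop); exact: sO.
have G1 z : Om z -> cabs (G z) < 1.
  by move=> Oz; apply: (polyOm (r (s z))).1; apply: rO; exact: sO.
have GV v : V v -> G v = v i.
  by move=> Vv; rewrite /G sV// (ext_map_on_V oOm bOm VOm Eop Vv).
(* T changes coordinate i only. On the slice through a point v of V, G is a self-map of the disc
   fixing v i, and T is its average with the identity. *)
pose T w := upd w i (2^-1 * (G w + w i)).
have half (x y : C) : cabs x < 1 -> cabs y < 1 -> cabs (2^-1 * (x + y)) < 1.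
  move=> x1 y1; rewrite cabsM cabsV cabs_two.
  by rewrite mulrC ltr_pdivrMr// mul1r (le_lt_trans (cabsD _ _))// mulr2n ltrD.
have TO w : Om w -> Om (T w).
  by move=> Ow; apply: upd_in => //; apply: half; [exact: G1|exact: (polyOm w).1].
have dT j a : Om a -> hdiff (fun z => T z j) a.
  move=> Oa; apply: hdiff_upd; apply: hdiffZ; apply: hdiffD; first exact: dG.
  exact: hdiff_proj.
have TnO n w : Om w -> Om (iter n T w) by move=> Ow; elim: n => [//|n IH]; exact: TO.
have dTn n j a : Om a -> hdiff (fun z => iter n T z j) a.
  move=> Oa; elim: n j => [|n IH] j; first exact: hdiff_proj.
  rewrite (_ : (fun z => _) = fun z => (fun w => T w j) (iter n T z)); last first.
    by apply/funext => z; rewrite iterS.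
  by apply: (@hdiff_comp _ _ (fun w => T w j) (iter n T)) => //; apply: dT; exact: TnO.
(* Starting from coordinate i equal to 0 removes the dependence on z i. *)
pose sn n z := iter n T (upd z i 0) i.
have zero1 : cabs (0 : C) < 1 by rewrite cabs0.
have dsn n a : Om a -> hdiff (sn n) a.
  move=> Oa; apply: (@hdiff_comp _ _ (fun w => iter n T w i) (fun z => upd z i 0)) => [j|].
    by apply: hdiff_upd; exact: hdiff_cst.
  by apply: dTn; exact: upd_in.
have sn1 n z : Om z -> cabs (sn n z) <= 1.
  by move=> Oz; apply/ltW; apply: (polyOm _).1; apply: TnO; exact: upd_in.
pose sig z := ulim (fun n => sn n z).
have lim z : Om z -> utends (fun n => sn n z) (sig z).
  by move=> Oz; apply: (@ulimP _ _ 1) => n; exact: sn1.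
have dsig a : Om a -> hdiff sig a by exact: (utends_hdiff oOm dsn sn1 lim).
have sigV v : V v -> sig v = v i.
  move=> Vv; have Ov := VOm Vv; apply: ulim_eq.
  pose g x := G (upd v i x).
  have dg : cdiff_on_disc g 0 1 by exact: slice_cdiff.
  have g1 x : cabs x < 1 -> cabs (g x) < 1 by move=> x1; apply: G1; exact: upd_in.
  have ga : g (v i) = v i by rewrite /g upd_self GV.
  (* Were the slice map through v the identity, propagation to all slices would give
     [G z0 = z0 i]. *)
  have [b b1 gb] : exists2 b : C, cabs b < 1 & g b != b.
    apply: contrapT => nb; move/eqP: rz0; apply.
    apply: (@slice_id_propagates G i v) => // [a Oa|x x1]; first exact/ltW/G1.
    by apply: contrapT => /eqP gx; apply: nb; exists x.
  have := averaged_iterates dg g1 ((polyOm v).1 Ov i) ga b1 gb.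
  apply: utends_ext; apply: umost_all => n.
  rewrite /sn; suff -> : iter n T (upd v i 0) = upd v i (iter n (fun x => (g x + x) / 2) 0).
    by rewrite upd_same.
  elim: n => [//|n IH]; rewrite !iterS IH /T upd_upd upd_same.
  by rewrite mulrC.
have [v0 Vv0] := V_nonempty oOm neOm VOm Eop.
have sig1 z : Om z -> cabs (sig z) < 1.
  move=> Oz.
  have le1 w : Om w -> cabs (sig w) <= 1.
    by move=> Ow; apply: (utends_le (lim w Ow)); apply: umost_all => n; exact: sn1.
  rewrite lt_neqAle le1// andbT; apply/eqP => e.
  have := max_principle_convex oOm cOm dsig le1 Oz e (VOm Vv0).
  rewrite sigV// => e'; have := (polyOm v0).1 (VOm Vv0) i.
  by rewrite e' e ltxx.
exists (fun z => s (upd z i (sig z))); split.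
- move=> j a Oa; apply: (@hdiff_comp _ _ (fun w => s w j) (fun z => upd z i (sig z))) => [k|].
    by apply: hdiff_upd; exact: dsig.
  by apply: ds; apply: upd_in => //; exact: sig1.
- by move=> z Oz; apply: sO; apply: upd_in => //; exact: sig1.
- by move=> v Vv; rewrite sigV// upd_self sV.
- move=> z z' zz'; apply: (sJ) => j jJ; rewrite /upd; case: eqP => [_|/eqP ji]; last first.
    by apply: zz'; rewrite !inE ji.
  rewrite /sig; congr ulim; apply/funext => n; rewrite /sn.
  suff H : forall j, j \in J -> iter n T (upd z i 0) j = iter n T (upd z' i 0) j by exact: H.
  elim: n => [|n IH] k kJ /=.
    by rewrite /upd; case: eqP => // /eqP ki; apply: zz'; rewrite !inE ki.
  rewrite /T /upd; case: eqP => _; last exact: IH.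
  by rewrite /G (sJ _ _ IH) IH.
Qed.

Lemma minimal_section : exists J s, section_over J s /\
  forall i, i \in J -> forall z, Om z -> r (s z) i = z i.
Proof.
have H (n : nat) : forall (J : {set 'I_d}) (s : pt -> pt), (#|J| <= n)%N -> section_over J s ->
    exists J s, section_over J s /\ forall i, i \in J -> forall z, Om z -> r (s z) i = z i.
  elim: n => [|n IH] J s Jn hs.
    by exists J, s; split => // i; move: Jn; rewrite leqn0 cards_eq0 => /eqP ->; rewrite inE.
  have [ok|nok] := pselect (forall i, i \in J -> forall z, Om z -> r (s z) i = z i).
    by exists J, s.
  have [i [z [iJ Oz rz]]] : exists i z, [/\ i \in J, Om z & r (s z) i != z i].
    apply: contrapT => nex; apply: nok => i iJ z Oz.
    by apply: contrapT => /eqP rz; apply: nex; exists i, z.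
  have [s' hs'] := section_drop_coord hs iJ Oz rz.
  by apply: IH hs'; move: Jn; rewrite (cardsD1 i) iJ.
apply: (H #|[set: 'I_d]| [set: 'I_d] id) => //; split => //.
- by move=> i a _; exact: hdiff_proj.
- by move=> z z' zz'; apply/funext => i; apply: zz'; rewrite inE.
Qed.

(** With A = |1 + u| and B = |1 - u|, the parallelogram law gives A^2 + B^2 <= 4, while completing
    squares gives A / 2 <= A^2 / 8 + 1/2 and t B <= B^2 / 8 + 2 t^2. *)
Lemma half_sum_le (u : C) (t : R) : cabs u <= 1 -> 0 <= t ->
  cabs (2^-1 * (1 + u)) + t * cabs (1 - u) <= 1 + 2 * t ^+ 2.
Proof.
move=> u1 t0; rewrite cabsM cabsV cabs_two.
have u2 : cabs u ^+ 2 <= 1 by rewrite exprn_ile1 ?cabs_ge0.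
have par : cabs (1 + u) ^+ 2 + cabs (1 - u) ^+ 2 = 2 + 2 * cabs u ^+ 2.
  by rewrite !cabs_sqr !cReD !cImD; case: u {u1 u2} => ? ? /=; ring.
move: u2 par; set A := cabs (1 + u); set B := cabs (1 - u); set p := cabs u ^+ 2.
move=> p1 par.
have h1 : 0 <= (A - 2) ^+ 2 by rewrite sqr_ge0.
have h2 : 0 <= (B - 4 * t) ^+ 2 by rewrite sqr_ge0.
have e1 : (A - 2) ^+ 2 = A ^+ 2 - 4 * A + 4 by ring.
have e2 : (B - 4 * t) ^+ 2 = B ^+ 2 - 8 * (t * B) + 16 * t ^+ 2 by ring.
move: h1 h2 par p1; rewrite e1 e2; set a := A ^+ 2; set b := B ^+ 2; set c := t * B.
set q := t ^+ 2; rewrite -[_^-1]/(2^-1).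
by clear; move=> *; lra.
Qed.

(* At points where [z i] is close to the unit circle, the norm-one functional
   [f |-> E f (s z)] is concentrated where [w i] is close to [z i]. *)
Lemma functional_concentrated J s i f (M t : R) z : section_over J s ->
  (forall z, Om z -> r (s z) i = z i) -> Hinf_var V f -> 0 < M ->
  (forall v, V v -> cabs (f v) <= M) -> 0 < t -> Om z -> z i != 0 ->
  cabs (E (fun w => w i * f w) (s z) - z i * E f (s z)) <=
    M * (2 * t + (1 - cabs (z i)) / (2 * t) + (1 - cabs (z i))).
Proof.
move=> [ds sO sV sJ] rs Hf M0 fM t0 Oz zi0.
have Os := sO z Oz.
have zi1 : cabs (z i) < 1 by exact: (polyOm z).1.
pose c' := z i / rC (cabs (z i)).
have czi : 0 < cabs (z i) by rewrite cabs_gt0.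
have rz0 : rC (cabs (z i)) != 0 by apply/eqP => /(@rC_inj R _ 0)/eqP; rewrite gt_eqF.
have c'1 : cabs c' = 1 by rewrite cabsM cabsV cabs_rC ger0_norm ?cabs_ge0// divff ?gt_eqF.
have cc : conjc c' * c' = 1 by rewrite mulrC -sqr_cabs_conj c'1 expr1n.
have zc : z i = rC (cabs (z i)) * c' by rewrite /c' mulrCA divff// mulr1.
have Hp := Hinf_proj oOm bOm VOm i.
have Hz : Hinf_var V (fun w => w i * f w) by exact: HinfM.
have Hc k := Hinf_cst oOm VOm k.
pose L f := E f (s z).
have Lp : L (fun w => w i) = z i by rewrite -[RHS](rs z Oz).
pose D := L (fun w => w i * f w) - c' * L f.
pose u w := conjc c' * w i.
have Hu : Hinf_var V u by exact: (HinfZ oOm VOm).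
have Luf : L (fun w => f w + -1 * (conjc c' * (w i * f w))) = - conjc c' * D.
  rewrite /L (extD oOm VOm Eop)//; last by do 2! apply: (HinfZ oOm VOm).
  rewrite (extZ oOm VOm Eop)//; last exact: (HinfZ oOm VOm).
  rewrite (extZ oOm VOm Eop)// /D /L.
  rewrite [LHS](_ : _ = - conjc c' * (E (fun w => w i * f w) (s z) - c' * E f (s z)) +
    (1 - conjc c' * c') * E f (s z)); last by ring.
  by rewrite cc subrr mul0r addr0.
have [th th1 thE] := phase_ex (- conjc c' * D).
(* A test function: under E, at s z, its first summand becomes (1 + |z i|) / 2, nearly 1, and the
   phase [th] makes the second contribute t |D| / M. As |k| <= 1 + 2 t^2 on V, only a small D is
   possible. *)
pose k w := 2^-1 * (1 + u w) + (rC (t / M) * th) * (f w + -1 * (conjc c' * (w i * f w))).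
have H1 : Hinf_var V (fun w => 1 + u w) by exact: HinfD (Hc 1) Hu.
have H2 : Hinf_var V (fun w => f w + -1 * (conjc c' * (w i * f w))).
  by apply: HinfD => //; do 2! apply: (HinfZ oOm VOm).
have Hk : Hinf_var V k by apply: HinfD; exact: (HinfZ oOm VOm).
have kb v : V v -> cabs (k v) <= 1 + 2 * t ^+ 2.
  move=> Vv; have u1 : cabs (u v) <= 1.
    by rewrite /u cabsM cabs_conj c'1 mul1r ltW//; exact: ((polyOm v).1 (VOm Vv)).
  apply: le_trans (half_sum_le u1 (ltW t0)).
  rewrite (le_trans (cabsD _ _))// lerD2l !cabsM th1 mulr1 cabs_rC gtr0_norm ?divr_gt0//.
  have -> : f v + -1 * (conjc c' * (v i * f v)) = f v * (1 - u v) by rewrite /u; ring.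
  rewrite cabsM mulrA ler_wpM2r ?cabs_ge0// -mulrA.
  by apply: ler_piMr; [exact: ltW|rewrite mulrC ler_pdivrMr// mul1r fM].
have := ext_le Eop Hk kb Os.
have -> : E k (s z) = rC (2^-1 * (1 + cabs (z i)) + t / M * cabs D).
  rewrite /k (extD oOm VOm Eop (HinfZ oOm VOm _ H1) (HinfZ oOm VOm _ H2) Os).
  rewrite (extZ oOm VOm Eop _ H1 Os) (extZ oOm VOm Eop _ H2 Os).
  rewrite (extD oOm VOm Eop (Hc 1) Hu Os) (ext_cst oOm neOm cOm VOm Eop _ Os).
  rewrite /u (extZ oOm VOm Eop)// -/(L (fun w => w i)) Lp.
  rewrite -[E _ (s z)]/(L _) Luf -mulrA thE cabsM cabsN cabs_conj c'1 mul1r.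
  have -> : conjc c' * z i = rC (cabs (z i)) by rewrite {1}zc mulrCA cc mulr1.
  rewrite rCD !rCM rCD rC1; congr (_ * _ + _).
  by rewrite /rC fmorphV rmorph_nat.
rewrite cabs_rC ger0_norm; last first.
  by rewrite addr_ge0 ?mulr_ge0 ?addr_ge0 ?cabs_ge0 ?invr_ge0 ?ltW.
move=> h.
have hD : cabs D <= M * (2 * t + (1 - cabs (z i)) / (2 * t)).
  have h1 : t / M * cabs D <= 2 * t ^+ 2 + (1 - cabs (z i)) / 2.
    by move: h; clear -oOm neOm bOm cOm balOm VOm Eop polyOm; move=> *; lra.
  rewrite -(ler_pM2l (divr_gt0 t0 M0)) (le_trans h1)// le_eqVlt; apply/orP; left.
  by apply/eqP; field; rewrite !gt_eqF.
have -> : E (fun w => w i * f w) (s z) - z i * E f (s z) =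
    D + (1 - rC (cabs (z i))) * (c' * E f (s z)).
  by rewrite /D /L {1}zc; ring.
rewrite (le_trans (cabsD _ _))// mulrDr lerD// -rC1 -rCB cabsM cabs_rC.
have z01 : 0 <= 1 - cabs (z i) by rewrite subr_ge0 ltW.
rewrite ger0_norm// cabsM c'1 mul1r mulrC; apply: ler_wpM2r => //.
exact: (ext_le Eop Hf fM Os).
Qed.

(** The difference of the two sides is holomorphic in z i on each slice and tends to 0 as |z i|
    tends to 1 by the concentration estimate, so it vanishes. *)
Lemma functional_module J s i f z : section_over J s ->
  (forall z, Om z -> r (s z) i = z i) -> Hinf_var V f -> Om z ->
  E (fun w => w i * f w) (s z) = z i * E f (s z).
Proof.
move=> hs rs Hf Oz; have [ds sO sV sJ] := hs.
have [M M0 fM] : exists2 M : R, 0 < M & forall v, V v -> cabs (f v) <= M.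
  have [_ /bounded_onP[M HM]] := Hf; exists (`|M| + 1); first by rewrite ltr_wpDl.
  by move=> v /HM h; rewrite (le_trans h)// (le_trans (ler_norm M))// lerDl.
have Hz : Hinf_var V (fun w => w i * f w) by apply: HinfM => //; exact: (Hinf_proj oOm bOm VOm).
have dE g a : Hinf_var V g -> Om a -> hdiff (fun z => E g (s z)) a.
  move=> Hg Oa; apply: hdiff_comp => [j|]; first exact: ds.
  by apply: (ext_holo Eop Hg); exact: sO.
pose Phi a := E (fun w => w i * f w) (s a) - a i * E f (s a).
have dPhi a : Om a -> hdiff Phi a.
  move=> Oa; apply: hdiffB; first exact: dE.
  by apply: hdiffM; [exact: hdiff_proj|exact: dE].
have zi1 : cabs (z i) < 1 by exact: (polyOm z).1.
suff H : Phi (upd z i (z i)) = 0.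
  by move/eqP: H; rewrite upd_self /Phi subr_eq0 => /eqP.
apply: (zero_of_boundary (slice_cdiff i dPhi Oz)) zi1 => e e0.
(* This [t] makes the first term of the estimate e / 2; [eta] bounds the other two together by e /
   2, and its cap 1/2 keeps x away from 0. *)
pose t := e / (4 * M).
have t0 : 0 < t by rewrite divr_gt0// mulr_gt0.
pose eta := Num.min (1 / 2) (e / (2 * M) / (1 / (2 * t) + 1)).
have B0 : 0 < 1 / (2 * t) + 1 by rewrite addr_gt0// divr_gt0// mulr_gt0.
have eta0 : 0 < eta by rewrite lt_min !divr_gt0// mulr_gt0.
exists (1 - eta); first by rewrite ltrBlDr ltrDl.
move=> x x1 x2; have Ou := upd_in i Oz x2.
have x0 : x != 0.
  have : eta <= 1 / 2 by rewrite ge_min lexx.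
  rewrite -cabs_gt0; move: x1; clear -oOm neOm bOm cOm balOm VOm Eop polyOm.
  by move=> *; lra.
have := @functional_concentrated J s i f M t (upd z i x) hs rs Hf M0 fM t0 Ou.
rewrite upd_same => /(_ x0); rewrite /Phi upd_same => /le_trans; apply.
have h1 : 1 - cabs x <= eta by move: x1; clear -oOm neOm bOm cOm balOm VOm Eop polyOm; move=> *; lra.
have h2 : (1 - cabs x) * (1 / (2 * t) + 1) <= e / (2 * M).
  by rewrite -ler_pdivlMr// (le_trans h1)// ge_min lexx orbT.
have -> : e = M * (2 * t + e / (2 * M)) by rewrite /t; field; rewrite gt_eqF.
rewrite ler_pM2l// -addrA lerD2l (le_trans _ h2)// le_eqVlt; apply/orP; left.
by apply/eqP; field; rewrite gt_eqF.
Qed.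

(** * The ideal annihilated by the functional at s z0 *)

Section Conclusion.
Variables (J : {set 'I_d}) (s : pt -> pt).
Hypotheses (hs : section_over J s)
  (rs : forall i, i \in J -> forall z, Om z -> r (s z) i = z i).

Variable z0 : pt.
Hypothesis Oz0 : Om z0.

(** The largest ideal of H^oo(V) contained in the kernel of f |-> E f (s z0). *)
Definition annihilated (f : pt -> C) := Hinf_var V f /\
  forall g, Hinf_var V g -> E (fun w => f w * g w) (s z0) = 0.

Let sO z : Om z -> Om (s z).
Proof. by case: hs => _ H _ _; exact: H. Qed.

Let HD f g := @HinfD R d V f g.
Let HM f g := @HinfM R d V f g.
Let HC := Hinf_cst oOm VOm.
Let HZ := HinfZ oOm VOm.

Lemma annihilated_eq f g : (forall v, V v -> f v = g v) -> Hinf_var V g ->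
  annihilated f -> annihilated g.
Proof.
move=> fg Hg [Hf H]; split => // h Hh; rewrite -(H h Hh).
apply: (ext_eq Eop); [exact: HM|exact: HM| |exact: sO].
by move=> v Vv; rewrite fg.
Qed.

Lemma annihilatedD f g : annihilated f -> annihilated g -> annihilated (fun w => f w + g w).
Proof.
move=> [Hf hf] [Hg hg]; split; first exact: HD.
move=> h Hh; rewrite -[RHS]addr0 -{1}(hf h Hh) -(hg h Hh) -(extD oOm VOm Eop); last 3 first.
- exact: HM.
- exact: HM.
- exact: sO.
by congr (E _ _); apply/funext => w; rewrite mulrDl.
Qed.

Lemma annihilatedM f g : annihilated f -> Hinf_var V g -> annihilated (fun w => f w * g w).
Proof.
move=> [Hf hf] Hg; split; first exact: HM.
move=> h Hh; rewrite -(hf _ (HM Hg Hh)).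
by congr (E _ _); apply/funext => w; rewrite mulrA.
Qed.

Lemma annihilated0 : annihilated (fun=> 0).
Proof.
split; first exact: HC.
move=> g Hg; rewrite (_ : (fun w => 0 * g w) = fun=> 0); first exact: (ext0 oOm VOm Eop (sO Oz0)).
by apply/funext => w; rewrite mul0r.
Qed.

Lemma annihilated_sum n (F : 'I_n -> pt -> C) : (forall k, annihilated (F k)) ->
  annihilated (fun w => \sum_k F k w).
Proof.
move=> HF; suff H (t : seq 'I_n) : annihilated (fun w => \sum_(k <- t) F k w) by exact: H.
elim: t => [|k t IH].
  rewrite (_ : (fun w => _) = fun=> 0); first exact: annihilated0.
  by apply/funext => w; rewrite big_nil.
rewrite (_ : (fun w => _) = fun w => F k w + \sum_(l <- t) F l w); first exact: annihilatedD.
by apply/funext => w; rewrite big_cons.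
Qed.

(** The radical of an ideal is closed under sums: every binomial term contains f^m or g^n. *)
Lemma annihilated_radicalD f g m n : Hinf_var V f -> Hinf_var V g ->
  annihilated (fun w => f w ^+ m) -> annihilated (fun w => g w ^+ n) ->
  annihilated (fun w => (f w + g w) ^+ (m + n)).
Proof.
move=> Hf Hg hf hg.
have HX h k : Hinf_var V h -> Hinf_var V (fun w => h w ^+ k) by exact: (HinfX oOm VOm).
rewrite (_ : (fun w => _) = fun w => \sum_(i < (m + n).+1)
    f w ^+ (m + n - i) * g w ^+ i *+ 'C(m + n, i)); last first.
  by apply/funext => w; rewrite exprDn.
apply: annihilated_sum => i.
have [ni|ni] := leqP n i.
  rewrite (_ : (fun w => _) = fun w => g w ^+ n *
      (g w ^+ (i - n) * (f w ^+ (m + n - i) * ('C(m + n, i))%:R))).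
    by apply: annihilatedM => //; apply: HM; [exact: HX|apply: HM; [exact: HX|exact: HC]].
  apply/funext => w; rewrite mulrA -exprD subnKC// -mulr_natr; ring.
rewrite (_ : (fun w => _) = fun w => f w ^+ m *
    (f w ^+ (n - i) * (g w ^+ i * ('C(m + n, i))%:R))).
  by apply: annihilatedM => //; apply: HM; [exact: HX|apply: HM; [exact: HX|exact: HC]].
by apply/funext => w; rewrite mulrA -exprD addnBA 1?ltnW// -mulr_natr mulrA.
Qed.

Variable P : pt -> C.
Hypothesis pP : polyfun P.

Let h z := P (s z).

(** Passes from z at n = 0 to z0 at n = d one coordinate at a time, so that consecutive points lie
    in a common slice. *)
Definition hyb z (n : nat) : pt := fun j => if (j < n)%N then z0 j else z j.

Lemma hyb0 z : hyb z 0 = z.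
Proof. by apply/funext. Qed.

Lemma hyb_all z : hyb z d = z0.
Proof. by apply/funext => j; rewrite /hyb ltn_ord. Qed.

Lemma hyb_in z n : Om z -> Om (hyb z n).
Proof.
move=> /polyOm Oz; apply/polyOm => j; rewrite /hyb; case: ifP => // _.
exact: ((polyOm z0).1 Oz0).
Qed.

Lemma hyb_upd z j : hyb z j = upd (hyb z j) j (z j).
Proof. by rewrite -{1}(upd_self (hyb z j) j) {2}/hyb ltnn. Qed.

Lemma hyb_updS z j : hyb z j.+1 = upd (hyb z j) j (z0 j).
Proof.
apply/funext => k; rewrite /hyb /upd ltnS leq_eqVlt.
case: (eqVneq k j) => [->|kj]; first by rewrite eqxx.
by rewrite (_ : (k == j :> nat) = false)//; exact/negbTE.
Qed.

Definition kdiff j z := h (hyb z j) - h (hyb z j.+1).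

Let dh a : Om a -> hdiff h a.
Proof.
case: hs => ds _ _ _ Oa; apply: hdiff_comp => [j|]; first exact: ds.
exact: polyfun_hdiff.
Qed.

Let hbound : exists2 B : R, 0 < B & forall z, Om z -> cabs (h z) <= B.
Proof.
have [B HB] := polyfun_bounded pP (bounded_cabs bOm).
exists (`|B| + 1); first by rewrite ltr_wpDl.
move=> z /sO/HB hz; rewrite (le_trans hz)// (le_trans (ler_norm B))// lerDl//.
Qed.

Lemma hdiff_hyb n a : Om a -> hdiff (fun z => h (hyb z n)) a.
Proof.
move=> Oa; apply: hdiff_comp => [j|]; last by apply: dh; exact: hyb_in.
by rewrite /hyb; case: (j < n)%N; [exact: hdiff_cst|exact: hdiff_proj].
Qed.

Lemma hdiff_kdiff j a : Om a -> hdiff (kdiff j) a.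
Proof. by move=> Oa; apply: hdiffB; exact: hdiff_hyb. Qed.

(** The two points differ in coordinate j only: close to z0 j this is the Lipschitz bound in a disc
    of radius [rho], elsewhere the bound 2 B suffices. *)
Lemma kdiff_le j : exists2 K : R, 0 < K & forall z, Om z ->
  cabs (kdiff j z) <= K * cabs (z j - z0 j).
Proof.
have [B B0 hB] := hbound.
pose rho := 1 - cabs (z0 j).
have rho0 : 0 < rho by rewrite subr_gt0; exact: ((polyOm z0).1 Oz0).
exists (8 * B / rho); first by rewrite divr_gt0// mulr_gt0.
move=> z Oz; rewrite /kdiff hyb_updS [in X in X - _](hyb_upd z j).
pose phi x := h (upd (hyb z j) j x); rewrite -/(phi (z j)) -/(phi (z0 j)).
have Oh := hyb_in j Oz.
have sub x : cabs (x - z0 j) < rho -> cabs x < 1.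
  move=> xr; rewrite -(subrK (z0 j) x) (le_lt_trans (cabsD _ _))//.
  by rewrite -ltrBrDr.
have [zj|zj] := ltP (cabs (z j - z0 j)) rho.
  apply: Lipschitz_disc => // x /sub x1.
    by apply: (slice_cdiff j dh Oh); rewrite subr0.
  by apply: hB; exact: upd_in.
have b1 : cabs (phi (z j)) <= B by apply: hB; apply: upd_in => //; exact: ((polyOm z).1 Oz).
have b2 : cabs (phi (z0 j)) <= B by apply: hB; apply: upd_in => //; exact: ((polyOm z0).1 Oz0).
rewrite (le_trans (cabsB _ _))// (le_trans (lerD b1 b2))//.
rewrite mulrAC ler_pdivlMr//.
have : (B + B) * rho <= (B + B) * cabs (z j - z0 j) by rewrite ler_wpM2l// ltW// addr_gt0.
have : 0 <= B * cabs (z j - z0 j) by rewrite mulr_ge0 ?cabs_ge0// ltW.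
by rewrite !mulrDl; set p := B * cabs _; set q := B * rho; rewrite -mulrA -/p; lra.
Qed.

(* Cubing removes the singularity: [kdiff j ^+ 3 / (z j - z0 j)] vanishes to
   second order where the denominator does (and there takes the value [0]). *)
Lemma Hinf_kdiff_quotient j :
  Hinf_var V (fun z => kdiff j z ^+ 3 * (z j - z0 j)^-1).
Proof.
have [K K0 HK] := kdiff_le j.
have q_le z : Om z -> cabs (kdiff j z ^+ 3 * (z j - z0 j)^-1) <= K ^+ 3 * cabs (z j - z0 j) ^+ 2.
  move=> Oz; have [zz|zz] := eqVneq (z j - z0 j) 0.
    by rewrite zz invr0 mulr0 cabs0 expr0n mulr0.
  have zp : 0 < cabs (z j - z0 j) by rewrite cabs_gt0.
  rewrite cabsM cabsV cabsX ler_pdivrMr// -mulrA -exprSr -exprMn.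
  by rewrite lerXn2r ?nnegrE ?cabs_ge0 ?HK// mulr_ge0 ?cabs_ge0// ltW.
apply: (Hinf_restrict oOm VOm); last first.
  exists (K ^+ 3 * 2 ^+ 2) => z Oz; rewrite (le_trans (q_le z Oz))//.
  rewrite ler_wpM2l ?exprn_ge0 ?(ltW K0)// lerXn2r ?nnegrE ?cabs_ge0//.
  rewrite (le_trans (cabsB _ _))// mulr2n lerD ?ltW//.
    exact: ((polyOm z).1 Oz).
  exact: ((polyOm z0).1 Oz0).
move=> a Oa; have [aa|aa] := eqVneq (a j - z0 j) 0; last first.
  apply: hdiffM; first by apply: hdiffX; exact: hdiff_kdiff.
  apply: hdiffV => //; apply: hdiffB; first exact: hdiff_proj.
  exact: hdiff_cst.
have [e e0 He] := is_open_l1 oOm Oa.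
exists (fun=> 0) => eps eps0.
have K3 : 0 < K ^+ 3 by rewrite exprn_gt0.
exists (Num.min e (eps / K ^+ 3)); first by rewrite lt_min e0 divr_gt0.
move=> t; rewrite lt_min => /andP[te teps].
rewrite aa invr0 mulr0 subr0 /pairing big1 => [|k _]; last by rewrite mul0r.
rewrite subr0 (le_trans (q_le _ (He t te)))//.
have -> : padd a t j - z0 j = t j by rewrite /padd addrAC aa add0r.
have tj := cabs_le_l1norm t j.
apply: (@le_trans _ _ (K ^+ 3 * l1norm t * l1norm t)).
  rewrite expr2 mulrA; apply: ler_pM; rewrite ?cabs_ge0//.
    by apply: mulr_ge0; [exact: ltW|exact: cabs_ge0].
  by apply: ler_wpM2l => //; exact: ltW.
rewrite ler_wpM2r ?l1norm_ge0// mulrC -ler_pdivlMr//; exact: ltW.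
Qed.

Lemma Hinf_kdiff j : Hinf_var V (kdiff j).
Proof.
apply: (Hinf_restrict oOm VOm) => [a Oa|]; first exact: hdiff_kdiff.
have [B B0 hB] := hbound; exists (B + B) => z Oz.
by rewrite (le_trans (cabsB _ _))// lerD// hB//; exact: hyb_in.
Qed.

(** For j outside J, s does not see the change of coordinate and [kdiff j] is 0. For j in J the cube
    is (w j - z0 j) times a bounded holomorphic function, and [functional_module] shows that such
    products are killed. *)
Lemma annihilated_kdiff j : annihilated (fun z => kdiff j z ^+ 3).
Proof.
have Hk := HinfX oOm VOm 3 (Hinf_kdiff j).
have [jJ|jJ] := boolP (j \in J); last first.
  apply: annihilated_eq (annihilated0) => // v Vv; rewrite /kdiff.
  case: hs => _ _ _ sJ; suff -> : h (hyb v j) = h (hyb v j.+1) by rewrite subrr expr0n.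
  congr P; apply: sJ => i iJ; rewrite hyb_updS /upd; case: eqP => // ij.
  by move: jJ; rewrite -ij iJ.
have [K K0 HK] := kdiff_le j.
have Hq := Hinf_kdiff_quotient j.
have Hp := Hinf_proj oOm bOm VOm j.
split=> // g Hg.
pose q z := kdiff j z ^+ 3 * (z j - z0 j)^-1 * g z.
have Hqg : Hinf_var V q by exact: HM.
have Hm : Hinf_var V (fun w => w j * q w) by exact: HM.
have -> : E (fun w => kdiff j w ^+ 3 * g w) (s z0) =
    E (fun w => w j * q w + - z0 j * q w) (s z0).
  apply: (ext_eq Eop); [exact: HM|by apply: HD => //; exact: HZ| |exact: sO].
  (* Where v j = z0 j the inverse is 0 by convention, and the factorization holds because [kdiff j]
     vanishes there. *)
  move=> v Vv; rewrite -mulrDl /q; have [vz|vz] := eqVneq (v j - z0 j) 0; last by field.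
  have k0 : kdiff j v = 0.
    apply/eqP; rewrite -cabs_eq0 eq_le cabs_ge0 andbT.
    by have := HK v (VOm Vv); rewrite vz cabs0 mulr0.
  by rewrite k0 expr0n !mul0r mulr0.
rewrite (extD oOm VOm Eop)//; [|exact: HZ|exact: sO].
rewrite (extZ oOm VOm Eop)//; last exact: sO.
by rewrite (functional_module hs (rs jJ))// mulNr subrr.
Qed.

Lemma kdiff_sum z : \sum_(j < d) kdiff j z = h z - h z0.
Proof.
rewrite -[in RHS](hyb0 z) -[in X in _ - X](hyb_all z).
rewrite -(big_mkord xpredT (fun n => h (hyb z n) - h (hyb z n.+1))).
rewrite -opprB -(telescope_sumr (fun n => h (hyb z n)) (leq0n d)) -sumrN.
by apply: eq_bigr => n _; rewrite opprB.
Qed.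

Lemma annihilated_kdiff_sum : exists n, annihilated (fun z => (h z - h z0) ^+ n).
Proof.
suff [n Hn] : exists n, annihilated (fun z => (\sum_(j < d) kdiff j z) ^+ n).
  by exists n; rewrite (_ : (fun z => _) = fun z => (\sum_(j < d) kdiff j z) ^+ n)//;
    apply/funext => z; rewrite kdiff_sum.
have H (t : seq 'I_d) : Hinf_var V (fun z => \sum_(j <- t) kdiff j z) /\
    exists n, annihilated (fun z => (\sum_(j <- t) kdiff j z) ^+ n).
  elim: t => [|j t [IH [n IHn]]].
    have e : (fun z => \sum_(j <- [::]) kdiff j z) = fun=> 0.
      by apply/funext => z; rewrite big_nil.
    split; first by rewrite e; exact: HC.
    (* Exponent 1, since the zeroth power of the empty sum is 1, which is not annihilated. *)
    exists 1%N; rewrite (_ : (fun z => _) = fun=> 0); first exact: annihilated0.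
    by apply/funext => z; rewrite big_nil expr1.
  have e : (fun z => \sum_(i <- j :: t) kdiff i z) =
      fun z => kdiff j z + \sum_(i <- t) kdiff i z.
    by apply/funext => z; rewrite big_cons.
  split; first by rewrite e; apply: HD => //; exact: Hinf_kdiff.
  exists (3 + n)%N; rewrite (_ : (fun z => _) = fun z =>
      (kdiff j z + \sum_(i <- t) kdiff i z) ^+ (3 + n)).
    by apply: annihilated_radicalD => //; [exact: Hinf_kdiff|exact: annihilated_kdiff].
  by apply/funext => z; rewrite big_cons.
by have [_] := H (index_enum _).
Qed.

Lemma section_value_le (c : R) : (forall v, V v -> cabs (P v) <= c) -> cabs (P (s z0)) <= c.
Proof.
move=> Pc; rewrite leNgt; apply/negP => cP.
have [n [Hn An]] := annihilated_kdiff_sum.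
have [_ _ sV _] := hs.
have d0 : 0 < cabs (P (s z0)) - c by rewrite subr_gt0.
have lb v : V v -> cabs (P (s z0)) - c <= cabs (h v - h z0).
  move=> Vv; have := cabs_ger (h z0) (h v); rewrite cabsC.
  have := Pc v Vv; rewrite -{1}(sV v Vv) -/(h v) -/(h z0).
  by lra.
have Hi : Hinf_var V (fun z => (h z - h z0)^-1).
  apply: (HinfV oOm VOm d0) lb => a Oa.
  by apply: hdiffB; [exact: dh|exact: hdiff_cst].
have := An _ (HinfX oOm VOm n Hi).
have -> : E (fun w => (h w - h z0) ^+ n * (h w - h z0)^-1 ^+ n) (s z0) = E (fun=> 1) (s z0).
  apply: (ext_eq Eop); [|exact: HC| |exact: sO].
    by apply: HM => //; exact: (HinfX oOm VOm n Hi).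
  move=> v Vv; rewrite -exprMn divff ?expr1n// -cabs_gt0.
  exact: lt_le_trans d0 (lb v Vv).
rewrite (ext_cst oOm neOm cOm VOm Eop 1 (sO Oz0)) => /eqP.
by rewrite oner_eq0.
Qed.

End Conclusion.

Lemma retract_of_polydisk : rel_poly_convex Om V -> retract Om V.
Proof.
move=> rpc; have [J [s [hs rs]]] := minimal_section.
have [ds sO sV _] := hs.
apply: (@retract_of_map _ _ Om V oOm VOm s) => // z Oz.
apply: (rel_poly_convex_hull rpc); first exact: sO.
by move=> P c pP Pc; exact: (section_value_le hs rs Oz pP Pc).
Qed.

End Polydisk.

Theorem theorem1p6 (R : realType) (d : nat) (Om V : cset R d)
    (E : (pt R d -> R[i]) -> (pt R d -> R[i])) :
  domain Om -> bounded_set Om -> convex_set Om -> balanced Om ->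
  analytic_subvariety Om V -> rel_poly_convex Om V ->
  isometric_extension_operator Om V E ->
  ((forall z, Om z <-> polydisk z) \/ strictly_convex Om \/ multiplicative_op Om V E) ->
  retract Om V.
Proof.
move=> [oOm [neOm _]] bOm cOm balOm [VOm _] rpc Eop [polyOm|[scOm|multE]].
- apply: (retract_of_polydisk oOm neOm bOm cOm balOm VOm Eop) => // z.
  split=> [/polyOm Oz i|Oz]; first by rewrite -rC_lt -normcE_cabs; exact: Oz.
  by apply/polyOm => i; rewrite normcE_cabs -rC1 rC_lt.
- exact: (retract_of_strictly_convex oOm neOm bOm cOm balOm VOm Eop scOm).
- exact: (retract_of_multiplicative oOm neOm bOm cOm balOm VOm Eop).
Qed.
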